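(* Suppose $0<p,\lambda<1$ and let $g$ be an analytic function on the unit disc $\mathbb{D}$. Let $M_g(f)=gf$ be the operator of multiplication by $g$. Then: (1) If $g\in\mathcal{W}_p\cap H^\infty$, then $M_g:\mathcal{D}_p^{\lambda}\to\mathcal{D}_p^{\lambda}$ is bounded. (2) If $g\in\mathcal{Q}_{p\lambda}\cap H^\infty$, then $M_g:\mathcal{D}_p^{\lambda}\to\mathcal{D}_p^{\lambda}$ is bounded. (3) If $M_g:\mathcal{D}_p^{\lambda}\to\mathcal{D}_p^{\lambda}$ is bounded, then $g\in\mathcal{Q}_p\cap H^\infty$.
   Context: $\mathbb{D}$ is the open unit disc in $\mathbb{C}$, $dm$ is planar Lebesgue measure normalized so that $m(\mathbb{D})=1$, and $\mathcal{H}ol(\mathbb{D})$ is the space of analytic functions on $\mathbb{D}$. For $a\in\mathbb{D}$, $\varphi_a(z)=\frac{a-z}{1-\bar a z}$. $H^\infty$ is the space of bounded analytic functions on $\mathbb{D}$. For $p\ge 0$, the weighted Dirichlet space $\mathcal{D}_p$ consists of all $f\in\mathcal{H}ol(\mathbb{D})$ with $\|f\|_{\mathcal{D}_p}^2=|f(0)|^2+\int_{\mathbb{D}}|f'(z)|^2(1-|z|^2)^p\,dm(z)<\infty$. For $0<p<1$, $\mathcal{Q}_p$ is the space of all $f\in\mathcal{H}ol(\mathbb{D})$ with $\|f\|_{\mathcal{Q}_p}=|f(0)|+\sup_{a\in\mathbb{D}}\|f\circ\varphi_a-f(a)\|_{\mathcal{D}_p}<\infty$. A positive Borel measure $\mu$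 on $\mathbb{D}$ is a $\mathcal{D}_p$-Carleson measure if there is a constant $C=C(\mu)$ such that $\int_{\mathbb{D}}|f(z)|^2\,d\mu(z)\le C\|f\|_{\mathcal{D}_p}^2$ for all $f\in\mathcal{D}_p$. $\mathcal{W}_p$ is the space of all $g\in\mathcal{H}ol(\mathbb{D})$ such that $d\mu_g(z)=|g'(z)|^2(1-|z|^2)^p\,dm(z)$ is a $\mathcal{D}_p$-Carleson measure. For $\lambda,p\in[0,1]$, the Dirichlet-Morrey space $\mathcal{D}_p^{\lambda}$ consists of all $f\in\mathcal{H}ol(\mathbb{D})$ with $$\|f\|_{\mathcal{D}_p^{\lambda}}=|f(0)|+\sup_{a\in\mathbb{D}}(1-|a|^2)^{\frac p2(1-\lambda)}\|f\circ\varphi_a-f(a)\|_{\mathcal{D}_p}<\infty ;$$ it is a Banach space under this norm. ''Bounded'' means that the operator maps $\mathcal{D}_p^{\lambda}$ into itself and is a bounded linear operator for this norm. *)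

(* Defs.v *)
From HB Require Import structures.
From mathcomp Require Import all_boot all_order all_algebra.
From mathcomp Require Import all_classical all_reals all_analysis.
From mathcomp Require Import complex.

Set Implicit Arguments.
Unset Strict Implicit.
Unset Printing Implicit Defensive.

Import Order.TTheory GRing.Theory Num.Theory.
Import numFieldNormedType.Exports.

Local Open Scope classical_set_scope.
Local Open Scope ring_scope.

Section DirichletMorrey.
Context {R : realType}.

(* [`|z|] lives in R[i]; this is the modulus as an element of R. *)
Definition cmod (z : R[i]) : R := Normc.normc z.

Definition disc : set R[i] := [set z | cmod z < 1].

(* Measures and integrals over the disc are taken on R * R with its product
   sigma-algebra, which is the Borel one; [measurableTypeR R] is R with its
   Borel sets. *)
Local Notation plane := (measurableTypeR R * measurableTypeR R)%type.

Definition toC (w : plane) : R[i] := @Complex R w.1 w.2.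

Definition disc2 : set plane := toC @^-1` disc.

Lemma inv_pi_ge0 : 0 <= (pi : R)^-1.
Proof. by rewrite invr_ge0 pi_ge0. Qed.

(* Planar Lebesgue measure divided by pi, so that the disc has mass 1. *)
Definition area : {measure set plane -> \bar R} :=
  mscale (NngNum inv_pi_ge0)
    ((@lebesgue_measure R) \x (@lebesgue_measure R))%E.

(* Complex differentiability at every point of the disc.  The functions are
   total on R[i]; none of the notions below depends on the values taken outside
   of the disc. *)
Definition Hol : set (R[i] -> R[i]) :=
  [set f | forall z, disc z -> derivable (f : R[i]^o -> R[i]^o) z 1].

Definition cderiv (f : R[i] -> R[i]) : R[i] -> R[i] :=
  derive1 (f : R[i]^o -> R[i]^o).

Definition Hinfty : set (R[i] -> R[i]) :=
  [set f | Hol f /\ exists M : R, forall z, disc z -> cmod (f z) <= M].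

Definition phi (a z : R[i]) : R[i] := (a - z) / (1 - conjc a * z).

Definition dirichlet_density (p : R) (f : R[i] -> R[i]) (w : plane) : R :=
  cmod (cderiv f (toC w)) ^+ 2 * (1 - cmod (toC w) ^+ 2) `^ p.

Definition normD2 (p : R) (f : R[i] -> R[i]) : \bar R :=
  ((cmod (f 0) ^+ 2)%:E
   + \int[area]_(w in disc2) (dirichlet_density p f w)%:E)%E.

Definition normD (p : R) (f : R[i] -> R[i]) : \bar R :=
  poweR (normD2 p f) 2^-1.

Definition Dspace (p : R) : set (R[i] -> R[i]) :=
  [set f | Hol f /\ (normD2 p f < +oo)%E].

Definition moebius_shift (f : R[i] -> R[i]) (a : R[i]) : R[i] -> R[i] :=
  fun z => f (phi a z) - f a.

Definition normQ (p : R) (f : R[i] -> R[i]) : \bar R :=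
  ((cmod (f 0))%:E
   + ereal_sup [set normD p (moebius_shift f a) | a in disc])%E.

Definition Qspace (p : R) : set (R[i] -> R[i]) :=
  [set f | Hol f /\ (normQ p f < +oo)%E].

Definition DCarleson (p : R) (mu : {measure set plane -> \bar R}) : Prop :=
  exists C : R, forall f, Dspace p f ->
    (\int[mu]_(w in disc2) (cmod (f (toC w)) ^+ 2)%:E <= C%:E * normD2 p f)%E.

(* The measure |g'(z)|^2 (1 - |z|^2)^p dm(z) is given by its values on Borel
   sets, which determine it. *)
Definition Wspace (p : R) : set (R[i] -> R[i]) :=
  [set g | Hol g /\ exists2 mu : {measure set plane -> \bar R},
     forall A, measurable A ->
       mu A = (\int[area]_(w in A `&` disc2) (dirichlet_density p g w)%:E)%E
     & DCarleson p mu].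

Definition normDM (p lambda : R) (f : R[i] -> R[i]) : \bar R :=
  ((cmod (f 0))%:E
   + ereal_sup [set ((1 - cmod a ^+ 2) `^ (p / 2 * (1 - lambda)))%:E
                    * normD p (moebius_shift f a) | a in disc])%E.

Definition DMspace (p lambda : R) : set (R[i] -> R[i]) :=
  [set f | Hol f /\ (normDM p lambda f < +oo)%E].

Definition mulop (g f : R[i] -> R[i]) : R[i] -> R[i] := fun z => g z * f z.

(* [T] maps the space [X], with norm [N], into itself and is a bounded linear
   operator on it; elements of [X] are identified when they agree on the
   disc. *)
Definition bounded_operator (X : set (R[i] -> R[i]))
    (N : (R[i] -> R[i]) -> \bar R)
    (T : (R[i] -> R[i]) -> R[i] -> R[i]) : Prop :=
  [/\ forall f, X f -> X (T f),
      forall (c : R[i]) f h, X f -> X h -> forall z, disc z ->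
        T (fun x => c * f x + h x) z = c * T f z + T h z
    & exists C : R, forall f, X f -> (N (T f) <= C%:E * N f)%E].

End DirichletMorrey.

(* Main.v *)
Require Import Defs.
From HB Require Import structures.
From mathcomp Require Import all_boot all_order all_algebra.
From mathcomp Require Import all_classical all_reals all_analysis.
From mathcomp Require Import measurable_realfun complex ring lra.

Set Implicit Arguments.
Unset Strict Implicit.
Unset Printing Implicit Defensive.

Import Order.TTheory GRing.Theory Num.Theory.
Import numFieldNormedType.Exports.

Local Open Scope classical_set_scope.
Local Open Scope ring_scope.

(* By the Moebius change of variables, the square of the D_p-norm of
   f o phi_a - f(a) is E(f, a) = int |f'|^2 (1 - |phi_a|^2)^p dm.  With
   q = p (1 - lambda), the norm of f in D_p^lambda is thus comparable to the
   least N such that |f(0)| <= N and E(f, a) <= N^2 (1 - |a|^2)^-q for all a.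
   The inequality |f'(0)|^2 <= C int |f'|^2 over a small square, applied to
   f o phi_a and integrated along radii, gives the growth bound
   |f(w)|^2 <= K N^2 (1 - |w|^2)^-q.

   Since (gf)' = g'f + gf', for bounded g both (1) and (2) reduce to
     int |f|^2 |g'|^2 (1 - |phi_a|^2)^p dm <= C N^2 (1 - |a|^2)^-q.
   For (2) the growth bound and the inequality
   (1 - |phi_a|^2)^q <= 4^q (1 - |a|^2)^-q (1 - |w|^2)^q bound the integrand
   pointwise by that of the Q_(p lambda)-norm of g.  For (1), the Carleson
   condition applied to f(w) / (1 - conj(b) w) gives
     int |f g'|^2 (1 - |w|^2)^p / |1 - conj(b) w|^2 dm
       <= C N^2 (1 - |b|^2)^(p - q - 2),
   and |1 - conj(a) w|^(-2p) is dominated by a weighted sum of the kernels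
   |1 - conj(b) w|^-2 over the points b = (1 - 2^-j) a.

   For (3), g^n = M_g^n 1 and the growth bound give |g(z)|^n <= K(z) C^n, hence
   |g| <= C.  Testing M_g on (1 - |b|^2)^(1 - q/2) / (1 - conj(b) w) gives
     int |g'|^2 (1 - |w|^2)^p / |1 - conj(b) w|^(2p + 2) dm
       <= C (1 - |b|^2)^-(p + 2),
   and the same dyadic sum bounds E(g, a). *)

(** Analyticity means complex differentiability at each point, so the regularity of f' has to be
    earned. The local inequality for |f'(0)|^2 starts from Goursat's theorem on rectangles, which
    assumes differentiability alone. The mean value bound that it yields is applied to squares of
    difference quotients (f(z + h) - f(z)) / h, which are analytic while f' is not yet known to be,
    and dominated convergence lets h tend to 0. Since inequalities suffice, the imaginary part of
    the integral of dz / z around a square is bounded below by 4 instead of computed as 2 pi. The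
    kernel in E(g, a) has exponent 2p, and test functions adapted to it would involve fractional
    powers of 1 - conj(b) w, hence a branch of the power. With the first power of the Cauchy kernel
    as test function the exponent becomes 2 in (1) and 2p + 2 in (3), both larger than 2p. The
    dyadic sum lowers it: its terms grow geometrically as b moves towards a along the radius, so the
    sum is comparable to its last term, where 2^-j is about 1 - |a|. *)

Lemma le_of_eq d (T : porderType d) (x y : T) : x = y -> (x <= y)%O.
Proof. by move=> ->. Qed.

(** * Modulus and complex differentiability *)

Section Cmod.
Context {R : realType}.
Implicit Types z w : R[i].

Lemma normr_cmod z : `|z| = (cmod z)%:C%C.
Proof. by case: z. Qed.

Lemma cmod_ge0 z : 0 <= cmod z.
Proof. by case: z => a b; exact: sqrtr_ge0. Qed.

Lemma cmod0 : cmod (0 : R[i]) = 0.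
Proof. exact: Normc.normc0. Qed.

Lemma cmod1 : cmod (1 : R[i]) = 1.
Proof. exact: Normc.normc1. Qed.

Lemma cmodM z w : cmod (z * w) = cmod z * cmod w.
Proof. exact: Normc.normcM. Qed.

Lemma cmodV z : cmod z^-1 = (cmod z)^-1.
Proof. exact: Normc.normcV. Qed.

Lemma cmodN z : cmod (- z) = cmod z.
Proof. exact: normcN. Qed.

Lemma cmodD z w : cmod (z + w) <= cmod z + cmod w.
Proof. exact: le_normcD. Qed.

Lemma cmodB z w : cmod (z - w) <= cmod z + cmod w.
Proof. by rewrite (le_trans (cmodD _ _))// cmodN. Qed.

Lemma cmod_distC z w : cmod (z - w) = cmod (w - z).
Proof. by rewrite -cmodN opprB. Qed.

Lemma cmodX z n : cmod (z ^+ n) = cmod z ^+ n.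
Proof. by elim: n => [|n IH]; rewrite ?expr0 ?cmod1// !exprS cmodM IH. Qed.

Lemma cmod_eq0 z : (cmod z == 0) = (z == 0).
Proof.
by apply/eqP/eqP => [/Normc.eq0_normc|->]; rewrite ?cmod0.
Qed.

Lemma cmod_gt0 z : (0 < cmod z) = (z != 0).
Proof. by rewrite lt0r cmod_ge0 andbT cmod_eq0. Qed.

Lemma cmod_conj z : cmod (conjc z) = cmod z.
Proof. by case: z => a b /=; rewrite /cmod /= sqrrN. Qed.

Lemma cmod_real (x : R) : cmod x%:C%C = `|x|.
Proof. by rewrite /cmod /= expr0n /= addr0 sqrtr_sqr. Qed.

Lemma sqr_cmod z : cmod z ^+ 2 = complex.Re z ^+ 2 + complex.Im z ^+ 2.
Proof.
by case: z => a b; rewrite /cmod /= sqr_sqrtr// addr_ge0// sqr_ge0.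
Qed.

Lemma cmod_Re z : `|complex.Re z| <= cmod z.
Proof.
rewrite -(@ler_pXn2r _ 2)// ?nnegrE ?normr_ge0 ?cmod_ge0//.
by rewrite sqr_cmod real_normK ?num_real// lerDl sqr_ge0.
Qed.

Lemma cmod_Im z : `|complex.Im z| <= cmod z.
Proof.
rewrite -(@ler_pXn2r _ 2)// ?nnegrE ?normr_ge0 ?cmod_ge0//.
by rewrite sqr_cmod real_normK ?num_real// lerDr sqr_ge0.
Qed.

Lemma cmod_le z : cmod z <= `|complex.Re z| + `|complex.Im z|.
Proof.
rewrite -(@ler_pXn2r _ 2)// ?nnegrE ?addr_ge0 ?cmod_ge0//.
rewrite sqr_cmod sqrrD !real_normK ?num_real//.
by rewrite lerD2r lerDl mulrn_wge0// mulr_ge0.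
Qed.

Lemma disc0 : disc (0 : R[i]).
Proof. by rewrite /disc/mkset cmod0. Qed.

End Cmod.

Section Cdiff.
Context {R : realType}.
Implicit Types (f g : R[i] -> R[i]) (z w d : R[i]).

(** The epsilon-delta form keeps every estimate in the ordered field [R]; [cdiffP] identifies it
    with the derivative over [R[i]]. *)
Definition cdiff f z d := forall e : R, 0 < e ->
  exists2 r : R, 0 < r & forall w, cmod (w - z) < r ->
    cmod (f w - f z - d * (w - z)) <= e * cmod (w - z).

Lemma cdiffP f z d : cdiff f z d <->
  is_derive (z : R[i]^o) 1 (f : R[i]^o -> R[i]^o) d.
Proof.
split=> [H|H].
  suff cv : (fun h : R[i]^o => h^-1 *: (((f : R[i]^o -> R[i]^o) \o shift (z : R[i]^o))
      (h *: (1 : R[i]^o)) - f z)) @ (0 : R[i]^o)^' --> (d : R[i]^o).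
    by apply: DeriveDef; [apply/cvg_ex; exists d|apply/cvg_lim].
  apply/cvgrPdist_le => e e0.
  have eR : e = (cmod e)%:C%C by rewrite -normr_cmod gtr0_norm.
  have e'0 : 0 < cmod e by rewrite cmod_gt0 gt_eqF.
  have [r r0 Hr] := H _ e'0.
  exists r%:C%C; first by rewrite /= ltcR.
  move=> h /=; rewrite sub0r normrN => hr h0.
  rewrite normr_cmod eR lecR.
  have {}hr : cmod h < r by rewrite -ltcR -normr_cmod.
  have := Hr (h *: (1 : R[i]^o) + z).
  rewrite addrK /= [h *: _]mulr1 => /(_ hr).
  rewrite -cmodN opprB => H1.
  have -> : d - h^-1 *: (f (h + z) - f z) = (d * h - (f (h + z) - f z)) / h.
    by rewrite mulrBl mulfK// [h^-1 *: _]mulrC.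
  by rewrite cmodM cmodV ler_pdivrMr// cmod_gt0.
move=> e e0.
have cv : (fun h : R[i]^o => h^-1 *: (((f : R[i]^o -> R[i]^o) \o shift (z : R[i]^o))
      (h *: (1 : R[i]^o)) - f z)) @ (0 : R[i]^o)^' --> (d : R[i]^o).
  by have [H1 <-] := H; exact: H1.
move/cvgrPdist_le : cv => /(_ e%:C%C); rewrite ltcR => /(_ e0).
case=> /= r r0 Hr.
have rR : r = (cmod r)%:C%C by rewrite -normr_cmod gtr0_norm.
exists (cmod r); first by rewrite cmod_gt0 gt_eqF.
move=> w wr.
have [->|wz] := eqVneq w z; first by rewrite !subrr mulr0 subr0 cmod0 mulr0.
have := Hr (w - z); rewrite /= sub0r normrN.
rewrite normr_cmod rR ltcR => /(_ wr); rewrite subr_eq0 => /(_ wz).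
rewrite [_ *: 1]mulr1 subrK normr_cmod lecR => H1.
have -> : f w - f z - d * (w - z) = - (d - (w - z)^-1 *: (f w - f z)) * (w - z).
  rewrite [_ *: _]mulrC opprB mulrBl divfK// subr_eq0//.
by rewrite cmodM cmodN ler_wpM2r// cmod_ge0.
Qed.

Lemma cdiff_cderiv f z d : cdiff f z d -> cderiv f z = d.
Proof. by move=> /cdiffP H; rewrite /cderiv derive1E; have [_ ->] := H. Qed.

Lemma cdiff_derivable f z d : cdiff f z d ->
  derivable (f : R[i]^o -> R[i]^o) z 1.
Proof. by move=> /cdiffP H; have [+ _] := H. Qed.

Lemma Hol_cdiff f z : Hol f -> disc z -> cdiff f z (cderiv f z).
Proof.
move=> fH zD; apply/cdiffP; rewrite /cderiv derive1E.
by apply: DeriveDef => //; exact: fH.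
Qed.

Lemma cdiff_eq f z d d' : d = d' -> cdiff f z d -> cdiff f z d'.
Proof. by move=> ->. Qed.

Lemma cdiff_cst (c : R[i]) z : cdiff (fun=> c) z 0.
Proof. apply/cdiffP; exact: is_derive_cst. Qed.

Lemma cdiff_id z : cdiff id z 1.
Proof. apply/cdiffP; exact: is_derive_id. Qed.

Lemma cdiffD f g z d d' : cdiff f z d -> cdiff g z d' ->
  cdiff (fun x => f x + g x) z (d + d').
Proof. by move=> /cdiffP ? /cdiffP ?; apply/cdiffP; exact: is_deriveD. Qed.

Lemma cdiffB f g z d d' : cdiff f z d -> cdiff g z d' ->
  cdiff (fun x => f x - g x) z (d - d').
Proof. by move=> /cdiffP ? /cdiffP ?; apply/cdiffP; exact: is_deriveB. Qed.

Lemma cdiffM f g z d d' : cdiff f z d -> cdiff g z d' ->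
  cdiff (fun x => f x * g x) z (d * g z + f z * d').
Proof.
move=> /cdiffP H1 /cdiffP H2.
apply/(@cdiff_eq _ _ (f z *: (d' : R[i]^o) + g z *: (d : R[i]^o))).
  by rewrite addrC [g z *: _]mulrC.
by apply/cdiffP; exact: is_deriveM.
Qed.

Lemma cdiffV f z d : f z != 0 -> cdiff f z d ->
  cdiff (fun x => (f x)^-1) z (- d / f z ^+ 2).
Proof.
move=> fz /cdiffP H1.
apply/(@cdiff_eq _ _ (- (f z) ^- 2 *: (d : R[i]^o))).
  by rewrite mulNr mulrC -mulNr.
apply/cdiffP; apply: DeriveDef; first by apply: derivableV.
by rewrite deriveV//; have [_ ->] := H1.
Qed.

Lemma cdiff_lip f z d : cdiff f z d -> exists2 r : R, 0 < r &
  forall w, cmod (w - z) < r -> cmod (f w - f z) <= (1 + cmod d) * cmod (w - z).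
Proof.
move=> /(_ 1 ltr01)[r r0 H]; exists r => // w /H {}H.
rewrite -[f w - f z](subrK (d * (w - z))) (le_trans (cmodD _ _))//.
by rewrite cmodM mulrDl lerD2r.
Qed.

Lemma cdiff_comp f g z d d' : cdiff f z d -> cdiff g (f z) d' ->
  cdiff (fun x => g (f x)) z (d' * d).
Proof.
move=> Hf Hg e e0.
have [r1 r10 H1] := cdiff_lip Hf.
pose L := 1 + cmod d.
have L0 : 0 < L by rewrite ltr_wpDr// cmod_ge0.
pose L' := 1 + cmod d'.
have L'0 : 0 < L' by rewrite ltr_wpDr// cmod_ge0.
(* The remainder splits into that of [g] at [f z], where |f w - f z| <= L |w - z|, and [d'] times
   that of [f]; each receives half of [e]. *)
have [r2 r20 H2] := Hg (e / (2 * L)) (divr_gt0 e0 (mulr_gt0 (ltr0n _ 2) L0)).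
have [r3 r30 H3] := Hf (e / (2 * L')) (divr_gt0 e0 (mulr_gt0 (ltr0n _ 2) L'0)).
exists (Num.min r1 (Num.min (r2 / L) r3)).
  by rewrite !lt_min r10 r30 divr_gt0.
move=> w; rewrite !lt_min => /and3P[/H1 w1 w2 /H3 w3].
have w4 : cmod (f w - f z) < r2.
  by rewrite (le_lt_trans w1)// mulrC -ltr_pdivlMr.
have {}w4 := H2 _ w4.
have -> : g (f w) - g (f z) - d' * d * (w - z) =
   (g (f w) - g (f z) - d' * (f w - f z)) + d' * (f w - f z - d * (w - z)).
  by ring.
rewrite (le_trans (cmodD _ _))// cmodM.
have -> : e * cmod (w - z) = e / (2 * L) * (L * cmod (w - z)) +
   L' * (e / (2 * L') * cmod (w - z)).
  have ? := lt0r_neq0 L0; have ? := lt0r_neq0 L'0; by field; apply/andP.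
apply: lerD.
  by rewrite (le_trans w4)// ler_wpM2l// divr_ge0 ?mulr_ge0// ltW.
by rewrite ler_pM ?cmod_ge0// lerDr.
Qed.

Lemma disc_open z : disc z -> exists2 r : R, 0 < r &
  forall w, cmod (w - z) < r -> disc w.
Proof.
rewrite /disc/mkset => zD; exists (1 - cmod z); first by rewrite subr_gt0.
move=> w; rewrite ltrBrDr => H; apply: le_lt_trans H.
by rewrite -{1}(subrK z w) cmodD.
Qed.

Lemma HolP f : (forall z, disc z -> exists d, cdiff f z d) -> Hol f.
Proof. by move=> H z /H[d /cdiff_derivable]. Qed.

End Cdiff.

(** * Cauchy's theorem on squares *)

Section SegmentIntegral.
Context {R : realType}.
Implicit Types (a b : R) (f g : R -> R).

Definition sint a b f : R := (\int[@lebesgue_measure R]_(x in `[a, b]) f x)%R.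

(** Continuity is two-sided even at the end points, as the differentiability of the underlying
    functions at these points supplies it. *)
Definition cont_on a b f := forall x, a <= x <= b -> {for x, continuous f}.

Lemma cont_on_int a b f : cont_on a b f ->
  (@lebesgue_measure R).-integrable `[a, b] (EFin \o f).
Proof.
move=> cf; apply: continuous_compact_integrable; first exact: segment_compact.
apply: continuous_in_subspaceT => x; rewrite inE /= in_itv /=; exact: cf.
Qed.

Lemma cont_onD a b f g : cont_on a b f -> cont_on a b g ->
  cont_on a b (fun x => f x + g x).
Proof. by move=> cf cg x xab; apply: cvgD; [exact: cf|exact: cg]. Qed.

Lemma cont_onN a b f : cont_on a b f -> cont_on a b (fun x => - f x).
Proof. by move=> cf x xab; apply: cvgN; exact: cf. Qed.

Lemma cont_onB a b f g : cont_on a b f -> cont_on a b g ->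
  cont_on a b (fun x => f x - g x).
Proof. by move=> cf cg; apply: cont_onD => //; exact: cont_onN. Qed.

Lemma cont_on_sub a b a' b' f : a <= a' -> b' <= b -> cont_on a b f ->
  cont_on a' b' f.
Proof.
by move=> aa bb cf x /andP[ax xb]; apply: cf; rewrite (le_trans aa)// (le_trans xb).
Qed.

Lemma sint_split a c b f : a <= c -> c <= b -> cont_on a b f ->
  sint a b f = sint a c f + sint c b f.
Proof.
move=> ac cb cf; rewrite /sint.
have If := cont_on_int cf.
have := @Rintegral_itvB _ f (BLeft a) (BRight b) c If.
rewrite !bnd_simp => /(_ ac cb) /eqP.
rewrite subr_eq => /eqP ->.
rewrite addrC Rintegral_itv_obnd_cbnd//.
apply: integrableS If => // x /=; rewrite !in_itv /= => /andP[cx ->].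
by rewrite andbT (le_trans ac)// ltW.
Qed.

Lemma sintB a b f g : cont_on a b f -> cont_on a b g ->
  sint a b (fun x => f x - g x) = sint a b f - sint a b g.
Proof. by move=> cf cg; rewrite /sint RintegralB//; exact: cont_on_int. Qed.

Lemma cont_onZ a b k f : cont_on a b f -> cont_on a b (fun x => k * f x).
Proof. by move=> cf x xab; apply: cvgMr; exact: cf. Qed.

Lemma sintZ a b k f : cont_on a b f ->
  sint a b (fun x => k * f x) = k * sint a b f.
Proof. by move=> cf; rewrite /sint RintegralZl//; exact: cont_on_int. Qed.

Lemma sint_near a b f k M : a <= b -> cont_on a b f ->
  (forall x, a <= x <= b -> `|f x - k| <= M) ->
  `|sint a b f - k * (b - a)| <= M * (b - a).
Proof.
move=> ab cf H.
have kE c : sint a b (fun=> c) = c * (b - a).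
  rewrite /sint Rintegral_cst//= lebesgue_measure_itv/= lte_fin.
  case: ltgtP ab => //= -> _.
  by rewrite subrr mulr0.
have cc c : cont_on a b (fun=> c) by move=> x _; exact: cvg_cst.
rewrite -!kE -sintB// ler_norml.
have cfk : cont_on a b (fun x => f x - k) by exact: cont_onB.
have : forall x, a <= x <= b -> - M <= f x - k <= M by move=> x /H; rewrite ler_norml.
move=> {}H; apply/andP; split.
  rewrite kE -mulNr -kE.
  apply: le_Rintegral => //; [exact: cont_on_int|exact: cont_on_int|].
  by move=> x /=; rewrite in_itv /= => /H /andP[].
apply: le_Rintegral => //; [exact: cont_on_int|exact: cont_on_int|].
by move=> x /=; rewrite in_itv /= => /H /andP[].
Qed.

Lemma sint_bound a b f M : a <= b -> cont_on a b f ->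
  (forall x, a <= x <= b -> `|f x| <= M) -> `|sint a b f| <= M * (b - a).
Proof.
move=> ab cf H; have := @sint_near a b f 0 M ab cf.
by rewrite mul0r subr0; apply=> x /H; rewrite subr0.
Qed.

End SegmentIntegral.

Section Goursat.
Context {R : realType}.
Implicit Types (P Q : R -> R -> R) (x y w h : R).

Definition rdiff P x y px py := forall e : R, 0 < e -> exists2 r : R, 0 < r &
  forall x' y', `|x' - x| < r -> `|y' - y| < r ->
   `|P x' y' - P x y - px * (x' - x) - py * (y' - y)|
     <= e * (`|x' - x| + `|y' - y|).

(** The shared [c] is the closedness condition dP/dy = dQ/dx, imposed at a single point. *)
Definition closed_form_at P Q x y :=
  exists px c qy, rdiff P x y px c /\ rdiff Q x y c qy.

Lemma rdiff_cont1 P x y px py : rdiff P x y px py ->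
  {for x, continuous (fun x' => P x' y)}.
Proof.
move=> /(_ 1 ltr01)[r r0 H]; apply/cvgrPdist_lt => e e0.
near=> x'.
have xr : `|x' - x| < r by rewrite distrC; near: x'; apply: cvgr_dist_lt => //; exact: cvg_id.
have := H x' y xr; rewrite subrr normr0 mulr0 subr0 addr0 mul1r => /(_ r0) H1.
rewrite distrC -(subrK (px * (x' - x)) (P x' y - P x y)).
rewrite (le_lt_trans (ler_normD _ _))// (le_lt_trans (lerD H1 (lexx _)))//.
rewrite normrM -{1}(mul1r `|x' - x|) -mulrDl -ltr_pdivlMl ?ltr_wpDr//.
rewrite distrC; near: x'; apply: cvgr_dist_lt; first exact: cvg_id.
by rewrite mulr_gt0// invr_gt0 ltr_wpDr.
Unshelve. all: by end_near. Qed.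

Lemma rdiff_swap P x y px py : rdiff P x y px py ->
  rdiff (fun a b => P b a) y x py px.
Proof.
move=> H e /H[r r0 {}H]; exists r => // x' y' xr yr.
by rewrite [X in _ <= _ * X]addrC addrAC H.
Qed.

Lemma rdiff_cont2 P x y px py : rdiff P x y px py ->
  {for y, continuous (fun y' => P x y')}.
Proof. by move/rdiff_swap/rdiff_cont1. Qed.

(* The integral of [P dx + Q dy] along the boundary of the rectangle with lower
   left corner [(x, y)], counterclockwise. *)
Definition bint P Q x y w h :=
  sint x (x + w) (fun t => P t y - P t (y + h))
  + sint y (y + h) (fun t => Q (x + w) t - Q x t).

Definition closed_form_on P Q x y w h :=
  forall a b, x <= a <= x + w -> y <= b <= y + h -> closed_form_at P Q a b.

Lemma closed_cont P Q x y w h : closed_form_on P Q x y w h ->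
  (forall b, y <= b <= y + h -> cont_on x (x + w) (fun t => P t b)) /\
  (forall a, x <= a <= x + w -> cont_on y (y + h) (fun t => Q a t)).
Proof.
move=> H; split.
  move=> b yb a xa; have [px [c [qy [+ _]]]] := H _ _ xa yb; exact: rdiff_cont1.
move=> a xa b yb; have [px [c [qy [_ +]]]] := H _ _ xa yb; exact: rdiff_cont2.
Qed.

(** Each inner side is traversed twice, in opposite directions, by neighbouring quarters. *)
Lemma bint_split P Q x y w h : 0 <= w -> 0 <= h ->
  closed_form_on P Q x y (2 * w) (2 * h) ->
  bint P Q x y (2 * w) (2 * h) =
  bint P Q x y w h + bint P Q (x + w) y w h + bint P Q x (y + h) w h
  + bint P Q (x + w) (y + h) w h.
Proof.
move=> w0 h0 /closed_cont[cP cQ].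
have ex : x + 2 * w = x + w + w by ring.
have ey : y + 2 * h = y + h + h by ring.
rewrite /bint !ex !ey; rewrite !ex !ey in cP cQ.
have xl : x <= x + w by rewrite lerDl.
have xr : x + w <= x + w + w by rewrite lerDl.
have yl : y <= y + h by rewrite lerDl.
have yr : y + h <= y + h + h by rewrite lerDl.
have cP' b u v : y <= b <= y + h + h -> x <= u -> v <= x + w + w ->
  cont_on u v (fun t => P t b).
  by move=> yb xu vx; exact: cont_on_sub (cP _ yb).
have cQ' b u v : x <= b <= x + w + w -> y <= u -> v <= y + h + h ->
  cont_on u v (fun t => Q b t).
  by move=> yb xu vx; exact: cont_on_sub (cQ _ yb).
have y0' : y <= y <= y + h + h by rewrite lexx (le_trans yl).
have y1' : y <= y + h <= y + h + h by rewrite yl.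
have y2' : y <= y + h + h <= y + h + h by rewrite lexx (le_trans yl).
have x0' : x <= x <= x + w + w by rewrite lexx (le_trans xl).
have x1' : x <= x + w <= x + w + w by rewrite xl.
have x2' : x <= x + w + w <= x + w + w by rewrite lexx (le_trans xl).
have xx := le_trans xl xr; have yy := le_trans yl yr.
rewrite !sintB; try by [apply: cP'|apply: cQ'].
rewrite (@sint_split _ x (x + w) (x + w + w) (fun t => P t y))//; last exact: cP'.
rewrite (@sint_split _ x (x + w) (x + w + w) (fun t => P t (y + h + h)))//; last exact: cP'.
rewrite (@sint_split _ y (y + h) (y + h + h) (Q x))//; last exact: cQ'.
rewrite (@sint_split _ y (y + h) (y + h + h) (Q (x + w + w)))//; last exact: cQ'.
by ring.
Qed.

(** The supremum of the left end points lies in every interval. *)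
Lemma nested_point (u d : nat -> R) : (forall n, u n <= u n.+1) ->
  (forall n, u n.+1 + d n.+1 <= u n + d n) -> (forall n, 0 <= d n) ->
  exists c, forall n, u n <= c <= u n + d n.
Proof.
move=> ui di d0.
have mu n k : u n <= u (n + k)%N.
  by elim: k => [|k IH]; rewrite ?addn0// addnS (le_trans IH).
have md n k : u (n + k)%N + d (n + k)%N <= u n + d n.
  by elim: k => [|k IH]; rewrite ?addn0// addnS (le_trans _ IH).
have ub n m : u m <= u n + d n.
  apply: le_trans (mu m n) _; rewrite addnC; apply: le_trans (md n m).
  by rewrite lerDl.
exists (sup (range u)) => n; apply/andP; split.
  apply: ub_le_sup; last by exists n.
  by exists (u 0%N + d 0%N) => _ [m _ <-].
apply: ge_sup; first by exists (u 0%N), 0%N.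
by move=> _ [m _ <-].
Qed.

(** Goursat's bisection: keep a quarter whose boundary integral is at least a fourth of the previous
    one. Near the common point of the quarters the form is affine up to an error that is small
    against the squared perimeter, and the boundary integral of the affine part vanishes by
    closedness. *)
Lemma goursat P Q x y w h : 0 <= w -> 0 <= h ->
  closed_form_on P Q x y w h -> bint P Q x y w h = 0.
Proof.
move=> w0 h0 H.
pose wn n := w / 2 ^+ n; pose hn n := h / 2 ^+ n.
have p2 n : (0 : R) < 2 ^+ n by rewrite exprn_gt0.
have wn0 n : 0 <= wn n by rewrite divr_ge0// ltW.
have hn0 n : 0 <= hn n by rewrite divr_ge0// ltW.
have wnS n : 2 * wn n.+1 = wn n by rewrite /wn exprS; field; rewrite gt_eqF.
have hnS n : 2 * hn n.+1 = hn n by rewrite /hn exprS; field; rewrite gt_eqF.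
pose b n (p : R * R) := `|bint P Q p.1 p.2 (wn n) (hn n)|.
(* The last quarter is the default: by [bint_split] it qualifies whenever the other three fail. *)
pose step n (p : R * R) : R * R :=
  let p1 := (p.1 + wn n.+1, p.2) in
  let p2 := (p.1, p.2 + hn n.+1) in
  let p3 := (p.1 + wn n.+1, p.2 + hn n.+1) in
  if b n p <= 4 * b n.+1 p then p else
  if b n p <= 4 * b n.+1 p1 then p1 else
  if b n p <= 4 * b n.+1 p2 then p2 else p3.
pose s := fix s n := if n is m.+1 then step m (s m) else (x, y).
have stepx n p : p.1 <= (step n p).1 /\ (step n p).1 <= p.1 + wn n.+1.
  rewrite /step /=; do ![case: ifP => _ /=]; rewrite ?lexx ?lerDl ?wn0//.
have stepy n p : p.2 <= (step n p).2 /\ (step n p).2 <= p.2 + hn n.+1.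
  rewrite /step /=; do ![case: ifP => _ /=]; rewrite ?lexx ?lerDl ?hn0//.
have [cx Hcx] : exists c, forall n, (s n).1 <= c <= (s n).1 + wn n.
  apply: nested_point => //n; have [] //= := stepx n (s n).
  by move=> _ Hx; rewrite -(wnS n) mulr2n mulrDl !mul1r addrA lerD2r.
have [cy Hcy] : exists c, forall n, (s n).2 <= c <= (s n).2 + hn n.
  apply: nested_point => //n; have [] //= := stepy n (s n).
  by move=> _ Hx; rewrite -(hnS n) mulr2n mulrDl !mul1r addrA lerD2r.
have sub n : x <= (s n).1 /\ (s n).1 + wn n <= x + w /\
             y <= (s n).2 /\ (s n).2 + hn n <= y + h.
  elim: n => [|n [I1 [I2 [I3 I4]]]] /=.
    by rewrite /wn /hn expr0 !divr1.
  have [X1 X2] := stepx n (s n); have [Y1 Y2] := stepy n (s n).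
  have := wnS n; have := hnS n.
  move: X1 X2 Y1 Y2 I1 I2 I3 I4; set p := step _ _; set q := s n => *.
  by do !split; lra.
have bn n : b 0%N (x, y) <= 4 ^+ n * b n (s n).
  elim: n => [|n IH]; first by rewrite expr0 mul1r.
  apply: le_trans IH _; rewrite exprS -mulrA [4 * _]mulrCA.
  rewrite ler_wpM2l ?exprn_ge0// /= /step.
  case: ifP => // /negbT H1; case: ifP => // /negbT H2; case: ifP => // /negbT H3.
  have [S1 [S2 [S3 S4]]] := sub n.
  have : closed_form_on P Q (s n).1 (s n).2 (2 * wn n.+1) (2 * hn n.+1).
    move=> a b' /andP[A1 A2] /andP[B1 B2]; rewrite wnS hnS in A2 B2; apply: H.
      by rewrite (le_trans S1)// (le_trans A2).
    by rewrite (le_trans S3)// (le_trans B2).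
  move/(bint_split (wn0 _) (hn0 _)); rewrite wnS hnS => E.
  move: H1 H2 H3; rewrite -!ltNge => H1 H2 H3.
  have : b n (s n) <= b n.+1 (s n) + b n.+1 ((s n).1 + wn n.+1, (s n).2)
      + b n.+1 ((s n).1, (s n).2 + hn n.+1)
      + b n.+1 ((s n).1 + wn n.+1, (s n).2 + hn n.+1).
    rewrite [leLHS]/b E /b /=.
    by do 3![apply: le_trans (ler_normD _ _) _; rewrite lerD2r].
  by move: H1 H2 H3; clear; lra.
have Hc : closed_form_at P Q cx cy.
  have := Hcx 0%N; have := Hcy 0%N; rewrite /= /wn /hn expr0 !divr1 => ? ?.
  exact: H.
have [px [c [qy [dP dQ]]]] := Hc.
apply/eqP; rewrite -normr_eq0 eq_le normr_ge0 andbT; apply/ler_addgt0Pl => e e0.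
rewrite addr0.
(* The factor 4^n from the bisection cancels against (S / 2^n)^2, which is why [e] is divided by 2
   S^2; the summand 1 keeps [S] positive for a degenerate rectangle. *)
pose S := w + h + 1.
have S0 : 0 < S by rewrite ltr_wpDl// addr_ge0.
have e1 : 0 < e / (2 * S ^+ 2) by rewrite divr_gt0// mulr_gt0// exprn_gt0.
set e' := e / _ in e1.
have [r1 r10 {}dP] := dP _ e1; have [r2 r20 {}dQ] := dQ _ e1.
have [n Hn] : exists n, S / 2 ^+ n < Num.min r1 r2.
  have r0 : 0 < Num.min r1 r2 by rewrite lt_min r10.
  have := cvg_geometric S (_ : `|2^-1| < 1 :> R).
  rewrite ger0_norm ?invr_ge0// invf_lt1// ltr1n => /(_ isT).
  move/cvgrPdist_lt => /(_ _ r0)[n _ /(_ n (leqnn n))] /=.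
  rewrite sub0r normrN exprVn ger0_norm ?divr_ge0 ?ltW// => Hn; by exists n.
have [wS hS] : wn n <= S / 2 ^+ n /\ hn n <= S / 2 ^+ n.
  by split; rewrite ler_wpM2r ?invr_ge0 ?ltW// /S; lra.
have lastW : wn n + hn n <= S / 2 ^+ n.
  by rewrite /wn /hn -mulrDl ler_wpM2r ?invr_ge0 ?ltW// /S; lra.
have wr1 : wn n < r1 /\ hn n < r1.
  by move: Hn; rewrite lt_min => /andP[Hn' _]; split; apply: le_lt_trans Hn'.
have wr2 : wn n < r2 /\ hn n < r2.
  by move: Hn; rewrite lt_min => /andP[_ Hn']; split; apply: le_lt_trans Hn'.
have [/andP[X1 X2] /andP[Y1 Y2]] := (Hcx n, Hcy n).
have near_x a : (s n).1 <= a <= (s n).1 + wn n -> `|a - cx| <= wn n.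
  move=> /andP[A1 A2]; rewrite ler_norml; apply/andP; clear -X1 X2 A1 A2; split; lra.
have near_y a : (s n).2 <= a <= (s n).2 + hn n -> `|a - cy| <= hn n.
  move=> /andP[A1 A2]; rewrite ler_norml; apply/andP; clear -Y1 Y2 A1 A2; split; lra.
set u := wn n + hn n in lastW.
have u0 : 0 <= u by rewrite addr_ge0.
have bP a b' : (s n).1 <= a <= (s n).1 + wn n -> (s n).2 <= b' <= (s n).2 + hn n ->
   `|P a b' - P cx cy - px * (a - cx) - c * (b' - cy)| <= e' * u.
  move=> /near_x A /near_y B; apply: le_trans (dP _ _ _ _) _; [by apply: le_lt_trans A _; case: wr1|by apply: le_lt_trans B _; case: wr1|].
  by rewrite ler_wpM2l ?lerD// ltW.
have bQ a b' : (s n).1 <= a <= (s n).1 + wn n -> (s n).2 <= b' <= (s n).2 + hn n ->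
   `|Q a b' - Q cx cy - c * (a - cx) - qy * (b' - cy)| <= e' * u.
  move=> /near_x A /near_y B; apply: le_trans (dQ _ _ _ _) _; [by apply: le_lt_trans A _; case: wr2|by apply: le_lt_trans B _; case: wr2|].
  by rewrite ler_wpM2l ?lerD// ltW.
have [S1 [S2 [S3 S4]]] := sub n.
have [cP cQ] : (forall b, (s n).2 <= b <= (s n).2 + hn n ->
    cont_on (s n).1 ((s n).1 + wn n) (fun t => P t b)) /\
  (forall a, (s n).1 <= a <= (s n).1 + wn n ->
    cont_on (s n).2 ((s n).2 + hn n) (fun t => Q a t)).
  apply: closed_cont => a b' /andP[A1 A2] /andP[B1 B2]; apply: H.
    by rewrite (le_trans S1)// (le_trans A2).
  by rewrite (le_trans S3)// (le_trans B2).
have sx : (s n).1 <= (s n).1 <= (s n).1 + wn n by rewrite lexx lerDl wn0.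
have sx' : (s n).1 <= (s n).1 + wn n <= (s n).1 + wn n by rewrite lexx lerDl wn0.
have sy : (s n).2 <= (s n).2 <= (s n).2 + hn n by rewrite lexx lerDl hn0.
have sy' : (s n).2 <= (s n).2 + hn n <= (s n).2 + hn n by rewrite lexx lerDl hn0.
(* The affine part contributes - c h w on the horizontal sides and c w h on the vertical ones; these
   cancel in [K3]. *)
have K1 : `|sint (s n).1 ((s n).1 + wn n)
     (fun t => P t (s n).2 - P t ((s n).2 + hn n)) - (- c * hn n) * wn n|
     <= (2 * (e' * u)) * wn n.
  have -> : wn n = (s n).1 + wn n - (s n).1 by ring.
  have -> : (s n).1 + ((s n).1 + wn n - (s n).1) = (s n).1 + wn n by ring.
  apply: sint_near; first by rewrite lerDl.
    by apply: cont_onB; exact: cP.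
  move=> t tx; have := bP _ _ tx sy; have := bP _ _ tx sy'.
  by rewrite !ler_norml => /andP[A1 A2] /andP[A3 A4]; clear -A1 A2 A3 A4; apply/andP; split; lra.
have K2 : `|sint (s n).2 ((s n).2 + hn n)
     (fun t => Q ((s n).1 + wn n) t - Q (s n).1 t) - (c * wn n) * hn n|
     <= (2 * (e' * u)) * hn n.
  have -> : hn n = (s n).2 + hn n - (s n).2 by ring.
  have -> : (s n).2 + ((s n).2 + hn n - (s n).2) = (s n).2 + hn n by ring.
  apply: sint_near; first by rewrite lerDl.
    by apply: cont_onB; exact: cQ.
  move=> t tx; have := bQ _ _ sx tx; have := bQ _ _ sx' tx.
  by rewrite !ler_norml => /andP[A1 A2] /andP[A3 A4]; clear -A1 A2 A3 A4; apply/andP; split; lra.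
have K3 : b n (s n) <= 2 * e' * u ^+ 2.
  rewrite /b /bint; move: K1 K2; rewrite !ler_norml => /andP[A1 A2] /andP[A3 A4].
  have -> : u ^+ 2 = u * (wn n + hn n) by rewrite /u; ring.
  by clear -A1 A2 A3 A4; apply/andP; split; lra.
have -> : `|bint P Q x y w h| = b 0%N (x, y) by rewrite /b /wn /hn expr0 !divr1.
apply: le_trans (bn n) _.
apply: (@le_trans _ _ (4 ^+ n * (2 * e' * (S / 2 ^+ n) ^+ 2))).
  apply: ler_wpM2l; first by rewrite exprn_ge0.
  apply: le_trans K3 _; apply: ler_wpM2l; first by rewrite mulr_ge0// ltW.
  by rewrite ler_pXn2r// nnegrE (le_trans u0).
have -> : 4 ^+ n = (2 ^+ n) ^+ 2 :> R by rewrite -exprM mulnC exprM; congr (_ ^+ _); ring.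
have simp (a z t : R) : a != 0 -> z != 0 ->
    z ^+ 2 * (2 * (t / (2 * a ^+ 2)) * (a / z) ^+ 2) = t.
  by move=> a0 z0; field; apply/andP.
by rewrite /e' simp ?gt_eqF.
Qed.

End Goursat.

(** * Integrals around an isolated singularity *)

Section PuncturedSquare.
Context {R : realType}.
Implicit Types (P Q : R -> R -> R) (G : R[i] -> R[i]).

(** The frame between the two squares is cut into four rectangles to which [goursat] applies:
    full-width strips below and above, shorter ones at the two sides. *)
Lemma bint_punctured P Q (s t : R) : 0 < t -> t <= s ->
  (forall x y, `|x| <= s -> `|y| <= s -> t <= Num.max `|x| `|y| ->
    closed_form_at P Q x y) ->
  bint P Q (- s) (- s) (2 * s) (2 * s) = bint P Q (- t) (- t) (2 * t) (2 * t).
Proof.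
move=> t0 ts H.
have s0 : 0 < s by exact: lt_le_trans t0 ts.
have dts : 0 <= s - t by rewrite subr_ge0.
have Hm x y : - s <= x <= s -> - s <= y <= s ->
    (t <= x \/ x <= - t \/ t <= y \/ y <= - t) -> closed_form_at P Q x y.
  move=> xs ys xy; apply: H; rewrite ?ler_norml//.
  rewrite le_max !ler_normr.
  by case: xy => [->|[xt|[->|yt]]]; rewrite ?orbT//; apply/orP;
    [left|right]; apply/orP; right; lra.
pose B := bint P Q (- s) (- s) (2 * s) (s - t).
pose T := bint P Q (- s) t (2 * s) (s - t).
pose L := bint P Q (- s) (- t) (s - t) (2 * t).
pose M := bint P Q t (- t) (s - t) (2 * t).
have B0 : B = 0.
  apply: goursat => //; first lra.
  move=> a b /andP[? ?] /andP[? ?]; apply: Hm; try (apply/andP; split; lra).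
  by right; right; right; lra.
have T0 : T = 0.
  apply: goursat => //; first lra.
  move=> a b /andP[? ?] /andP[? ?]; apply: Hm; try (apply/andP; split; lra).
  by right; right; left; lra.
have L0 : L = 0.
  apply: goursat => //; first lra.
  move=> a b /andP[? ?] /andP[? ?]; apply: Hm; try (apply/andP; split; lra).
  by right; left; lra.
have M0 : M = 0.
  apply: goursat => //; first lra.
  move=> a b /andP[? ?] /andP[? ?]; apply: Hm; try (apply/andP; split; lra).
  by left; lra.
have cP b u v : - s <= u -> v <= s -> - s <= b <= s -> (t <= b \/ b <= - t) ->
    cont_on u v (fun x => P x b).
  move=> us vs bs bt x /andP[ux xv].
  have [||px [c [qy [+ _]]]] := Hm x b _ bs; [lra|by right; right|].
  exact: rdiff_cont1.
have cP2 b u v : - s <= u -> v <= s -> - s <= b <= s -> (t <= u \/ v <= - t) ->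
    cont_on u v (fun x => P x b).
  move=> us vs bs bt x /andP[ux xv].
  have [||px [c [qy [+ _]]]] := Hm x b _ bs; [lra|by case: bt; [left|right; left]; lra|].
  exact: rdiff_cont1.
have cQ b u v : - s <= u -> v <= s -> - s <= b <= s -> (t <= b \/ b <= - t) ->
    cont_on u v (fun x => Q b x).
  move=> us vs bs bt x /andP[ux xv].
  have [||px [c [qy [_ +]]]] := Hm b x bs; [lra|by case: bt; [left|right; left]|].
  exact: rdiff_cont2.
have cQ2 b u v : - s <= u -> v <= s -> - s <= b <= s -> (t <= u \/ v <= - t) ->
    cont_on u v (fun x => Q b x).
  move=> us vs bs bt x /andP[ux xv].
  have [||px [c [qy [_ +]]]] := Hm b x bs; [lra|by case: bt => ?; right; right; [left|right]; lra|].
  exact: rdiff_cont2.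
suff : bint P Q (- s) (- s) (2 * s) (2 * s) =
    B + T + L + M + bint P Q (- t) (- t) (2 * t) (2 * t).
  by rewrite B0 T0 L0 M0 !add0r.
rewrite /B /T /L /M /bint.
have -> : - s + 2 * s = s by ring.
have -> : - t + 2 * t = t by ring.
have -> : - s + (s - t) = - t by ring.
have -> : t + (s - t) = s by ring.
have Hs : - s <= - s <= s by lra.
have Hs' : - s <= s <= s by lra.
have Ht : - s <= - t <= s by lra.
have Ht' : - s <= t <= s by lra.
have Ls : - s <= - s by lra.
have Lt : - s <= - t by lra.
have Lt' : - s <= t by lra.
have Ms : s <= s by lra.
have Mt : - t <= s by lra.
have tt : - t <= t by lra.
have st : - s <= - t by lra.
rewrite !sintB; try by first [apply: cP => //; (by left) || (by right)
   | apply: cP2 => //; (by left) || (by right)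
   | apply: cQ => //; (by left) || (by right)
   | apply: cQ2 => //; (by left) || (by right)].
have sP b : - s <= b <= s -> (t <= b \/ b <= - t) ->
  sint (- s) s (fun x => P x b) = sint (- s) (- t) (fun x => P x b) +
    sint (- t) t (fun x => P x b) + sint t s (fun x => P x b).
  move=> bs bt; rewrite (@sint_split _ (- s) (- t) s)//; last exact: cP.
  by rewrite (@sint_split _ (- t) t s) ?addrA//; exact: cP.
have sQ b : - s <= b <= s -> (t <= b \/ b <= - t) ->
  sint (- s) s (Q b) = sint (- s) (- t) (Q b) +
    sint (- t) t (Q b) + sint t s (Q b).
  move=> bs bt; rewrite (@sint_split _ (- s) (- t) s)//; last exact: cQ.
  by rewrite (@sint_split _ (- t) t s) ?addrA//; exact: cQ.
rewrite (sP t) ?(sP (- t)) ?(sQ s) ?(sQ (- s)) //; try (by left); try (by right; lra); try by left; lra.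
ring.
Qed.

End PuncturedSquare.

Section Residue.
Context {R : realType}.
Implicit Types (P Q : R -> R -> R) (G : R[i] -> R[i]).

(** The Cauchy-Riemann equations. *)
Lemma cdiff_rdiff G (x y : R) (d : R[i]) : cdiff G (x +i* y)%C d ->
  rdiff (fun a b => complex.Re (G (a +i* b)%C)) x y (complex.Re d) (- complex.Im d) /\
  rdiff (fun a b => complex.Im (G (a +i* b)%C)) x y (complex.Im d) (complex.Re d).
Proof.
move=> H.
have key e : 0 < e -> exists2 r : R, 0 < r & forall x' y', `|x' - x| < r -> `|y' - y| < r ->
    cmod (G (x' +i* y')%C - G (x +i* y)%C - d * ((x' - x) +i* (y' - y))%C)
      <= e * (`|x' - x| + `|y' - y|).
  move=> e0; have [r r0 Hr] := H e e0; exists (r / 2); first by rewrite divr_gt0.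
  move=> x' y' xr yr; have /= le := cmod_le ((x' - x) +i* (y' - y))%C.
  apply: le_trans (_ : e * cmod ((x' - x) +i* (y' - y))%C <= _); last by rewrite ler_pM2l.
  by apply: (Hr (x' +i* y')%C); apply: le_lt_trans le _; lra.
split=> e /key[r r0 Hr]; exists r => // x' y' xr yr; apply: le_trans (Hr _ _ xr yr).
  apply: le_trans (cmod_Re _); apply: le_of_eq.
  by case: (G _) (G _) d {H key Hr} => [a b] [a' b'] [c c'] /=; congr (`| _ |); ring.
apply: le_trans (cmod_Im _); apply: le_of_eq.
by case: (G _) (G _) d {H key Hr} => [a b] [a' b'] [c c'] /=; congr (`| _ |); ring.
Qed.

Lemma Re_realM (k : R) (w : R[i]) : complex.Re (k%:C%C * w) = k * complex.Re w.
Proof. by case: w => a b /=; rewrite mul0r subr0. Qed.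

Lemma Im_realM (k : R) (w : R[i]) : complex.Im (k%:C%C * w) = k * complex.Im w.
Proof. by case: w => a b /=; rewrite mul0r addr0. Qed.

(* The imaginary part of [G dz] is [Im G dx + Re G dy]. *)
Definition formP G (x y : R) : R := complex.Im (G (x +i* y)%C).
Definition formQ G (x y : R) : R := complex.Re (G (x +i* y)%C).

Lemma cdiff_closed G (x y : R) (d : R[i]) : cdiff G (x +i* y)%C d ->
  closed_form_at (formP G) (formQ G) x y.
Proof.
by move=> /cdiff_rdiff[H1 H2]; exists (complex.Im d), (complex.Re d), (- complex.Im d).
Qed.

Lemma cdiff_inv (z : R[i]) : z != 0 -> cdiff (fun w => w^-1) z (- 1 / z ^+ 2).
Proof. by move=> z0; apply: cdiffV => //; exact: cdiff_id. Qed.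

Lemma complex_neq0 (x y : R) : 0 < Num.max `|x| `|y| -> (x +i* y)%C != 0 :> R[i].
Proof.
rewrite lt_max !normr_gt0 eq_complex /= negb_and; by [].
Qed.

Lemma max_le_cmod (x y : R) : Num.max `|x| `|y| <= cmod (x +i* y)%C.
Proof. by rewrite ge_max (cmod_Re (x +i* y)%C) (cmod_Im (x +i* y)%C). Qed.

Definition punctured_hol G s := forall x y : R, `|x| <= s -> `|y| <= s ->
  (x +i* y)%C != 0 :> R[i] -> exists d, cdiff G (x +i* y)%C d.

Lemma punctured_hol_inv s : punctured_hol (fun z => z^-1) s.
Proof. by move=> x y _ _ /cdiff_inv; eexists; eassumption. Qed.

Lemma punctured_cont G s b : 0 < s -> `|b| = s -> punctured_hol G s ->
  cont_on (- s) s (fun x => formP G x b) /\ cont_on (- s) s (fun y => formQ G b y).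
Proof.
move=> s0 bs GH; split=> x; rewrite -ler_norml => xs.
  have [||d] := GH x b xs; [by rewrite bs|by rewrite complex_neq0// lt_max bs s0 orbT|].
  by move=> /cdiff_closed[px [c [qy [+ _]]]]; exact: rdiff_cont1.
have [|||d] := GH b x; [by rewrite bs|exact: xs|by rewrite complex_neq0// lt_max bs s0|].
by move=> /cdiff_closed[px [c [qy [_ +]]]]; exact: rdiff_cont2.
Qed.

(** The exact value is 2 pi. Two opposite sides together have the integrand 2 s / (x^2 + s^2), which
    is at least 1 / s on a segment of length 2 s. *)
Lemma bint_inv_ge4 (s : R) : 0 < s ->
  4 <= bint (formP (fun z => z^-1)) (formQ (fun z => z^-1)) (- s) (- s) (2 * s) (2 * s).
Proof.
move=> s0; rewrite /bint.
have -> : - s + 2 * s = s by ring.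
have ss : - s <= s by lra.
have cP b (bs : `|b| = s) := (punctured_cont s0 bs (@punctured_hol_inv s)).1.
have cQ b (bs : `|b| = s) := (punctured_cont s0 bs (@punctured_hol_inv s)).2.
have sN : `|- s| = s by rewrite normrN gtr0_norm.
have sP : `|s| = s by rewrite gtr0_norm.
have key (f : R -> R) : cont_on (- s) s f ->
    (forall x, - s <= x <= s -> s^-1 <= f x <= 3 * s^-1) -> 2 <= sint (- s) s f.
  move=> cf Hf; have := @sint_near _ (- s) s f (2 / s) (s^-1) ss cf.
  have -> : 2 / s * (s - - s) = 4 by field; rewrite gt_eqF.
  have -> : s^-1 * (s - - s) = 2 by field; rewrite gt_eqF.
  move=> H; have : `|sint (- s) s f - 4| <= 2.
    apply: H => x /Hf /andP[f1 f2]; rewrite ler_norml; apply/andP; split; lra.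
  by rewrite ler_norml => /andP[? ?]; lra.
(* The upper bound 3 / s makes the range symmetric about 2 / s, the form in which [sint_near] uses
   it. *)
have est x : - s <= x <= s -> s^-1 <= 2 * (s / (x ^+ 2 + s ^+ 2)) <= 3 * s^-1.
  move=> /andP[x1 x2]; have s2 : 0 < x ^+ 2 + s ^+ 2.
    by rewrite ltr_wpDl ?sqr_ge0// exprn_gt0.
  have x2s : x ^+ 2 <= s ^+ 2 by nra.
  apply/andP; split.
    by rewrite mulrA ler_pdivlMr// ler_pdivrMl//; nra.
  by rewrite mulrA ler_pdivrMr// mulrAC ler_pdivlMr//; nra.
have -> : (4 : R) = 2 + 2 by ring.
have n2 x : x ^+ 2 + s ^+ 2 != 0.
  by rewrite gt_eqF// ltr_wpDl ?sqr_ge0// exprn_gt0.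
apply: lerD; apply: key.
- by apply: cont_onB; exact: cP.
- move=> x /est; suff -> : formP (fun z => z^-1) x (- s) -
      formP (fun z => z^-1) x s = 2 * (s / (x ^+ 2 + s ^+ 2)) by [].
  by rewrite /formP /= sqrrN; field; rewrite n2.
- by apply: cont_onB; exact: cQ.
- move=> x /est; suff -> : formQ (fun z => z^-1) s x -
      formQ (fun z => z^-1) (- s) x = 2 * (s / (x ^+ 2 + s ^+ 2)) by [].
  by rewrite /formQ /= sqrrN [s ^+ 2 + _]addrC; field; rewrite n2.
Qed.

(** After subtraction of k / z the integral is the same for all smaller squares by [bint_punctured],
    and it tends to 0 with the square because the integrand is o(1 / |z|). As [k] is real, the
    imaginary part of the form carries the whole residue. *)
Lemma residue_ge G (k s : R) : 0 < s -> 0 <= k -> punctured_hol G s ->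
  (forall e : R, 0 < e -> exists2 r : R, 0 < r & forall z, z != 0 -> cmod z < r ->
     cmod (G z - k%:C%C / z) * cmod z <= e) ->
  4 * k <= bint (formP G) (formQ G) (- s) (- s) (2 * s) (2 * s).
Proof.
move=> s0 k0 dG limG.
pose H z := G z - k%:C%C / z.
have dH : punctured_hol H s.
  move=> x y xs ys z0; have [d dGz] := dG _ _ xs ys z0.
  eexists; apply: cdiffB; first exact: dGz.
  by apply: cdiffM; [exact: cdiff_cst|exact: cdiff_inv].
have ss : - s <= s by lra.
have contP F b (FH : punctured_hol F s) (bs : `|b| = s) := (punctured_cont s0 bs FH).1.
have contQ F b (FH : punctured_hol F s) (bs : `|b| = s) := (punctured_cont s0 bs FH).2.
have H0 : bint (formP H) (formQ H) (- s) (- s) (2 * s) (2 * s) = 0.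
  apply/eqP; rewrite -normr_eq0 eq_le normr_ge0 andbT; apply/ler_addgt0Pl => e e0.
  rewrite addr0.
  have [r r0 Hr] := limG _ (divr_gt0 e0 (ltr0n R 8)).
  (* On the boundary of this square |z| <= 2 t < r, and each of the four sides, of length 2 t,
     contributes at most e / 4. *)
  pose t := Num.min s (r / 3).
  have t0 : 0 < t by rewrite lt_min s0 divr_gt0.
  have ts : t <= s by rewrite ge_min lexx.
  have tr : t <= r / 3 by rewrite ge_min lexx orbT.
  rewrite (bint_punctured t0 ts); last first.
    move=> x y xs ys txy; have [|d] := dH x y xs ys.
      by apply: complex_neq0; exact: lt_le_trans txy.
    exact: cdiff_closed.
  have tt : - t <= t by lra.
  have cH x y : `|x| <= t -> `|y| <= t -> Num.max `|x| `|y| = t ->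
     cmod (H (x +i* y)%C) <= e / 8 / t.
    move=> xt yt xy; have := max_le_cmod x y; rewrite xy => tz.
    have z0 : (x +i* y)%C != 0 :> R[i] by apply: complex_neq0; rewrite xy.
    rewrite ler_pdivlMr//; apply: le_trans (Hr _ z0 _).
      by rewrite ler_wpM2l// cmod_ge0.
    apply: le_lt_trans (cmod_le (x +i* y)%C) _ => /=; lra.
  have bs1 f : cont_on (- t) t f -> (forall x, `|x| <= t -> `|f x| <= e / 8 / t + e / 8 / t) ->
     `|sint (- t) t f| <= e / 2.
    move=> cf Hf; have := @sint_bound _ (- t) t f (e / 8 / t + e / 8 / t) tt cf.
    have -> : (e / 8 / t + e / 8 / t) * (t - - t) = e / 2 by field; rewrite gt_eqF.
    by apply=> x xt; apply: Hf; rewrite ler_norml.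
  have sN : `|- t| = t by rewrite normrN gtr0_norm.
  have sP : `|t| = t by rewrite gtr0_norm.
  have dHt : punctured_hol H t.
    by move=> x y xt yt; apply: dH; [exact: le_trans ts|exact: le_trans ts].
  have cP' b (bt : `|b| = t) := (punctured_cont t0 bt dHt).1.
  have cQ' b (bt : `|b| = t) := (punctured_cont t0 bt dHt).2.
  rewrite /bint; have -> : - t + 2 * t = t by ring.
  have -> : e = e / 2 + e / 2 by field.
  apply: le_trans (ler_normD _ _) _; apply: lerD; apply: bs1.
  - by apply: cont_onB; exact: cP'.
  - move=> x xt; apply: le_trans (ler_normB _ _) _; apply: lerD;
    apply: le_trans (cmod_Im _) _; apply: cH; rewrite ?sN ?sP//; exact/max_idPr.
  - by apply: cont_onB; exact: cQ'.
  - move=> x xt; apply: le_trans (ler_normB _ _) _; apply: lerD;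
    apply: le_trans (cmod_Re _) _; apply: cH; rewrite ?sN ?sP//; exact/max_idPl.
have sN : `|- s| = s by rewrite normrN gtr0_norm.
have sP : `|s| = s by rewrite gtr0_norm.
have dI := @punctured_hol_inv s.
have := bint_inv_ge4 s0.
move: H0; rewrite /bint; have -> : - s + 2 * s = s by ring.
have zP (x y : R) : formP H x y = formP G x y - k * formP (fun z => z^-1) x y.
  rewrite /H /formP raddfB; congr (_ - _).
  exact: Im_realM.
have zQ (x y : R) : formQ H x y = formQ G x y - k * formQ (fun z => z^-1) x y.
  rewrite /H /formQ raddfB; congr (_ - _).
  exact: Re_realM.
have lin (f1 f2 g1 g2 h1 h2 : R -> R) : cont_on (- s) s g1 -> cont_on (- s) s g2 ->
   cont_on (- s) s h1 -> cont_on (- s) s h2 ->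
   (forall x, f1 x = g1 x - k * h1 x) -> (forall x, f2 x = g2 x - k * h2 x) ->
   sint (- s) s (fun x => f1 x - f2 x) =
   sint (- s) s (fun x => g1 x - g2 x) - k * sint (- s) s (fun x => h1 x - h2 x).
  move=> c1 c2 c3 c4 E1 E2.
  have -> : (fun x => f1 x - f2 x) =
     (fun x => (g1 x - g2 x) - k * (h1 x - h2 x)).
    by apply/funext => x; rewrite E1 E2; ring.
  rewrite sintB; [|exact: cont_onB|by apply: cont_onZ; exact: cont_onB].
  by rewrite sintZ//; exact: cont_onB.
rewrite (lin _ _ _ _ _ _ _ _ _ _ (zP^~ (- s)) (zP^~ s)); try by [exact: contP dG _|exact: contP dI _].
rewrite (lin _ _ _ _ _ _ _ _ _ _ (zQ s) (zQ (- s))); try by [exact: contQ dG _|exact: contQ dI _].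
move=> /eqP; rewrite -[_ - _ + _]addrA [- _ + _]addrCA addrA -opprD -mulrDr subr_eq0.
by move=> /eqP -> ?; rewrite mulrC ler_wpM2l.
Qed.

End Residue.

(** * Cauchy estimates on squares *)

Section CauchyBounds.
Context {R : realType}.
Implicit Types (F : R[i] -> R[i]) (s : R).

Lemma sint_le (a b : R) f g : cont_on a b f -> cont_on a b g ->
  (forall x, a <= x <= b -> f x <= g x) -> sint a b f <= sint a b g.
Proof.
move=> /cont_on_int If /cont_on_int Ig fg; apply: le_Rintegral => //.
Qed.

Lemma cdiff_cont F z d : cdiff F z d -> forall e : R, 0 < e ->
  exists2 r : R, 0 < r & forall w, cmod (w - z) < r -> cmod (F w - F z) <= e.
Proof.
move=> /cdiff_lip[r r0 H] e e0.
have L0 : 0 < 1 + cmod d by rewrite ltr_wpDr// cmod_ge0.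
exists (Num.min r (e / (1 + cmod d))); first by rewrite lt_min r0 divr_gt0.
move=> w; rewrite lt_min ltr_pdivlMr// => /andP[/H H1 H2].
by rewrite (le_trans H1)// mulrC ltW.
Qed.

Lemma cmod_lip (z w : R[i]) : `|cmod z - cmod w| <= cmod (z - w).
Proof.
have A : cmod z <= cmod w + cmod (z - w) by rewrite -{1}(subrK w z) addrC cmodD.
have B : cmod w <= cmod z + cmod (z - w).
  by rewrite cmod_distC -{1}(subrK z w) addrC cmodD.
by rewrite ler_norml; apply/andP; split; lra.
Qed.

Lemma cdiff_cont_cmod1 F (x y : R) d : cdiff F (x +i* y)%C d ->
  {for x, continuous (fun t => cmod (F (t +i* y)%C))}.
Proof.
move=> /cdiff_cont H; apply/cvgrPdist_le => e e0.
have [r r0 {}H] := H _ e0; near=> t.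
rewrite (le_trans (cmod_lip _ _))// cmod_distC H//.
have -> : (t +i* y - x +i* y)%C = (t - x)%:C%C by rewrite /= -[LHS]/((t - x) +i* (y - y))%C subrr.
rewrite cmod_real distrC; near: t; apply: cvgr_dist_lt => //; exact: cvg_id.
Unshelve. all: by end_near. Qed.

Lemma cdiff_cont_cmod2 F (x y : R) d : cdiff F (x +i* y)%C d ->
  {for y, continuous (fun t => cmod (F (x +i* t)%C))}.
Proof.
move=> /cdiff_cont H; apply/cvgrPdist_le => e e0.
have [r r0 {}H] := H _ e0; near=> t.
rewrite (le_trans (cmod_lip _ _))// cmod_distC H//.
have -> : (x +i* t - x +i* y)%C = 'i%C * (t - y)%:C%C.
  by rewrite -[LHS]/((x - x) +i* (t - y))%C; apply/eqP; rewrite eq_complex /=; apply/andP; split; apply/eqP; ring.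
have -> : cmod ('i%C * (t - y)%:C%C) = `|t - y|.
  by rewrite cmodM cmod_real /cmod /= expr0n /= add0r expr1n sqrtr1 mul1r.
rewrite distrC; near: t; apply: cvgr_dist_lt => //; exact: cvg_id.
Unshelve. all: by end_near. Qed.

Definition hol_square F s := forall x y : R, `|x| <= s -> `|y| <= s ->
  exists d, cdiff F (x +i* y)%C d.

Lemma mulcJ (z : R[i]) : conjc z * z = (cmod z ^+ 2)%:C%C.
Proof.
rewrite sqr_cmod; case: z => a b; apply/eqP; rewrite eq_complex /=.
by apply/andP; split; apply/eqP; ring.
Qed.

(** The function conj(F(0)) F(z) / z has a real nonnegative residue, as [residue_ge] demands, and 1
    / |z| <= 1 / s on the boundary. *)
Lemma cauchy_side_bound F s : 0 < s -> hol_square F s ->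
  4 * s * cmod (F 0) <=
  sint (- s) s (fun x => cmod (F (x +i* (- s))%C) + cmod (F (x +i* s)%C)) +
  sint (- s) s (fun y => cmod (F (s +i* y)%C) + cmod (F ((- s) +i* y)%C)).
Proof.
move=> s0 HF; set A := F 0.
have [A0|A0] := eqVneq A 0.
  rewrite A0 cmod0 mulr0 addr_ge0// /sint Rintegral_ge0// => *;
  by rewrite addr_ge0// cmod_ge0.
have cA0 : 0 < cmod A by rewrite cmod_gt0.
(* The residue of [G] at [0] is [cmod A ^+ 2]. *)
pose G z := conjc A * F z / z.
have dG : punctured_hol G s.
  move=> x y xs ys z0; have [d dF] := HF _ _ xs ys; eexists.
  apply: cdiffM; last exact: cdiff_inv.
  by apply: cdiffM; [exact: cdiff_cst|exact: dF].
have : 4 * cmod A ^+ 2 <= bint (formP G) (formQ G) (- s) (- s) (2 * s) (2 * s).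
  apply: residue_ge => //; first by rewrite sqr_ge0.
  move=> e e0.
  have [||d dF] := HF 0 0; rewrite ?normr0 ?ltW//.
  have [r r0 Hr] := cdiff_cont dF (divr_gt0 e0 cA0).
  exists r => // z z0 zr.
  have -> : G z - (cmod A ^+ 2)%:C%C / z = conjc A * (F z - A) / z.
    by rewrite -mulcJ /G; field.
  rewrite !cmodM cmodV divfK ?cmod_eq0// cmod_conj.
  rewrite mulrC -ler_pdivlMr//; have := Hr z; rewrite subr0; exact.
have GF x y : Num.max `|x| `|y| = s ->
    cmod (G (x +i* y)%C) <= cmod A / s * cmod (F (x +i* y)%C).
  move=> xy; have := max_le_cmod x y; rewrite xy => sz.
  rewrite /G !cmodM cmodV cmod_conj mulrAC ler_wpM2r ?cmod_ge0//.
  by rewrite ler_wpM2l ?cmod_ge0// lef_pV2// posrE (lt_le_trans s0).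
have sN : `|- s| = s by rewrite normrN gtr0_norm.
have sP : `|s| = s by rewrite gtr0_norm.
have contP b (bs : `|b| = s) := (punctured_cont s0 bs dG).1.
have contQ b (bs : `|b| = s) := (punctured_cont s0 bs dG).2.
have cF1 b : `|b| = s -> cont_on (- s) s (fun x => cmod (F (x +i* b)%C)).
  move=> bs x xs; have [||d] := HF x b; first by rewrite ler_norml.
    by rewrite bs.
  exact: cdiff_cont_cmod1.
have cF2 b : `|b| = s -> cont_on (- s) s (fun x => cmod (F (b +i* x)%C)).
  move=> bs x xs; have [||d] := HF b x; first by rewrite bs.
    by rewrite ler_norml.
  exact: cdiff_cont_cmod2.
rewrite /bint; have -> : - s + 2 * s = s by ring.
move=> H; rewrite -(ler_pM2l cA0) mulrDr -!(mulrA 4).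
have -> : cmod A * (4 * (s * cmod A)) = s * (4 * cmod A ^+ 2) by ring.
rewrite -ler_pdivlMl// mulrDr.
apply: le_trans H _.
apply: lerD; rewrite mulrA [s^-1 * _]mulrC -sintZ; try by apply: cont_onD; try exact: cF1; exact: cF2.
  apply: sint_le.
  - by apply: cont_onB; exact: contP.
  - by apply: cont_onZ; apply: cont_onD; exact: cF1.
  move=> x xs; rewrite mulrDr.
  have xs' : `|x| <= s by rewrite ler_norml.
  apply: le_trans (ler_norm _) _; apply: le_trans (ler_normB _ _) _.
  apply: lerD; apply: le_trans (cmod_Im _) _; apply: GF; rewrite ?sN ?sP; exact/max_idPr.
apply: sint_le.
- by apply: cont_onB; exact: contQ.
- by apply: cont_onZ; apply: cont_onD; exact: cF2.
move=> x xs; rewrite mulrDr.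
have xs' : `|x| <= s by rewrite ler_norml.
apply: le_trans (ler_norm _) _; apply: le_trans (ler_normB _ _) _.
apply: lerD; apply: le_trans (cmod_Re _) _; apply: GF; rewrite ?sN ?sP; exact/max_idPl.
Qed.

(** Subtracting [F 0] turns the double pole of F(z) / z^2 into a simple one, at the cost of the
    bound 2 M for the numerator. *)
Lemma cauchy_deriv_bound F s M d : 0 < s -> hol_square F s ->
  (forall x y : R, `|x| <= s -> `|y| <= s -> cmod (F (x +i* y)%C) <= M) ->
  cdiff F 0 d -> s * cmod d <= 4 * M.
Proof.
move=> s0 HF FM dF0.
have M0 : 0 <= M.
  by apply: le_trans (FM 0 0 _ _); rewrite ?cmod_ge0 ?normr0 ?ltW.
have [->|d0] := eqVneq d 0; first by rewrite cmod0 mulr0 mulr_ge0.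
have cd0 : 0 < cmod d by rewrite cmod_gt0.
(* The residue of [G] at [0] is [cmod d ^+ 2]. *)
pose G z := conjc d * (F z - F 0) / z ^+ 2.
have dG : punctured_hol G s.
  move=> x y xs ys z0; have [d' dF] := HF _ _ xs ys; eexists.
  apply: cdiffM.
    apply: cdiffM; [exact: cdiff_cst|apply: cdiffB; [exact: dF|exact: cdiff_cst]].
  apply: cdiffV; first by rewrite expf_neq0.
  by apply: (@cdiffM _ id id); exact: cdiff_id.
have : 4 * cmod d ^+ 2 <= bint (formP G) (formQ G) (- s) (- s) (2 * s) (2 * s).
  apply: residue_ge => //; first by rewrite sqr_ge0.
  move=> e e0.
  have [r r0 Hr] := dF0 _ (divr_gt0 e0 cd0).
  exists r => // z z0 zr.
  have -> : G z - (cmod d ^+ 2)%:C%C / z = conjc d * (F z - F 0 - d * z) / z ^+ 2.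
    by rewrite -mulcJ /G; field.
  rewrite !cmodM cmodV cmod_conj cmodX.
  have cz : 0 < cmod z by rewrite cmod_gt0.
  have := Hr z; rewrite !subr0 => /(_ zr) H1.
  have -> : cmod d * cmod (F z - F 0 - d * z) / cmod z ^+ 2 * cmod z =
     (cmod d * cmod (F z - F 0 - d * z)) / cmod z by field; rewrite gt_eqF.
  rewrite ler_pdivrMr//.
  have -> : e * cmod z = cmod d * (e / cmod d * cmod z) by field; rewrite gt_eqF.
  by rewrite ler_pM2l.
have GF x y : Num.max `|x| `|y| = s ->
    cmod (G (x +i* y)%C) <= cmod d * (2 * M) / s ^+ 2.
  move=> xy; have := max_le_cmod x y; rewrite xy => sz.
  have xs : `|x| <= s by rewrite -xy le_max lexx.
  have ys : `|y| <= s by rewrite -xy le_max lexx orbT.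
  rewrite /G !cmodM cmodV cmod_conj cmodX.
  apply: ler_pM; rewrite ?mulr_ge0 ?invr_ge0 ?exprn_ge0 ?cmod_ge0//.
    rewrite ler_wpM2l ?cmod_ge0// (le_trans (cmodB _ _))// mulr2n mulrDl !mul1r.
    by rewrite lerD// FM// normr0 ltW.
  rewrite lef_pV2 ?posrE ?exprn_gt0 ?(lt_le_trans s0)//.
  by rewrite ler_pXn2r// nnegrE ?ltW// (lt_le_trans s0).
have sN : `|- s| = s by rewrite normrN gtr0_norm.
have sP : `|s| = s by rewrite gtr0_norm.
have contP b (bs : `|b| = s) := (punctured_cont s0 bs dG).1.
have contQ b (bs : `|b| = s) := (punctured_cont s0 bs dG).2.
rewrite /bint; have -> : - s + 2 * s = s by ring.
set K := cmod d * (2 * M) / s ^+ 2 in GF.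
have ss : - s <= s by lra.
move=> H; have {}H : 4 * cmod d ^+ 2 <= (K + K) * (s - - s) + (K + K) * (s - - s).
  apply: le_trans H _; apply: le_trans (ler_norm _) _; apply: le_trans (ler_normD _ _) _.
  apply: lerD; apply: sint_bound => //.
  - by apply: cont_onB; exact: contP.
  - move=> x xs; have xs' : `|x| <= s by rewrite ler_norml.
    apply: le_trans (ler_normB _ _) _.
    apply: lerD; apply: le_trans (cmod_Im _) _; apply: GF; rewrite ?sN ?sP; exact/max_idPr.
  - by apply: cont_onB; exact: contQ.
  - move=> x xs; have xs' : `|x| <= s by rewrite ler_norml.
    apply: le_trans (ler_normB _ _) _.
    apply: lerD; apply: le_trans (cmod_Re _) _; apply: GF; rewrite ?sN ?sP; exact/max_idPl.
rewrite -(ler_pM2l cd0) -(ler_pM2l (ltr0n R 4)).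
have -> : 4 * (cmod d * (s * cmod d)) = s * (4 * cmod d ^+ 2) by ring.
apply: (@le_trans _ _ (s * ((K + K) * (s - - s) + (K + K) * (s - - s)))).
  by rewrite ler_pM2l.
rewrite /K; apply: le_of_eq; field.
by rewrite gt_eqF.
Qed.

End CauchyBounds.

(** * Borel measurability of analytic functions and of their derivatives *)

Notation plane R := (measurableTypeR R * measurableTypeR R)%type.

Section PlaneMeasurability.
Context {R : realType}.

(** Openness in terms of coordinate boxes matches the rectangles that generate the product
    sigma-algebra. *)
Definition box_open (A : set (plane R)) := forall p, A p -> exists2 r : R, 0 < r &
  forall q : plane R, `|q.1 - p.1| < r -> `|q.2 - p.2| < r -> A q.

Lemma box_open_measurable (A : set (plane R)) : box_open A -> measurable A.
Proof.
move=> Ao.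
(* [A] is the union of the rational rectangles that it contains; the others are replaced by the
   empty set, which keeps the index type countable. *)
pose bx (t : rat * rat * rat * rat) : set (plane R) :=
  `]ratr t.1.1.1, ratr t.1.1.2[%classic `*` `]ratr t.1.2, ratr t.2[%classic.
have -> : A = \bigcup_t (if `[< bx t `<=` A >] then bx t else set0).
  apply/seteqP; split=> [p Ap|p [t _]]; last first.
    by case: asboolP => // tA pt; exact: tA.
  have [r r0 Hr] := Ao p Ap.
  have [a] : exists q : rat, ratr q \in `]p.1 - r, p.1[ by apply: rat_in_itvoo; rewrite ltrBlDr ltrDl.
  rewrite in_itv /= => /andP[a1 a2].
  have [b] : exists q : rat, ratr q \in `]p.1, p.1 + r[ by apply: rat_in_itvoo; rewrite ltrDl.
  rewrite in_itv /= => /andP[b1 b2].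
  have [c] : exists q : rat, ratr q \in `]p.2 - r, p.2[ by apply: rat_in_itvoo; rewrite ltrBlDr ltrDl.
  rewrite in_itv /= => /andP[c1 c2].
  have [d] : exists q : rat, ratr q \in `]p.2, p.2 + r[ by apply: rat_in_itvoo; rewrite ltrDl.
  rewrite in_itv /= => /andP[d1 d2].
  exists (a, b, c, d) => //; case: asboolP => [_|].
    by rewrite /bx /= !in_itv /= a2 b1 c2 d1.
  case=> q [] /=; rewrite !in_itv /= => /andP[q1 q2] /andP[q3 q4].
  by apply: Hr; rewrite ltr_norml; apply/andP; split; lra.
apply: countable_bigcupT_measurable; first exact: countableP.
move=> t; case: asboolP => // _.
by apply: measurableX; exact: measurable_itv.
Qed.

Definition box_cont (f : plane R -> R) (p : plane R) := forall e : R, 0 < e ->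
  exists2 r : R, 0 < r & forall q : plane R, `|q.1 - p.1| < r -> `|q.2 - p.2| < r ->
   `|f q - f p| < e.

Lemma box_cont_measurable (A : set (plane R)) (f : plane R -> R) : box_open A ->
  (forall p, A p -> box_cont f p) -> measurable_fun A f.
Proof.
move=> Ao cf; apply: (measurability _ (measurable_realfun.RGenOInfty.measurableE R)) => //=.
move=> _ [_ [x ->] <-] /=; apply: box_open_measurable => p [/= Ap].
rewrite in_itv /= andbT => xf.
have [r1 r10 H1] := Ao _ Ap.
have [r2 r20 H2] := cf _ Ap (f p - x) (ltac:(by rewrite subr_gt0)).
exists (Num.min r1 r2); first by rewrite lt_min r10.
move=> q; rewrite !lt_min => /andP[q1 q2] /andP[q3 q4]; split; first exact: H1.
rewrite /= in_itv /= andbT; have := H2 q q2 q4.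
by rewrite ltr_norml => /andP[]; lra.
Qed.

Lemma disc2_open : box_open (@disc2 R).
Proof.
move=> p pD; have [r r0 Hr] := disc_open pD.
exists (r / 2); first by rewrite divr_gt0.
move=> q q1 q2; apply: Hr; apply: le_lt_trans (cmod_le _) _.
rewrite -[complex.Re _]/(q.1 - p.1) -[complex.Im _]/(q.2 - p.2); lra.
Qed.

Lemma measurable_disc2 : measurable (@disc2 R).
Proof. exact: box_open_measurable disc2_open. Qed.

Lemma cdiff_box_cont (f : R[i] -> R[i]) (p : plane R) d : cdiff f (toC p) d ->
  box_cont (fun q => complex.Re (f (toC q))) p /\
  box_cont (fun q => complex.Im (f (toC q))) p.
Proof.
move=> /cdiff_cont H.
have key e : 0 < e -> exists2 r : R, 0 < r & forall q : plane R,
   `|q.1 - p.1| < r -> `|q.2 - p.2| < r -> cmod (f (toC q) - f (toC p)) < e.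
  move=> e0; have [r r0 Hr] := H _ (divr_gt0 e0 (ltr0n R 2)).
  exists (r / 2); first by rewrite divr_gt0.
  move=> q q1 q2; apply: (@le_lt_trans _ _ (e / 2)); last first.
    by rewrite ltr_pdivrMr// ltr_pMr// ltr1n.
  apply: Hr; apply: le_lt_trans (cmod_le _) _.
  rewrite -[complex.Re _]/(q.1 - p.1) -[complex.Im _]/(q.2 - p.2); lra.
split=> e /key[r r0 Hr]; exists r => // q q1 q2.
  rewrite -raddfB; exact: le_lt_trans (cmod_Re _) (Hr _ q1 q2).
rewrite -raddfB; exact: le_lt_trans (cmod_Im _) (Hr _ q1 q2).
Qed.

Definition cmeas (A : set (plane R)) (f : R[i] -> R[i]) :=
  measurable_fun A (fun q => complex.Re (f (toC q))) /\
  measurable_fun A (fun q => complex.Im (f (toC q))).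

Lemma cmeas_cdiff (A : set (plane R)) (f : R[i] -> R[i]) : box_open A ->
  (forall p, A p -> exists d, cdiff f (toC p) d) -> cmeas A f.
Proof.
move=> Ao H; split; apply: box_cont_measurable => // p Ap;
by have [d /cdiff_box_cont[]] := H _ Ap.
Qed.

Lemma cmeas_cmod2 A f : cmeas A f -> measurable_fun A (fun q => cmod (f (toC q)) ^+ 2).
Proof.
move=> [m1 m2]; under eq_fun do rewrite sqr_cmod.
by apply: measurable_funD; exact: measurable_funX.
Qed.

Lemma cmeas_cmod A f : cmeas A f -> measurable_fun A (fun q => cmod (f (toC q))).
Proof.
move=> /cmeas_cmod2 m.
have -> : (fun q : plane R => cmod (f (toC q))) =
   (fun q : plane R => (cmod (f (toC q)) ^+ 2) `^ 2^-1).
  by apply/funext => q; rewrite powR12_sqrt ?sqr_ge0// sqrtr_sqr ger0_norm ?cmod_ge0.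
exact: (measurableT_comp (@measurable_powR R 2^-1)).
Qed.

Lemma cmeas_Hol f : Hol f -> cmeas disc2 f.
Proof.
move=> Hf; apply: cmeas_cdiff; first exact: disc2_open.
by move=> p pD; exists (cderiv f (toC p)); exact: Hol_cdiff.
Qed.

(** f' is the pointwise limit of the difference quotients with steps 1 / (n + 1), and these inherit
    measurability from f. *)
Lemma cmeas_cderiv f : Hol f -> cmeas disc2 (cderiv f).
Proof.
move=> Hf.
(* The translate may leave the disc, where [f] is arbitrary; the extension by 0 is measurable on the
   whole plane and agrees with [f] at z + h once h is small. *)
pose f0 z := if `[< disc z >] then f z else 0.
pose h n : R[i] := (n.+1%:R^-1)%:C%C.
pose g n z := (n.+1%:R)%:C%C * (f0 (z + h n) - f z).
have hE n : cmod (h n) = n.+1%:R^-1 by rewrite cmod_real ger0_norm.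
have hlim r : 0 < r -> \forall n \near \oo, cmod (h n) < r.
  move=> r0; have /cvgrPdist_lt/(_ r r0) := @cvg_harmonic R.
  by apply: filterS => n; rewrite hE /= sub0r normrN ger0_norm.
have cv z : disc z -> forall e : R, 0 < e ->
    \forall n \near \oo, cmod (g n z - cderiv f z) <= e.
  move=> zD e e0; have [r r0 Hr] := Hol_cdiff Hf zD e0.
  have [r' r'0 Hr'] := disc_open zD.
  near=> n.
  have hr : cmod (h n) < r by near: n; exact: hlim.
  have hr' : cmod (h n) < r' by near: n; exact: hlim.
  have zh : z + h n - z = h n by rewrite addrC addKr.
  have := Hr (z + h n); rewrite zh => /(_ hr) H1.
  have := Hr' (z + h n); rewrite zh => /(_ hr') zhD.
  have E : (n.+1%:R)%:C%C * h n = 1 by rewrite /h -rmorphM /= mulfV.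
  have -> : g n z - cderiv f z =
      (n.+1%:R)%:C%C * (f (z + h n) - f z - cderiv f z * h n).
    by rewrite /g /f0 (asboolT zhD) [RHS]mulrBr [_ * (cderiv f z * _)]mulrCA E mulr1.
  rewrite cmodM cmod_real ger0_norm// -ler_pdivlMl//.
  by rewrite (le_trans H1)// hE mulrC.
have msh n : measurable_fun setT (fun q : plane R => (q.1 + n.+1%:R^-1, q.2) : plane R).
  by apply: measurable_fun_pair => //; apply: measurable_funD.
have shE n (q : plane R) : toC q + h n = toC (q.1 + n.+1%:R^-1, q.2).
  by apply/eqP; rewrite eq_complex /= addr0 !eqxx.
have gen (P : {additive R[i] -> R}) : (forall z, `|P z| <= cmod z) ->
    (forall (k : R) z, P (k%:C%C * z) = k * P z) ->
    measurable_fun disc2 (fun q => P (f (toC q))) ->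
    measurable_fun disc2 (fun q => P (cderiv f (toC q))).
  move=> Ple PM mP.
  have m0 : measurable_fun setT (fun q : plane R => P (f0 (toC q))).
    have -> : (fun q => P (f0 (toC q))) = (fun q => P (f (toC q))) \_ disc2.
      apply/funext => q; rewrite /f0 /patch.
      by case: asboolP => qD; [rewrite mem_set|rewrite memNset// raddf0].
    exact: (measurable_restrictT _ measurable_disc2).1.
  apply: (@measurable_fun_cvg _ _ _ _ (fun n q => P (g n (toC q)))).
    move=> n; rewrite /g; under eq_fun do rewrite PM raddfB shE.
    apply: measurable_funM => //; apply: measurable_funB => //.
    by apply: measurable_funTS; exact: (measurableT_comp m0 (msh n)).
  move=> q qD; apply/cvgrPdist_le => e e0.
  have := cv _ qD e e0; apply: filterS => n; apply: le_trans.
  by rewrite -raddfB cmod_distC Ple.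
have [m1 m2] := cmeas_Hol Hf.
by split; [exact: (gen _ (@cmod_Re R) (@Re_realM R))|exact: (gen _ (@cmod_Im R) (@Im_realM R))].
Unshelve. all: by end_near. Qed.

End PlaneMeasurability.

(** * Change of variables in the plane *)

Section Density.
Local Open Scope ereal_scope.
Context d (T : measurableType d) (R : realType) (mu : {measure set T -> \bar R}).
Variable h : T -> R.
Hypotheses (mh : measurable_fun setT h) (h0 : forall x, (0 <= h x)%R).

Definition dens (A : set T) : \bar R := \int[mu]_(x in A) (h x)%:E.

Let dens0 : dens set0 = 0.
Proof. by rewrite /dens integral_set0. Qed.

Let dens_ge0 A : 0 <= dens A.
Proof. by apply: integral_ge0 => x _; rewrite lee_fin. Qed.

Let dens_sigma_additive : semi_sigma_additive dens.
Proof.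
move=> /= F mF tF mUF; rewrite /dens; apply: cvg_toP.
  apply: ereal_nondecreasing_is_cvgn => m n mn.
  by apply: lee_sum_nneg_natr => // k _ _; exact: dens_ge0.
rewrite ge0_integral_bigcup//=.
- by apply/measurable_funTS/measurableT_comp.
- by move=> x _; rewrite lee_fin.
Qed.

HB.instance Definition _ := isMeasure.Build _ _ _ dens dens0 dens_ge0 dens_sigma_additive.

Import HBNNSimple.

(** [nu] is any measure with the prescribed values on measurable sets, so the statement also covers
    the measure in [Wspace]. Simple functions come first, then monotone convergence on both
    sides. *)
Lemma integral_density (nu : {measure set T -> \bar R}) (f : T -> \bar R) :
  (forall A, measurable A -> nu A = \int[mu]_(x in A) (h x)%:E) ->
  measurable_fun setT f -> (forall x, 0 <= f x) ->
  \int[nu]_x f x = \int[mu]_x (f x * (h x)%:E).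
Proof.
move=> nuE mf f0.
pose g := nnsfun_approx measurableT mf.
have mhE : measurable_fun setT (EFin \o h) by exact/measurable_EFinP.
have -> : \int[nu]_x f x = lim (\int[nu]_x (EFin \o g n) x @[n --> \oo]).
  rewrite -monotone_convergence//.
  - by apply: eq_integral => x _; apply/esym/cvg_lim => //; exact: cvg_nnsfun_approx.
  - by move=> n; apply/measurable_EFinP.
  - by move=> n x _ /=; rewrite lee_fin.
  - by move=> x _ a b ab; rewrite lee_fin; exact/lefP/nd_nnsfun_approx.
have -> : \int[mu]_x (f x * (h x)%:E) =
    lim (\int[mu]_x ((EFin \o g n) x * (h x)%:E) @[n --> \oo]).
  rewrite -monotone_convergence//.
  - apply: eq_integral => x _; apply/esym/cvg_lim => //; apply: cvgeZr => //.
    exact: cvg_nnsfun_approx.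
  - by move=> n; apply: emeasurable_funM => //; apply/measurable_EFinP.
  - by move=> n x _ /=; rewrite mule_ge0// lee_fin.
  - move=> x _ a b ab; rewrite lee_wpmul2r ?lee_fin//.
    exact/lefP/nd_nnsfun_approx.
suff suf n : \int[nu]_x (EFin \o g n) x = \int[mu]_x ((EFin \o g n) x * (h x)%:E).
  by congr (limn _); apply/funext => n; rewrite suf.
transitivity (\int[nu]_x
   (\sum_(y \in range (g n)) (y * \1_(g n @^-1` [set y]) x)%:E)).
  by apply: eq_integral => t tE; rewrite /= fimfunE -fsumEFin.
have indich r : measurable_fun setT (fun x => (r * \1_(g n @^-1` [set r]) x)%:E).
  by apply: (measurable_comp measurableT) => //; exact: measurable_funM.
rewrite ge0_integral_fsum//; last by move=> m y Ey; exact: nnfun_muleindic_ge0.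
transitivity (\int[mu]_x (\sum_(y \in range (g n))
    (y * \1_(g n @^-1` [set y]) x)%:E * (h x)%:E)); last first.
  apply: eq_integral => x xE.
  rewrite -ge0_mule_fsuml => [|y]; last exact: nnfun_muleindic_ge0.
  by rewrite fsumEFin // -(fimfunE _ x).
rewrite [RHS]ge0_integral_fsum//; last 2 first.
  - by move=> y; apply: emeasurable_funM => //; apply: measurable_funTS.
  - move=> m y Ey; apply: mule_ge0; last by rewrite lee_fin.
    exact: nnfun_muleindic_ge0.
apply: eq_fsbigr => r rhn.
have r0 : 0 <= r%:E by move: rhn; rewrite inE => -[t _ <-]; rewrite lee_fin.
under eq_integral do rewrite EFinM.
rewrite integralZl_indic_nnsfun => //.
under [RHS]eq_integral do rewrite EFinM -muleA.
rewrite [RHS]ge0_integralZl//.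
- congr (_ * _); under [RHS]eq_integral do rewrite muleC.
  rewrite [RHS](eq_integral ((EFin \o h) \_ (g n @^-1` [set r]))); last first.
    by move=> x xE; rewrite epatch_indic.
  by rewrite -integral_mkcond -nuE// integral_indic// setIT.
- by apply: emeasurable_funM => //; exact/measurable_EFinP.
- by move=> t Et; rewrite mule_ge0 ?lee_fin.
Qed.

(** The existential hides the construction; afterwards only the values on measurable sets matter. *)
Lemma density_measure : exists nu : {measure set T -> \bar R},
  forall A, measurable A -> nu A = \int[mu]_(x in A) (h x)%:E.
Proof. by exists dens. Qed.

End Density.

Section Push.
Local Open Scope ereal_scope.
Context d d' (T1 : measurableType d) (T2 : measurableType d') (R : realType).

Lemma pushforward_measure (m : {measure set T1 -> \bar R}) (f : T1 -> T2) :
  measurable_fun setT f ->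
  exists nu : {measure set T2 -> \bar R}, nu = pushforward m f :> (set T2 -> \bar R).
Proof.
move=> mf; unshelve eexists; first by refine (pushforward m f : {measure set T2 -> \bar R}).
by [].
Qed.

End Push.

Section Substitution.
Local Open Scope ereal_scope.
Context {R : realType}.
Local Notation mu := (@lebesgue_measure R).
Implicit Types (f : R -> \bar R).

Definition aff (a b x : R) : measurableTypeR R := (a * x + b)%R.

Lemma measurable_aff a b : measurable_fun setT (aff a b : measurableTypeR R -> measurableTypeR R).
Proof. by apply: measurable_funD => //; exact: measurable_funM. Qed.

(** By uniqueness of Lebesgue measure it suffices to treat intervals []u, v]]; a negative slope
    exchanges the end points, and with them the one that belongs to the preimage. *)
Lemma lebesgue_measure_aff (a b : R) (A : set R) : (a != 0)%R -> measurable A ->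
  pushforward mu (aff a b : measurableTypeR R -> measurableTypeR R) A = `|a|^-1%:E * mu A.
Proof.
move=> a0 mA.
have a0' : (0 < `|a|)%R by rewrite normr_gt0.
pose k : {nonneg R} := NngNum (ltW a0').
have [nu nuE] := pushforward_measure mu (measurable_aff a b).
have : mu A = mscale k nu A.
  apply: lebesgue_measure_unique => //= _ [[u v]] _ <-.
  rewrite /mscale /= nuE /pushforward lebesgue_measure_itv/= lte_fin.
  have [uv|uv] := ltP u v; last first.
    rewrite [X in _ * lebesgue_measure X](_ : _ = set0) ?measure0 ?mule0//.
    apply/seteqP; split => // x /=; rewrite in_itv/= => /andP[/lt_le_trans H /H].
    by rewrite ltNge uv.
  move: a0; rewrite neq_lt => /orP[a0|a0].
    have -> : aff a b @^-1` `]u, v] = `[((v - b) / a)%R, ((u - b) / a)%R[%classic.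
      apply/seteqP; split=> x /=; rewrite !in_itv /= ler_ndivrMr// ltr_ndivlMr//;
      by rewrite /aff lerBrDr ltrBlDr mulrC andbC.
    rewrite lebesgue_measure_itv/= lte_fin ltr_nM2r ?invr_lt0// ltrD2r uv.
    rewrite -!EFinD -EFinM ltr0_norm//; congr EFin; field; exact: ltr0_neq0.
  have -> : aff a b @^-1` `]u, v] = `]((u - b) / a)%R, ((v - b) / a)%R]%classic.
    apply/seteqP; split=> x /=; rewrite !in_itv /= ler_pdivlMr// ltr_pdivrMr//;
    by rewrite /aff lerBrDr ltrBlDr mulrC.
  rewrite lebesgue_measure_itv/= lte_fin ltr_pM2r ?invr_gt0// ltrD2r uv.
  by rewrite -!EFinD -EFinM gtr0_norm//; congr EFin; field; exact: lt0r_neq0.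
rewrite /mscale /= nuE => ->; rewrite muleA -EFinM mulVf ?mul1e//.
by rewrite gt_eqF.
Qed.

Lemma integral_aff (a b : R) f : (a != 0)%R -> measurable_fun setT f ->
  (forall x, 0 <= f x) ->
  \int[mu]_x f (a * x + b)%R = `|a|^-1%:E * \int[mu]_x f x.
Proof.
move=> a0 mf f0.
have := @ge0_integral_pushforward _ _ _ _ R _ (measurable_aff a b) mu setT f measurableT mf
   (fun y _ => f0 y).
rewrite preimage_setT /= => <-.
have k0 : (0 <= `|a|^-1)%R by rewrite invr_ge0.
rewrite -(@ge0_integral_mscale _ _ R mu _ measurableT (NngNum k0))//.
apply: eq_measure_integral => [|m A mA _]; [exact: measurable_aff|exact: lebesgue_measure_aff].
Qed.

(* Fixing the negative half-line makes [sinv] a bijection of R that transports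
   the measure of density [sinv_jac] to the Lebesgue measure, so that uniqueness
   of the latter applies. *)
Definition sinv (x : R) : measurableTypeR R := (if 0 < x then x^-1 else x)%R.

Definition sinv_jac (x : R) : R := (if 0 < x then x ^- 2 else 1)%R.

Lemma measurable_inv : measurable_fun setT (@GRing.inv R : measurableTypeR R -> measurableTypeR R).
Proof.
have E : ~` [set (0:R)%R] = [set x : R | x != 0%R].
  by apply/seteqP; split=> x /eqP.
rewrite -(setvU [set (0:R)%R]) E; apply/measurable_funU => //.
  by apply: open_measurable; exact: open_neq.
split; last exact: measurable_fun_set1.
apply: open_continuous_measurable_fun; first exact: open_neq.
by move=> x; rewrite inE /= => x0; exact: inv_continuous.
Qed.

Lemma measurable_gt0 : measurable_fun setT (fun x : measurableTypeR R => (0 < x)%R).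
Proof. exact: measurable_fun_ltr. Qed.

Lemma measurable_sinv : measurable_fun setT (sinv : measurableTypeR R -> measurableTypeR R).
Proof. apply: measurable_fun_ifT => //; [exact: measurable_gt0|exact: measurable_inv]. Qed.

Lemma measurable_sinv_jac : measurable_fun setT (sinv_jac : measurableTypeR R -> measurableTypeR R).
Proof.
apply: measurable_fun_ifT => //; first exact: measurable_gt0.
under eq_fun do rewrite -exprVn.
apply: measurable_funX; exact: measurable_inv.
Qed.

Lemma sinv_jac_ge0 x : (0 <= sinv_jac x)%R.
Proof. by rewrite /sinv_jac; case: ifP => // _; rewrite invr_ge0 sqr_ge0. Qed.

(** The half-line is the preimage of ]0, c] under inversion; the antiderivative is - 1 / x. *)
Lemma integral_inv_tail (c : R) : (0 < c)%R ->
  \int[mu]_(x in `[c^-1%R, +oo[) (x ^- 2)%:E = c%:E.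
Proof.
move=> c0; have ic0 : (0 < c^-1)%R by rewrite invr_gt0.
have pos x : (c^-1 <= x)%R -> (x != 0)%R.
  by move=> cx; rewrite gt_eqF// (lt_le_trans ic0).
have dF x : (c^-1 <= x)%R -> is_derive x 1%R (fun x : R => - x^-1)%R (x ^- 2)%R.
  move=> /pos x0.
  have : is_derive x 1%R (fun x : R => x^-1)%R (- (x ^- 2))%R.
    apply: DeriveDef; first by apply: (@derivableV R R id).
    by rewrite (@deriveV R R id)// derive_id [_ *: _]mulr1.
  by move=> /is_deriveN; rewrite opprK.
have := @ge0_continuous_FTC2y R (fun x => x ^- 2)%R (fun x => - x^-1)%R c^-1%R 0%R.
rewrite invrK sub0e EFinN oppeK; apply.
- by move=> x _; rewrite invr_ge0 sqr_ge0.
- apply: continuous_in_subspaceT => x; rewrite inE /= in_itv /= andbT => cx.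
  apply: cvgV; first by rewrite expf_neq0// pos.
  exact: exprn_continuous.
- rewrite -oppr0; apply: cvgN.
  have H : \forall x \near +oo%R, (0 < x :> R)%R by exact: nbhs_pinfty_gt.
  by apply: ((gtr0_cvgV0 H).2).
- by move=> x /ltW /dF [].
- have [/derivable1_diffP/differentiable_continuous H _] := dF _ (lexx c^-1%R).
  have H' : (fun x : R => - x^-1)%R @ c^-1%R --> (- c^-1^-1)%R := H.
  by apply: cvg_at_right_filter; move: H'; rewrite invrK.
- move=> x; rewrite in_itv /= andbT => /ltW /dF H; rewrite derive1E.
  by have [_ ->] := H.
Qed.

End Substitution.

(** * Inversion of the real line *)

Section InversionR.
Local Open Scope ereal_scope.
Context {R : realType}.
Local Notation mu := (@lebesgue_measure R).
Implicit Types (f : R -> \bar R).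

(** The points of the positive half-line that [sinv] sends into ]-oo, c]. *)
Let S (c : R) : set (measurableTypeR R) := [set x | (0 < x)%R && (x^-1 <= c)%R].

Let SE c : S c = if (0 < c)%R then `[c^-1%R, +oo[%classic else set0.
Proof.
apply/seteqP; split=> x; rewrite /S /=; case: ifPn => c0 /=.
- move=> /andP[x0 xc]; rewrite in_itv /= andbT.
  by rewrite -(invrK x) lef_pV2// posrE invr_gt0.
- move=> /andP[x0 xc]; rewrite -leNgt in c0; have := le_trans xc c0.
  by rewrite invr_le0 leNgt x0.
- rewrite in_itv /= andbT => cx.
  have x0 : (0 < x)%R by rewrite (lt_le_trans _ cx)// invr_gt0.
  by rewrite x0 -(invrK c) lef_pV2// posrE invr_gt0.
- by [].
Qed.

Let mS c : measurable (S c).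
Proof. by rewrite SE; case: ifP => _; [exact: measurable_itv|exact: measurable0]. Qed.

Let intS c : \int[mu]_(x in S c) (sinv_jac x)%:E = (Num.max c 0)%:E.
Proof.
have -> : \int[mu]_(x in S c) (sinv_jac x)%:E = \int[mu]_(x in S c) (x ^- 2)%:E.
  by apply: eq_integral => x; rewrite inE => /andP[x0 _]; rewrite /sinv_jac x0.
rewrite SE; case: ifPn => c0; first by rewrite integral_inv_tail// (max_idPl (ltW c0)).
by rewrite integral_set0 (max_idPr _)// leNgt.
Qed.

Let mjac : measurable_fun setT (fun x : measurableTypeR R => (sinv_jac x)%:E).
Proof. by apply/measurable_EFinP; exact: measurable_sinv_jac. Qed.

Lemma integral_sinv f : measurable_fun setT f -> (forall x, 0 <= f x) ->
  \int[mu]_x (f (sinv x) * (sinv_jac x)%:E) = \int[mu]_x f x.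
Proof.
move=> mf f0.
have [nu nuE] := density_measure mu (@measurable_sinv_jac R) (@sinv_jac_ge0 R).
have [nu' nu'E] := pushforward_measure nu (@measurable_sinv R).
have muE A : measurable A -> mu A = nu' A.
  apply: lebesgue_measure_unique => //= _ [[a b]] _ <-.
  rewrite nu'E /pushforward lebesgue_measure_itv/= lte_fin.
  have [ab|ab] := ltP a b; last first.
    rewrite [X in nu X](_ : _ = set0) ?measure0//.
    apply/seteqP; split => // x /=; rewrite in_itv/= => /andP[/lt_le_trans H /H].
    by rewrite ltNge ab.
  (* [P] is the preimage of the positive part of []a, b]], and [N] is its nonpositive part. Their
     measures are differences of max(., 0) and of min(., 0), which add up to b - a. *)
  pose P := S b `\` S a; pose N : set (measurableTypeR R) :=
    `](Num.min a 0)%R, (Num.min b 0)%R]%classic.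
  have PN : sinv @^-1` `]a, b] = P `|` N.
    apply/seteqP; split=> x; rewrite /P /S /N /sinv /= !in_itv /=.
      case: ifPn => x0 /andP[ax xb].
        by left; rewrite xb; split => //=; apply/negP; rewrite -ltNge.
      by right; rewrite -leNgt in x0; rewrite gt_min ax/= le_min xb.
    case=> [[/andP[x0 xb] H]|].
      by rewrite x0 xb andbT ltNge; apply/negP => xa; apply: H; rewrite /S /= x0.
    rewrite gt_min le_min => /andP[ax /andP[xb x0]].
    case: ifPn => x1; first by move: x0; rewrite leNgt x1.
    by rewrite xb andbT; case/orP: ax => //; rewrite (negbTE x1).
  have mP : measurable P by apply: measurableD; exact: mS.
  have mN : measurable N by exact: measurable_itv.
  have PNd : [disjoint P & N].
    apply/eqP/seteqP; split => // x [[/andP[x0 _] _]]; rewrite /N /= in_itv /= => /andP[_].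
    by rewrite le_min => /andP[_]; rewrite leNgt x0.
  rewrite PN nuE; last exact: measurableU.
  rewrite ge0_integral_setU//; last 2 first.
    exact: measurable_funTS.
    by move=> x _; rewrite lee_fin sinv_jac_ge0.
  have -> : \int[mu]_(x in N) (sinv_jac x)%:E = (Num.min b 0 - Num.min a 0)%:E.
    transitivity (\int[mu]_(x in N) (cst 1%E x)).
      apply: eq_integral => x; rewrite inE /N /= in_itv /= => /andP[_].
      by rewrite le_min => /andP[_ x0]; rewrite /sinv_jac ltNge x0.
    rewrite integral_cst// mul1e /= lebesgue_measure_itv /= lte_fin.
    case: ltP => [|ab']; first by rewrite -EFinD.
    by congr EFin; have : (Num.min a 0 <= Num.min b 0)%R by [rewrite le_min !ge_min lexx (ltW ab) orbT]; lra.
  have : \int[mu]_(x in S b) (sinv_jac x)%:E =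
     \int[mu]_(x in S a) (sinv_jac x)%:E + \int[mu]_(x in P) (sinv_jac x)%:E.
    rewrite -ge0_integral_setU//.
    - congr (integral _ _ _); rewrite /P setDUK// => x /= /andP[x0 xa].
      by rewrite /S /= x0 (le_trans xa)// ltW.
    - exact: measurable_funTS.
    - by move=> x _; rewrite lee_fin sinv_jac_ge0.
    - by apply/eqP/seteqP; split => // x [Sa [_]].
  rewrite !intS => H.
  have -> : \int[mu]_(x in P) (sinv_jac x)%:E = (Num.max b 0 - Num.max a 0)%:E.
    by rewrite EFinB H addeAC subee// add0e.
  rewrite -!EFinD; congr EFin.
  by rewrite !maxEle !minEle; do 2 case: ifP; lra.
transitivity (\int[nu']_x f x); last by apply: eq_measure_integral => A mA _; rewrite -muE.
transitivity (\int[nu]_x f (sinv x)).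
  rewrite (@integral_density _ _ _ mu sinv_jac (@measurable_sinv_jac R) (@sinv_jac_ge0 R) nu)//.
  by apply: measurableT_comp => //; exact: measurable_sinv.
have := @ge0_integral_pushforward _ _ _ _ R _ (@measurable_sinv R) nu setT f measurableT mf
   (fun y _ => f0 y).
rewrite preimage_setT /= => <-.
apply/esym/eq_measure_integral => [|m A mA _]; first exact: measurable_sinv.
by rewrite nu'E.
Qed.

Lemma integral_inv_pos f : measurable_fun setT f -> (forall x, 0 <= f x) ->
  \int[mu]_(x in `]0%R, +oo[) (f x^-1%R * (x ^- 2)%:E) = \int[mu]_(x in `]0%R, +oo[) f x.
Proof.
move=> mf f0; rewrite integral_mkcond [RHS]integral_mkcond.
rewrite -[RHS]integral_sinv.
- apply: eq_integral => x _; rewrite /patch /sinv /sinv_jac.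
  have [x0|x0] := ltP 0%R x.
    by rewrite !mem_setE !in_itv /= !andbT invr_gt0 x0.
  by rewrite !mem_setE !in_itv /= andbT ltNge x0 mul0e.
- by apply/(measurable_restrictT _ _).1 => //; exact: measurable_funTS.
- by move=> x; rewrite erestrict_ge0.
Qed.

Lemma integral_neg f : measurable_fun setT f -> (forall x, 0 <= f x) ->
  \int[mu]_(x in `]-oo, 0%R[) f x = \int[mu]_(x in `]0%R, +oo[) f (- x)%R.
Proof.
move=> mf f0; rewrite integral_mkcond [RHS]integral_mkcond.
have := @integral_aff R (-1) 0%R (f \_ `]-oo, 0%R[).
rewrite normrN1 invr1 mul1e => <-.
- apply: eq_integral => x _; rewrite /patch addr0 mulN1r.
  have [x0|x0] := ltP 0%R x.
    by rewrite !mem_setE !in_itv /= andbT oppr_lt0 x0.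
  by rewrite !mem_setE !in_itv /= andbT oppr_lt0 ltNge x0.
- by rewrite oppr_eq0 oner_eq0.
- by apply/(measurable_restrictT _ _).1 => //; exact: measurable_funTS.
- by move=> x; rewrite erestrict_ge0.
Qed.

Lemma integral_split0 f : measurable_fun setT f -> (forall x, 0 <= f x) ->
  \int[mu]_x f x = \int[mu]_(x in `]-oo, 0%R[) f x + \int[mu]_(x in `]0%R, +oo[) f x.
Proof.
move=> mf f0.
have E : [set: R] = (`]-oo, 0%R[ `|` `]0%R, +oo[)%classic `|` [set 0%R].
  apply/seteqP; split => // x _; rewrite /= !in_itv /= andbT.
  by case: (ltgtP x 0%R) => [x0|x0|->]; [left; left|left; right|right].
rewrite E ge0_integral_setU//=; last 3 first.
- exact: measurableU.
- by rewrite -E.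
- apply/eqP/seteqP; split => // x /= [H xE]; move: H; rewrite xE !in_itv /= ltxx; by case.
rewrite integral_set1 adde0 ge0_integral_setU//=.
- exact: measurable_funTS.
- apply/eqP/seteqP; split => // x /= []; rewrite !in_itv /= andbT => x0 x1.
  by have := lt_trans x0 x1; rewrite ltxx.
Qed.

(* [x ^-1] is [0] at [0], where the density [x ^- 2] vanishes. *)
Lemma integral_invr f : measurable_fun setT f -> (forall x, 0 <= f x) ->
  \int[mu]_x (f x^-1%R * (x ^- 2)%:E) = \int[mu]_x f x.
Proof.
move=> mf f0.
have m2 : measurable_fun setT (fun x : measurableTypeR R => (x ^- 2)%:E).
  apply/measurable_EFinP; under eq_fun do rewrite -exprVn.
  by apply: measurable_funX; exact: measurable_inv.
have mg : measurable_fun setT (fun x : measurableTypeR R => f x^-1%R * (x ^- 2)%:E).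
  by apply: emeasurable_funM => //; apply: measurableT_comp => //; exact: measurable_inv.
have g0 x : 0 <= f x^-1%R * (x ^- 2)%:E by rewrite mule_ge0// lee_fin invr_ge0 sqr_ge0.
rewrite integral_split0// [RHS]integral_split0// integral_inv_pos//; congr (_ + _).
rewrite !integral_neg//.
under eq_integral do rewrite invrN sqrrN.
rewrite (@integral_inv_pos (fun x => f (- x)%R))//.
by apply: measurableT_comp => //.
Qed.

End InversionR.

(** * Affine maps, inversion and Moebius maps of the plane *)

Section PlaneSubstitution.
Local Open Scope ereal_scope.
Context {R : realType}.
Local Notation mu := (@lebesgue_measure R).
Implicit Types (f : plane R -> \bar R).

Lemma integral_eq_neq0 (F G : R -> \bar R) :
  measurable_fun setT (F : measurableTypeR R -> \bar R) ->
  measurable_fun setT (G : measurableTypeR R -> \bar R) ->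
  (forall x, x != 0%R -> F x = G x) -> \int[mu]_x F x = \int[mu]_x G x.
Proof.
move=> mF mG FG; apply: ae_eq_integral => //.
exists [set 0%R]; split => //; first exact: lebesgue_measure_set1.
move=> x /= /not_implyP[_ H]; apply: contrapT => /eqP x0; apply: H; exact: FG.
Qed.

Definition lin2 (a b c d e g : R) (p : plane R) : plane R :=
  ((a * p.1 + b * p.2 + e)%R, (c * p.1 + d * p.2 + g)%R).

Lemma measurable_lin2 a b c d e g : measurable_fun setT (lin2 a b c d e g).
Proof.
apply: measurable_fun_pair; do 2 (apply: measurable_funD => //);
  by apply: measurable_funM.
Qed.

Let mpair1 x : measurable_fun setT (fun t : measurableTypeR R => (x, t) : plane R).
Proof. exact: measurable_fun_pair. Qed.

Let mpair2 t : measurable_fun setT (fun x : measurableTypeR R => (x, t) : plane R).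
Proof. exact: measurable_fun_pair. Qed.

Let int2 f := \int[mu \x mu]_p f p.

(** Elimination with pivot [a]: substitute in x for fixed y, exchange the integrals, then substitute
    in y, whose coefficient has become (a d - b c) / a. *)
Lemma integral_lin2_neq0 a b c d e g f : (a != 0)%R -> (a * d - b * c != 0)%R ->
  measurable_fun setT f -> (forall p, 0 <= f p) ->
  int2 (f \o lin2 a b c d e g) = `|a * d - b * c|^-1%:E * int2 f.
Proof.
move=> a0 det0 mf f0; rewrite /int2.
have mfl : measurable_fun setT (f \o lin2 a b c d e g).
  by apply: measurableT_comp => //; exact: measurable_lin2.
rewrite (fubini_tonelli2 _ mfl (fun p => f0 _)) /fubini_G.
pose F y (X : R) := f (X, (c / a * X + (a * d - b * c) / a * y + (g - c / a * e))%R).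
have mF y : measurable_fun setT (F y : measurableTypeR R -> \bar R).
  apply: measurableT_comp => //; apply: measurable_fun_pair => //.
  by do 2 (apply: measurable_funD => //); exact: measurable_funM.
have FE y : \int[mu]_x (f \o lin2 a b c d e g) (x, y) = `|a|^-1%:E * \int[mu]_X F y X.
  rewrite -(@integral_aff R a (b * y + e) (F y) a0 (mF y) (fun x => f0 _)).
  apply: eq_integral => x _; rewrite /F /lin2 /=; congr (f (_, _)); first by ring.
  by field.
under eq_integral do rewrite FE.
have mF2 : measurable_fun setT (fun p : plane R => F p.2 p.1).
  apply: measurableT_comp => //; apply: measurable_fun_pair => //=.
  by do 2 (apply: measurable_funD => //); exact: measurable_funM.
rewrite ge0_integralZl//; last 2 first.
- exact: (@measurable_fun_fubini_tonelli_G _ _ _ _ R mu (fun p : plane R => F p.2 p.1) mF2 (fun p => f0 _)).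
- by move=> y _; apply: integral_ge0 => x _; exact: f0.
rewrite -(fubini_tonelli (fun p : plane R => F p.2 p.1))//=; last by move=> p; exact: f0.
rewrite (fubini_tonelli1 f mf f0) /fubini_F.
pose k := ((a * d - b * c) / a)%R.
have k0 : (k != 0)%R by rewrite mulf_neq0// invr_neq0.
have GE X : \int[mu]_y F y X = `|k|^-1%:E * \int[mu]_Y f (X, Y).
  rewrite -(@integral_aff R k (c / a * X + (g - c / a * e)) (fun Y => f (X, Y)))//.
  - by apply: eq_integral => y _; rewrite /F /k; congr (f (_, _)); ring.
  - apply: measurableT_comp => //; exact: measurable_fun_pair.
under eq_integral do rewrite GE.
rewrite ge0_integralZl//; last 2 first.
- exact: (@measurable_fun_fubini_tonelli_F _ _ _ _ R mu f mf f0).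
- by move=> y _; apply: integral_ge0 => x _; exact: f0.
rewrite muleA -EFinM; congr (_%:E * _).
by rewrite /k normrM normfV -invfM mulrCA mulfV ?normr_eq0// mulr1.
Qed.

Definition ofC (z : R[i]) : plane R := (complex.Re z, complex.Im z).

Lemma ofCK z : toC (ofC z) = z. Proof. by case: z. Qed.

Lemma integral_affC_re (c b : R[i]) f : (complex.Re c != 0)%R ->
  measurable_fun setT f -> (forall p, 0 <= f p) ->
  int2 (fun p => f (ofC (c * toC p + b)%R)) = (cmod c ^- 2)%:E * int2 f.
Proof.
case: c b => a b [e g] /= a0 mf f0.
have E : (a * a - (- b) * b = cmod (a +i* b)%C ^+ 2)%R by rewrite sqr_cmod /=; ring.
have d0 : (a * a - (- b) * b != 0)%R.
  rewrite E expf_neq0// cmod_eq0 eq_complex /= negb_and a0//.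
have := @integral_lin2_neq0 a (- b) b a e g f a0 d0 mf f0.
rewrite E ger0_norm ?sqr_ge0// => <-.
congr (integral _ _ _); apply/funext => -[x y] /=.
rewrite /lin2 /ofC /=; congr (f (_, _)); ring.
Qed.

Lemma measurable_affC (c b : R[i]) : measurable_fun setT (fun p : plane R => ofC (c * toC p + b)%R).
Proof.
case: c b => a b [e g].
have -> : (fun p : plane R => ofC ((a +i* b)%C * toC p + (e +i* g)%C)%R) = lin2 a (- b) b a e g.
  by apply/funext => -[x y]; rewrite /lin2 /ofC /=; congr (_, _); ring.
exact: measurable_lin2.
Qed.

Lemma integral_affC (c b : R[i]) f : (c != 0)%R ->
  measurable_fun setT f -> (forall p, 0 <= f p) ->
  int2 (fun p => f (ofC (c * toC p + b)%R)) = (cmod c ^- 2)%:E * int2 f.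
Proof.
move=> c0 mf f0.
have [r0|] := eqVneq (complex.Re c) 0%R; last by move=> ?; exact: integral_affC_re.
(* When Re c = 0 the pivot vanishes. Then c is written as (c u)(v / 2) with u = 1 + i and v = 1 - i,
   and both factors have a nonzero real part. *)
pose u : R[i] := Complex 1%R 1%R; pose v : R[i] := Complex 1%R (-1)%R.
have uv : (u * v = 2%:R)%R.
  by apply/eqP; rewrite eq_complex /=; apply/andP; split; apply/eqP; ring.
have cu : (complex.Re (c * u) != 0)%R.
  move: c0 r0; case: c => x y /= c0 x0; rewrite x0 mul0r mulr1 sub0r oppr_eq0.
  by move: c0; rewrite x0 eq_complex /= eqxx.
have -> : (fun p => f (ofC (c * toC p + b)%R)) =
   (fun p => (fun q => f (ofC (c * u * toC q + b)%R)) (ofC (v / 2%:R * toC p + 0)%R)).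
  apply/funext => p; rewrite ofCK addr0; congr (f (ofC (_ + _)%R)).
  have -> : (c * u * (v / 2%:R * toC p) = c * (u * v) / 2%:R * toC p)%R by ring.
  by rewrite uv mulfK// pnatr_eq0.
have v2 : (complex.Re (v / 2%:R) != 0)%R.
  have -> : (v / 2%:R = Complex 2^-1 (- 2^-1))%R.
    apply: (@mulIf _ 2%:R); first by rewrite pnatr_eq0.
    rewrite divfK ?pnatr_eq0//; apply/eqP; rewrite eq_complex /=; apply/andP.
    by split; apply/eqP; field.
  by rewrite /= invr_eq0.
rewrite (@integral_affC_re (v / 2%:R)%R 0%R (fun q => f (ofC (c * u * toC q + b)%R)) v2)//; last first.
  by apply: measurableT_comp => //; exact: measurable_affC.
rewrite (@integral_affC_re (c * u)%R b)//.
rewrite muleA -EFinM; congr (_%:E * _).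
rewrite -invfM -exprMn -cmodM.
have -> : (v / 2%:R * (c * u) = c * (u * v) / 2%:R)%R by ring.
by rewrite uv mulfK// pnatr_eq0.
Qed.

Definition inv2 (p : plane R) : plane R := ofC (toC p)^-1%R.

Lemma sqr_cmod_toC (p : plane R) : (cmod (toC p) ^+ 2 = p.1 ^+ 2 + p.2 ^+ 2)%R.
Proof. by rewrite sqr_cmod. Qed.

Lemma mtoC_sqr : measurable_fun setT (fun p : plane R => cmod (toC p) ^+ 2)%R.
Proof.
under eq_fun do rewrite sqr_cmod_toC.
by apply: measurable_funD; exact: measurable_funX.
Qed.

Lemma measurable_inv2 : measurable_fun setT inv2.
Proof.
have -> : inv2 = fun p => ((p.1 * (cmod (toC p) ^+ 2)^-1)%R, (- p.2 * (cmod (toC p) ^+ 2)^-1)%R).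
  apply/funext => p.
  by rewrite /inv2 sqr_cmod_toC; case: p => x y /=; congr (_, _); rewrite mulNr.
apply: measurable_fun_pair; apply: measurable_funM => //.
- by apply: measurableT_comp; [exact: measurable_inv|exact: mtoC_sqr].
- by apply: measurableT_comp.
- by apply: measurableT_comp; [exact: measurable_inv|exact: mtoC_sqr].
Qed.

Lemma measurable_cmod_pow4 : measurable_fun setT (fun p : plane R => (cmod (toC p) ^- 4)%:E).
Proof.
apply/measurable_EFinP.
have -> : (fun p : plane R => cmod (toC p) ^- 4)%R =
   (fun p : plane R => ((cmod (toC p) ^+ 2)^-1) ^+ 2)%R.
  by apply/funext => p; rewrite exprVn -exprM.
apply: measurable_funX; apply: measurableT_comp; [exact: measurable_inv|exact: mtoC_sqr].
Qed.

(* In the coordinates [(x, t)] with [y = t * x], the inversion maps [x] to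
   [(x * (1 + t ^+ 2))^-1] and [t] to [- t]. *)
Lemma integral_inv2 f : measurable_fun setT f -> (forall p, 0 <= f p) ->
  int2 (fun p => f (inv2 p) * (cmod (toC p) ^- 4)%:E) = int2 f.
Proof.
move=> mf f0; rewrite /int2.
have m4 := measurable_cmod_pow4.
pose L (p : plane R) := f (inv2 p) * (cmod (toC p) ^- 4)%:E.
have mL : measurable_fun setT L.
  apply: emeasurable_funM => //; apply: measurableT_comp => //; exact: measurable_inv2.
have L0 p : 0 <= L p.
  by rewrite /L mule_ge0// lee_fin invr_ge0 exprn_ge0// cmod_ge0.
rewrite -/L (fubini_tonelli1 L mL L0).
pose sh (q : plane R) : plane R := (q.1, (q.1 * q.2)%R).
have msh : measurable_fun setT sh.
  by apply: measurable_fun_pair => //; exact: measurable_funM.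
pose K (q : plane R) := `|q.1|%:E * L (sh q).
have mK : measurable_fun setT K.
  apply: emeasurable_funM.
    by apply/measurable_EFinP; apply: measurableT_comp.
  exact: (measurableT_comp mL msh).
have K0 q : 0 <= K q by rewrite mule_ge0// lee_fin.
transitivity (\int[mu]_x \int[mu]_t K (x, t)).
  apply: integral_eq_neq0.
  - exact: measurable_fun_fubini_tonelli_F.
  - exact: (@measurable_fun_fubini_tonelli_F _ _ _ _ R mu K mK K0).
  move=> x x0.
  have mLx : measurable_fun setT (fun y : measurableTypeR R => L (x, y)).
    exact: (measurableT_comp mL (mpair1 x)).
  have mLsx : measurable_fun setT (fun y : measurableTypeR R => L (sh (x, y))).
    exact: (measurableT_comp (measurableT_comp mL msh) (mpair1 x)).
  have -> : \int[mu]_t K (x, t) = `|x|%:E * \int[mu]_t L (sh (x, t)).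
    by rewrite -ge0_integralZl.
  have E := @integral_aff R x 0%R (fun y => L (x, y)) x0 mLx (fun y => L0 _).
  have -> : \int[mu]_t L (sh (x, t)) = \int[mu]_y L (x, (x * y + 0)%R).
    by apply: eq_integral => t _; rewrite /sh addr0.
  by rewrite E muleA -EFinM mulfV ?mul1e// normr_eq0.
rewrite (fubini_tonelli K)//.
pose V (q : plane R) := f (q.1, (- q.2 * q.1)%R) * `|q.1|%:E.
have mV : measurable_fun setT V.
  apply: emeasurable_funM; last by apply/measurable_EFinP; apply: measurableT_comp.
  apply: measurableT_comp => //; apply: measurable_fun_pair => //.
  by apply: measurable_funM => //; apply: measurableT_comp.
have V0 q : 0 <= V q by rewrite mule_ge0// lee_fin.
transitivity (\int[mu]_t \int[mu]_x V (x, t)).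
  apply: eq_integral => t _.
  (* For fixed t the map in x is a dilation by c = 1 + t^2 followed by the inversion of the line;
     [integral_aff] and [integral_invr] give its Jacobian. *)
  have c0 : (1 + t ^+ 2 > 0 :> R)%R by rewrite ltr_wpDr// sqr_ge0.
  set c := (1 + t ^+ 2)%R in c0 *.
  have mVt : measurable_fun setT (fun x : measurableTypeR R => V (x, t)).
    exact: (measurableT_comp mV (mpair2 t)).
  rewrite -(@integral_invr R (fun x => V (x, t)))//.
  pose g (x : measurableTypeR R) := V (x^-1%R, t) * (x ^- 2)%:E.
  have mg : measurable_fun setT g.
    apply: emeasurable_funM.
      exact: (measurableT_comp mVt measurable_inv).
    apply/measurable_EFinP; under eq_fun do rewrite -exprVn.
    by apply: measurable_funX; exact: measurable_inv.
  have g0 x : 0 <= g x by rewrite mule_ge0// lee_fin invr_ge0 sqr_ge0.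
  have := @integral_aff R c 0%R g (lt0r_neq0 c0) mg g0.
  under eq_integral do rewrite addr0.
  move=> Eg; have : \int[mu]_x g x = c%:E * \int[mu]_x g (c * x)%R.
    by rewrite Eg muleA -EFinM gtr0_norm// mulfV ?mul1e// gt_eqF.
  have mcx : measurable_fun setT (fun x : measurableTypeR R => (c * x)%R : measurableTypeR R).
    exact: measurable_funM.
  have mgc : measurable_fun setT (fun x : measurableTypeR R => g (c * x)%R).
    exact: (measurableT_comp mg mcx).
  rewrite {1}/g => ->; rewrite -ge0_integralZl//; last by rewrite lee_fin ltW.
  apply: eq_integral => x _; rewrite /K /L /g /V.
  (* At x = 0 both sides vanish, the inverse of 0 being 0. *)
  have [->|x0] := eqVneq x 0%R.
    by rewrite normr0 mul0e !mulr0 invr0 normr0 !mule0 mul0e mule0.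
  have E1 : (cmod (toC (sh (x, t))) ^+ 2 = x ^+ 2 * c)%R.
    by rewrite sqr_cmod_toC /sh /c /=; ring.
  have -> : inv2 (sh (x, t)) = ((c * x)^-1%R, (- t * (c * x)^-1)%R).
    rewrite /inv2 /ofC /sh /=; congr (_, _).
      have -> : (x ^+ 2 + (x * t) ^+ 2 = x ^+ 2 * c)%R by rewrite /c; ring.
      by field; rewrite x0 gt_eqF.
    have -> : (x ^+ 2 + (x * t) ^+ 2 = x ^+ 2 * c)%R by rewrite /c; ring.
    by field; rewrite x0 gt_eqF.
  have -> : (cmod (toC (sh (x, t))) ^- 4 = (x ^+ 2 * c) ^- 2)%R by rewrite -E1 -exprM.
  rewrite -[in RHS]muleA -EFinM muleCA -EFinM muleCA -EFinM; congr (_ * _%:E).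
  have [cx0 xx0] : (c != 0 /\ `|x| != 0)%R by rewrite gt_eqF// normr_eq0.
  rewrite normfV normrM (gtr0_norm c0).
  rewrite [(c * x)%R ^- 2](_ : _ = (c ^+ 2 * `|x| ^+ 2)^-1)%R; last first.
    by rewrite exprMn real_normK ?num_real.
  rewrite [(x ^+ 2 * c)%R](_ : _ = (`|x| ^+ 2 * c)%R); last first.
    by rewrite real_normK ?num_real.
  by field; apply/andP.
apply: etrans (_ : _ = \int[mu]_x \int[mu]_t V (x, t)) _.
  by rewrite (fubini_tonelli V).
rewrite (fubini_tonelli1 f mf f0).
apply: integral_eq_neq0.
- exact: (@measurable_fun_fubini_tonelli_F _ _ _ _ R mu V mV V0).
- exact: (@measurable_fun_fubini_tonelli_F _ _ _ _ R mu f mf f0).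
move=> x x0; rewrite /fubini_F.
have mfx : measurable_fun setT (fun y : measurableTypeR R => f (x, y)).
  exact: (measurableT_comp mf (mpair1 x)).
have mx : measurable_fun setT (fun t : measurableTypeR R => (- t * x)%R : measurableTypeR R).
  by apply: measurable_funM => //; apply: measurableT_comp.
have mfmx : measurable_fun setT (fun t : measurableTypeR R => f (x, (- t * x)%R)).
  exact: (measurableT_comp mfx mx).
have -> : \int[mu]_t V (x, t) = `|x|%:E * \int[mu]_t f (x, (- t * x)%R).
  by rewrite -ge0_integralZl//; apply: eq_integral => t _; rewrite /V muleC.
have Nx0 : (- x != 0)%R by rewrite oppr_eq0.
have := @integral_aff R (- x) 0%R (fun y => f (x, y)) Nx0 mfx (fun y => f0 _).
have -> : \int[mu]_x0 f (x, (- x * x0 + 0)%R) = \int[mu]_t f (x, (- t * x)%R).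
  by apply: eq_integral => t _; rewrite addr0 mulNr mulrC mulNr.
by move=> ->; rewrite muleA -EFinM normrN mulfV ?mul1e// normr_eq0.
Qed.

(** The map is the composition of an affine map, the inversion and another affine map. *)
Lemma integral_moebius (A B C D : R[i]) f : (B != 0)%R -> (C != 0)%R ->
  measurable_fun setT f -> (forall p, 0 <= f p) ->
  int2 (fun p => f (ofC (A + B / (C * toC p + D))%R) *
     (cmod (C * toC p + D)%R ^- 4)%:E) = ((cmod (B * C)%R) ^- 2)%:E * int2 f.
Proof.
move=> B0 C0 mf f0.
pose g (p : plane R) := f (ofC (A + B * toC p)%R).
have gE : g = fun p => f (ofC (B * toC p + A)%R).
  by apply/funext => p; rewrite /g addrC.
have mg : measurable_fun setT g.
  by rewrite gE; apply: (measurableT_comp mf); exact: measurable_affC.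
have g0 p : 0 <= g p by exact: f0.
have m4 := measurable_cmod_pow4.
pose L (p : plane R) := g (inv2 p) * (cmod (toC p) ^- 4)%:E.
have mL : measurable_fun setT L.
  apply: emeasurable_funM => //; exact: (measurableT_comp mg measurable_inv2).
have L0 p : 0 <= L p.
  by rewrite mule_ge0// lee_fin invr_ge0 exprn_ge0// cmod_ge0.
have -> : (fun p => f (ofC (A + B / (C * toC p + D))%R) *
     (cmod (C * toC p + D)%R ^- 4)%:E) = (fun p => L (ofC (C * toC p + D)%R)).
  by apply/funext => p; rewrite /L /g /inv2 !ofCK.
rewrite integral_affC// integral_inv2// gE integral_affC// muleA -EFinM.
by rewrite cmodM exprMn -invfM mulrC.
Qed.


End PlaneSubstitution.

(** * Disc automorphisms and the area measure *)

Section DiscAutomorphism.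
Context {R : realType}.
Implicit Types (a z w : R[i]).

Lemma disc_sqr_lt1 z : disc z -> cmod z ^+ 2 < 1.
Proof. by move=> zD; rewrite expr_lt1// cmod_ge0. Qed.

Lemma one_sub_sqr_gt0 z : disc z -> 0 < 1 - cmod z ^+ 2.
Proof. by move=> /disc_sqr_lt1 ?; rewrite subr_gt0. Qed.

Lemma cmod_denom_ge a z : disc a -> disc z -> 1 - cmod a <= cmod (1 - conjc a * z).
Proof.
move=> aD zD; have : cmod (conjc a * z) <= cmod a.
  by rewrite cmodM cmod_conj ler_piMr ?cmod_ge0// ltW.
have := cmodD (1 - conjc a * z) (conjc a * z); rewrite subrK cmod1; lra.
Qed.

Lemma cmod_denom_ge' a z : disc a -> disc z -> 1 - cmod z <= cmod (1 - conjc a * z).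
Proof.
move=> aD zD; have : cmod (conjc a * z) <= cmod z.
  by rewrite cmodM cmod_conj ler_piMl ?cmod_ge0// ltW.
have := cmodD (1 - conjc a * z) (conjc a * z); rewrite subrK cmod1; lra.
Qed.

Lemma cmod_denom_gt0 a z : disc a -> disc z -> 0 < cmod (1 - conjc a * z).
Proof.
by move=> aD zD; apply: lt_le_trans (cmod_denom_ge aD zD); rewrite subr_gt0.
Qed.

Lemma cmod_denom_le2 a z : disc a -> disc z -> cmod (1 - conjc a * z) <= 2.
Proof.
move=> aD zD; apply: le_trans (cmodB _ _) _; rewrite cmod1 cmodM cmod_conj.
have : cmod a * cmod z <= 1 * 1 by rewrite ler_pM ?cmod_ge0// ltW.
by rewrite mulr1; lra.
Qed.

Lemma denom_neq0 a z : disc a -> disc z -> 1 - conjc a * z != 0.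
Proof. by move=> aD zD; rewrite -cmod_gt0 cmod_denom_gt0. Qed.

Lemma one_sub_sqr_phi a z : disc a -> disc z ->
  1 - cmod (phi a z) ^+ 2 =
  (1 - cmod a ^+ 2) * (1 - cmod z ^+ 2) / cmod (1 - conjc a * z) ^+ 2.
Proof.
move=> aD zD; rewrite /phi cmodM cmodV exprMn exprVn.
have d0 : cmod (1 - conjc a * z) ^+ 2 != 0.
  by rewrite expf_neq0// gt_eqF// cmod_denom_gt0.
apply: (mulIf d0); rewrite mulrBl !divfK// mul1r.
by rewrite !sqr_cmod; case: a z {aD zD d0} => a b [c d] /=; ring.
Qed.

Lemma phi_disc a z : disc a -> disc z -> disc (phi a z).
Proof.
move=> aD zD; rewrite /disc/mkset -(@ltr_pXn2r _ 2)// ?nnegrE ?cmod_ge0//.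
rewrite expr1n -subr_gt0 one_sub_sqr_phi// divr_gt0// ?exprn_gt0 ?cmod_denom_gt0//.
by rewrite mulr_gt0// one_sub_sqr_gt0.
Qed.

(** Stated off the pole rather than on the disc, because [phi_outside] applies it to points outside
    the disc. *)
Lemma phi_phi a z : disc a -> 1 - conjc a * z != 0 -> phi a (phi a z) = z.
Proof.
move=> aD d0; have aJ := denom_neq0 aD aD.
have e1 : a - phi a z = (1 - conjc a * a) * z / (1 - conjc a * z).
  by rewrite /phi; field.
have e2 : 1 - conjc a * phi a z = (1 - conjc a * a) / (1 - conjc a * z).
  by rewrite /phi; field.
by rewrite {1}/phi e1 e2; field; rewrite d0 aJ.
Qed.

Lemma phiK a z : disc a -> disc z -> phi a (phi a z) = z.
Proof. by move=> aD zD; apply: phi_phi => //; exact: denom_neq0. Qed.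

Lemma phi0 a : phi a 0 = a.
Proof. by rewrite /phi mulr0 !subr0 divr1. Qed.

Lemma phi_outside a z : disc a -> ~ disc z -> 1 - conjc a * z != 0 -> ~ disc (phi a z).
Proof.
by move=> aD zD d0 wD; apply: zD; rewrite -(phi_phi aD d0); exact: phi_disc.
Qed.

Lemma cdiff_denom a z : cdiff (fun z => 1 - conjc a * z) z (- conjc a).
Proof.
apply: (@cdiff_eq _ _ _ (0 - (0 * z + conjc a * 1))); first by ring.
by apply: cdiffB; [exact: cdiff_cst|apply: cdiffM; [exact: cdiff_cst|exact: cdiff_id]].
Qed.

Lemma cdiff_phi a z : disc a -> disc z ->
  cdiff (phi a) z (- (1 - cmod a ^+ 2)%:C%C / (1 - conjc a * z) ^+ 2).
Proof.
move=> aD zD; have d0 := denom_neq0 aD zD.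
have H1 : cdiff (fun z => a - z) z (0 - 1).
  by apply: cdiffB; [exact: cdiff_cst|exact: cdiff_id].
have := cdiffM H1 (@cdiffV R (fun w => 1 - conjc a * w) z _ d0 (cdiff_denom a z)); apply: cdiff_eq.
have -> : (1 - cmod a ^+ 2)%:C%C = 1 - conjc a * a by rewrite mulcJ rmorphB /= rmorph1.
by field.
Qed.

Local Open Scope ereal_scope.
Local Notation mu := (@lebesgue_measure R).

Lemma measurable_phi a :
  measurable_fun setT (fun p : plane R => ofC (phi a (toC p))).
Proof.
pose W (p : plane R) : plane R := inv2 (ofC (- conjc a * toC p + 1)%R).
have mW : measurable_fun setT W.
  exact: (measurableT_comp (@measurable_inv2 R) (measurable_affC _ _)).
have mW1 : measurable_fun setT (fun p => (W p).1).
  exact: (measurableT_comp measurable_fst mW).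
have mW2 : measurable_fun setT (fun p => (W p).2).
  exact: (measurableT_comp measurable_snd mW).
have -> : (fun p : plane R => ofC (phi a (toC p))) = (fun p : plane R =>
    (((complex.Re a - p.1) * (W p).1 - (complex.Im a - p.2) * (W p).2)%R,
     ((complex.Re a - p.1) * (W p).2 + (complex.Im a - p.2) * (W p).1)%R)).
  apply/funext => p.
  have -> : W p = ofC (1 - conjc a * toC p)^-1%R by rewrite /W /inv2 ofCK mulNr addrC.
  by rewrite /phi; case: (_^-1)%R => u v; case: a {W mW mW1 mW2} => x y; case: p.
apply: measurable_fun_pair.
  apply: measurable_funB; apply: measurable_funM => //; exact: measurable_funB.
apply: measurable_funD; apply: measurable_funM => //; exact: measurable_funB.
Qed.

Lemma Hol_denom a : Hol (fun z => (1 - conjc a * z)%R).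
Proof. by apply: HolP => z _; eexists; exact: cdiff_denom. Qed.

Lemma measurable_denom_pow a k : measurable_fun setT
  (fun p : plane R => (cmod (1 - conjc a * toC p)%R ^+ k)^-1%R).
Proof.
apply: (measurableT_comp measurable_inv); apply: measurable_funX.
apply: (@cmeas_cmod _ setT (fun z => (1 - conjc a * z)%R)).
by apply: cmeas_cdiff => [p _|p _]; [exists 1%R|eexists; exact: cdiff_denom].
Qed.

Lemma measurable_phi_jac a : measurable_fun setT
  (fun p : plane R => (1 - cmod a ^+ 2) ^+ 2 / cmod (1 - conjc a * toC p) ^+ 4)%R.
Proof. by apply: measurable_funM => //; exact: measurable_denom_pow. Qed.

Lemma integral_phi a (f : plane R -> \bar R) : disc a ->
  measurable_fun setT f -> (forall p, 0 <= f p) ->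
  \int[mu \x mu]_p (f (ofC (phi a (toC p))) *
     ((1 - cmod a ^+ 2) ^+ 2 / cmod (1 - conjc a * toC p)%R ^+ 4)%:E) =
  \int[mu \x mu]_p f p.
Proof.
move=> aD mf f0; have aJ := one_sub_sqr_gt0 aD.
(* phi_0 is z -> - z, which has no pole and so is not of the form treated by [integral_moebius]. *)
have [->|a0] := eqVneq a 0%R.
  rewrite cmod0 expr0n /= subr0 expr1n.
  have -> : (fun p : plane R => f (ofC (phi 0%R (toC p))) *
     (1 / cmod (1 - conjc 0 * toC p)%R ^+ 4)%:E) =
     (fun p => f (ofC (-1 * toC p + 0)%R)).
    apply/funext => p; rewrite conjc0 mul0r subr0 cmod1 expr1n divr1 mule1.
    by congr (f (ofC _)); rewrite /phi conjc0 mul0r subr0 divr1 sub0r addr0 mulN1r.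
  have N1 : (-1 != 0 :> R[i])%R by rewrite oppr_eq0 oner_eq0.
  rewrite (integral_affC 0%R N1 mf f0).
  by rewrite cmodN cmod1 expr1n invr1 mul1e.
have ca0 : conjc a != 0%R by rewrite conjc_eq0.
(* The partial fraction phi_a(z) = 1 / conj(a) + B / (1 - conj(a) z). *)
pose B := (- (1 - conjc a * a) / conjc a)%R.
have aJ' := denom_neq0 aD aD.
have B0 : (B != 0)%R by rewrite mulf_neq0 ?invr_neq0// oppr_eq0.
have C0 : (- conjc a != 0)%R by rewrite oppr_eq0.
have BC : (cmod (B * - conjc a)%R = 1 - cmod a ^+ 2)%R.
  have -> : (B * - conjc a = (1 - cmod a ^+ 2)%:C%C)%R.
    by rewrite rmorphB /= rmorph1 -mulcJ /B; field.
  by rewrite cmod_real gtr0_norm.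
have := @integral_moebius R (conjc a)^-1%R B (- conjc a)%R 1%R f B0 C0 mf f0.
rewrite BC => E.
pose L (p : plane R) := f (ofC (phi a (toC p))) *
     ((1 - cmod a ^+ 2) ^+ 2 / cmod (1 - conjc a * toC p)%R ^+ 4)%:E.
have LE : (fun p => f (ofC ((conjc a)^-1 + B / (- conjc a * toC p + 1))%R) *
     (cmod (- conjc a * toC p + 1)%R ^- 4)%:E) =
   (fun p => ((1 - cmod a ^+ 2) ^- 2)%:E * L p).
  apply/funext => p; rewrite /L.
  have -> : (- conjc a * toC p + 1 = 1 - conjc a * toC p)%R by rewrite addrC mulNr.
  have [->|d0] := eqVneq (1 - conjc a * toC p)%R 0%R.
    by rewrite cmod0 expr0n /= !(invr0, mulr0, mule0).
  have -> : ((conjc a)^-1 + B / (1 - conjc a * toC p) = phi a (toC p))%R.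
    by rewrite /B /phi; field; rewrite ca0 d0.
  by rewrite muleCA -EFinM mulrA mulVf ?mul1r// expf_neq0// gt_eqF.
have mL : measurable_fun setT L.
  apply: emeasurable_funM; first exact: (measurableT_comp mf (measurable_phi a)).
  by apply/measurable_EFinP; exact: measurable_phi_jac.
have k0 : (0 < (1 - cmod a ^+ 2) ^- 2)%R by rewrite invr_gt0 exprn_gt0.
have L0 p : 0 <= L p by rewrite mule_ge0// lee_fin mulr_ge0 ?sqr_ge0// invr_ge0 exprn_ge0// cmod_ge0.
move: E; rewrite LE ge0_integralZl//; last by rewrite lee_fin ltW.
move=> /(congr1 (fun x => ((1 - cmod a ^+ 2) ^+ 2)%:E * x)).
by rewrite !muleA -!EFinM mulfV ?mul1e// expf_neq0// gt_eqF.
Qed.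

Lemma integral_area (D : set (plane R)) (f : plane R -> \bar R) : measurable D ->
  measurable_fun D f -> (forall p, D p -> 0 <= f p) ->
  \int[area]_(p in D) f p = (pi^-1)%:E * \int[mu \x mu]_(p in D) f p.
Proof. by move=> mD mf f0; rewrite /area ge0_integral_mscale. Qed.

(** phi_a maps the disc into itself and, off the pole, the complement into itself, so [integral_phi]
    for the extension of [u] by 0 restricts to the disc; at the pole the Jacobian factor is 0. *)
Lemma area_phi a (u : plane R -> \bar R) : disc a ->
  measurable_fun disc2 u -> (forall p, disc2 p -> 0 <= u p) ->
  \int[area]_(p in disc2) (u (ofC (phi a (toC p))) *
     ((1 - cmod a ^+ 2) ^+ 2 / cmod (1 - conjc a * toC p)%R ^+ 4)%:E) =
  \int[area]_(p in disc2) u p.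
Proof.
move=> aD mu' u0; have mD := @measurable_disc2 R.
pose f := u \_ disc2.
have mf : measurable_fun setT f by apply: (measurable_restrictT _ mD).1; exact: mu'.
have f0 p : 0 <= f p by rewrite erestrict_ge0.
have key := integral_phi aD mf f0.
have E : (fun p : plane R => f (ofC (phi a (toC p))) *
     ((1 - cmod a ^+ 2) ^+ 2 / cmod (1 - conjc a * toC p)%R ^+ 4)%:E) =
   (fun p => u (ofC (phi a (toC p))) *
     ((1 - cmod a ^+ 2) ^+ 2 / cmod (1 - conjc a * toC p)%R ^+ 4)%:E) \_ disc2.
  apply/funext => p; rewrite /f /patch; have [pD|pD] := boolP (p \in disc2).
    rewrite mem_set//; rewrite inE in pD.
    by rewrite /disc2 /= ofCK; exact: phi_disc.
  have [d0|d0] := eqVneq (1 - conjc a * toC p)%R 0%R.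
    by rewrite d0 cmod0 expr0n /= invr0 mulr0 mule0.
  rewrite memNset ?mul0e// /disc2 /= ofCK.
  by apply: phi_outside => // ?; move: pD; rewrite notin_setE; apply.
have mg : measurable_fun disc2 (fun p : plane R => u (ofC (phi a (toC p))) *
     ((1 - cmod a ^+ 2) ^+ 2 / cmod (1 - conjc a * toC p)%R ^+ 4)%:E).
  apply: (measurable_restrictT _ mD).2; rewrite -E; apply: emeasurable_funM.
    exact: (measurableT_comp mf (measurable_phi a)).
  by apply/measurable_EFinP; exact: measurable_phi_jac.
rewrite integral_area//; last first.
  move=> p pD; rewrite mule_ge0// ?u0//; first by rewrite /disc2 /= ofCK; exact: phi_disc.
  by rewrite lee_fin divr_ge0 ?sqr_ge0// exprn_ge0// cmod_ge0.
rewrite [RHS]integral_area//; congr (_ * _).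
by rewrite integral_mkcond -E key [RHS]integral_mkcond.
Qed.

End DiscAutomorphism.

(** * Growth of Dirichlet-Morrey functions *)

Section PathDerivative.
Context {R : realType}.
Implicit Types (f : R[i] -> R[i]) (z w d : R[i]).

Lemma cdiff_path f z w t d : cdiff f (z + t%:C%C * w) d ->
  is_derive (t : R) 1 (fun u : R => complex.Re (f (z + u%:C%C * w))) (complex.Re (d * w)) /\
  is_derive (t : R) 1 (fun u : R => complex.Im (f (z + u%:C%C * w))) (complex.Im (d * w)).
Proof.
move=> H.
have key (e : R) : 0 < e -> \forall h \near (0 : R)^',
   cmod (h^-1%:C%C * (f (z + (h + t)%:C%C * w) - f (z + t%:C%C * w)) - d * w) <= e.
  move=> e0; pose W := cmod w + 1.
  have W0 : 0 < W by rewrite ltr_wpDl// cmod_ge0.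
  have [r r0 Hr] := H _ (divr_gt0 e0 W0).
  near=> h.
  have h0 : h != 0 by near: h; exact: nbhs_dnbhs_neq.
  have hr : `|h| < r / W.
    near: h; apply: (@nbhs_dnbhs _ (0:R)).
    have : 0 < r / W by rewrite divr_gt0.
    move=> rW; exists (r / W) => // y /=; by rewrite sub0r normrN.
  have E : z + (h + t)%:C%C * w - (z + t%:C%C * w) = h%:C%C * w.
    by rewrite rmorphD /=; ring.
  have := Hr (z + (h + t)%:C%C * w); rewrite E cmodM cmod_real => H1.
  have {}H1 : `|h| * cmod w < r.
    apply: (@le_lt_trans _ _ (`|h| * W)); last by rewrite -ltr_pdivlMr.
    by rewrite ler_wpM2l// lerDl.
  have := Hr (z + (h + t)%:C%C * w); rewrite E cmodM cmod_real => /(_ H1) H2.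
  have -> : h^-1%:C%C * (f (z + (h + t)%:C%C * w) - f (z + t%:C%C * w)) - d * w =
     h^-1%:C%C * (f (z + (h + t)%:C%C * w) - f (z + t%:C%C * w) - d * (h%:C%C * w)).
    have hh : h^-1%:C%C * h%:C%C = 1 :> R[i] by rewrite -rmorphM /= mulVf.
    by rewrite [RHS]mulrBr [_ * (d * _)]mulrCA [h^-1%:C%C * (h%:C%C * w)]mulrA hh mul1r.
  rewrite cmodM cmod_real normfV ler_pdivrMl ?normr_gt0//.
  apply: le_trans H2 _.
  have W1 : cmod w / W <= 1 by rewrite ler_pdivrMr// mul1r lerDl.
  have -> : e / W * (`|h| * cmod w) = `|h| * (e * (cmod w / W)) by ring.
  by rewrite ler_wpM2l// ler_piMr// ltW.
have gen (P : {additive R[i] -> R}) : (forall z, `|P z| <= cmod z) ->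
    (forall (k : R) z, P (k%:C%C * z) = k * P z) ->
    is_derive (t : R) 1 (fun u : R => P (f (z + u%:C%C * w))) (P (d * w)).
  move=> Ple PM; suff cv : (fun h : R => h^-1 *: (((fun u : R => P (f (z + u%:C%C * w))) \o
      shift t) (h *: 1) - P (f (z + t%:C%C * w)))) @ (0 : R)^' --> P (d * w).
    by apply: DeriveDef; [apply/cvg_ex; eexists; exact: cv|exact/cvg_lim].
  apply/cvgrPdist_le => e /key; apply: filterS => h; apply: le_trans.
  rewrite cmod_distC -[h *: 1]/(h * 1) mulr1 -[_ *: _]/(_ * _) /=.
  by rewrite -raddfB -PM -raddfB Ple.
by split; [exact: (gen _ (@cmod_Re R) (@Re_realM R))|exact: (gen _ (@cmod_Im R) (@Im_realM R))].
Unshelve. all: by end_near. Qed.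

(** The mean value theorem for u - g, in place of integrating the derivatives. *)
Lemma derive_le_compare (u g du dg : R -> R) :
  (forall t : R, 0 <= t <= 1 -> is_derive t 1 u (du t)) ->
  (forall t : R, 0 <= t <= 1 -> is_derive t 1 g (dg t)) ->
  (forall t, 0 <= t <= 1 -> du t <= dg t) -> u 1 - u 0 <= g 1 - g 0.
Proof.
move=> Hu Hg H.
have D (t : R) : 0 <= t <= 1 -> is_derive t 1 (u \- g) (du t - dg t).
  by move=> t01; have := is_deriveB (Hu t t01) (Hg t t01).
have [||c] := @MVT R (u \- g) (fun t => du t - dg t) 0 1 ltr01.
- by move=> x; rewrite in_itv /= => /andP[x0 x1]; apply: D; rewrite !ltW.
- apply: continuous_in_subspaceT => x; rewrite inE /= in_itv /= => x01.
  by apply: differentiable_continuous; apply/derivable1_diffP; have [] := D x x01.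
rewrite in_itv /= => /andP[c0 c1]; rewrite subr0 mulr1 => E.
have : du c <= dg c by apply: H; rewrite !ltW.
by move: E; lra.
Qed.

(** [dg] bounds the speed of [f] along the segment; the factor 2 comes from treating real and
    imaginary parts separately. *)
Lemma path_bound f z w (g dg : R -> R) :
  (forall t : R, 0 <= t <= 1 -> exists2 d, cdiff f (z + t%:C%C * w) d & cmod (d * w) <= dg t) ->
  (forall t : R, 0 <= t <= 1 -> is_derive t 1 g (dg t)) ->
  cmod (f (z + w) - f z) <= 2 * (g 1 - g 0).
Proof.
move=> Hf Hg.
pose D (t : R) := if pselect (exists2 d, cdiff f (z + t%:C%C * w) d & cmod (d * w) <= dg t)
   is left P then projT1 (cid2 P) else 0.
have HD (t : R) : 0 <= t <= 1 -> cdiff f (z + t%:C%C * w) (D t) /\ cmod (D t * w) <= dg t.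
  move=> /Hf P; rewrite /D; case: pselect => // P'; by case: (cid2 P').
have e1 : z + 1%:C%C * w = z + w by rewrite mul1r.
have e0 : z + 0%:C%C * w = z by rewrite mul0r addr0.
have bnd (u du : R -> R) : (forall t : R, 0 <= t <= 1 -> is_derive t 1 u (du t)) ->
    (forall t, 0 <= t <= 1 -> `|du t| <= dg t) -> `|u 1 - u 0| <= g 1 - g 0.
  move=> Hu Hdu; rewrite ler_norml; apply/andP; split.
    have := @derive_le_compare (\- u) g (\- du) dg.
    have h1 : forall t : R, 0 <= t <= 1 -> is_derive t 1 (\- u) ((\- du) t).
      by move=> t /Hu ?; exact: is_deriveN.
    move=> /(_ h1 Hg) -/(_ _) H.
    have /H : forall t, 0 <= t <= 1 -> (\- du) t <= dg t.
      by move=> t /Hdu; rewrite ler_norml /= lerNl => /andP[].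
    by rewrite /=; lra.
  apply: (derive_le_compare Hu Hg) => t /Hdu; by rewrite ler_norml => /andP[].
apply: le_trans (cmod_le _) _; rewrite mulr2n mulrDl !mul1r.
rewrite !raddfB -e1 -{2 4}e0; apply: lerD.
  apply: (bnd (fun u => complex.Re (f (z + u%:C%C * w))) (fun t => complex.Re (D t * w))).
    by move=> t /HD[/cdiff_path[]].
  by move=> t /HD[_]; apply: le_trans; exact: cmod_Re.
apply: (bnd (fun u => complex.Im (f (z + u%:C%C * w))) (fun t => complex.Im (D t * w))).
  by move=> t /HD[/cdiff_path[]].
by move=> t /HD[_]; apply: le_trans; exact: cmod_Im.
Qed.

Lemma path_lip f z w M :
  (forall t : R, 0 <= t <= 1 -> exists2 d, cdiff f (z + t%:C%C * w) d & cmod d <= M) ->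
  cmod (f (z + w) - f z) <= 2 * (M * cmod w).
Proof.
move=> H; have := @path_bound f z w (fun t => M * cmod w * t) (fun=> M * cmod w).
rewrite mulr1 mulr0 subr0; apply.
  by move=> t /H[d dz dM]; exists d => //; rewrite cmodM ler_wpM2r// cmod_ge0.
move=> t _; have := @is_deriveZ R R R id (M * cmod w) t 1 1 (is_derive_id _ _).
by rewrite /= [_ *: _]mulr1.
Qed.

End PathDerivative.

(** * Local bounds for f' near the origin *)

Section BoxBounds.
Context {R : realType}.
Implicit Types (f : R[i] -> R[i]) (z w d : R[i]) (x y : R).

(** 2 (7/10)^2 < 1. The boxes of half side 1/2, 6/10 and 7/10 are nested with margins 1/10: the
    outer margin serves the Cauchy estimate for f', the inner one the steps of the difference
    quotients. *)
Lemma box_disc x y : `|x| <= 7 / 10 -> `|y| <= 7 / 10 -> disc (x +i* y)%C.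
Proof.
move=> x7 y7; rewrite /disc/mkset -(@ltr_pXn2r _ 2)// ?nnegrE ?cmod_ge0//.
rewrite expr1n sqr_cmod /= -[x ^+ 2]real_normK ?num_real// -[y ^+ 2]real_normK ?num_real//.
have := normr_ge0 x; have := normr_ge0 y; nra.
Qed.

Lemma Hol_box_bounded f : Hol f -> exists M, forall x y,
  `|x| <= 7 / 10 -> `|y| <= 7 / 10 -> cmod (f (x +i* y)%C) <= M.
Proof.
move=> Hf.
pose K : set (R * R) := `[- (7 / 10), 7 / 10]%classic `*` `[- (7 / 10), 7 / 10]%classic.
have cK : compact K by apply: compact_setX; exact: segment_compact.
have K0 : K !=set0 by exists (0, 0); split; rewrite /= in_itv /=; lra.
have [|c _ Hc] := @compact_EVT_max _ R (fun q : R * R => cmod (f (toC q))) K K0 cK.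
  apply: continuous_in_subspaceT => -[x y]; rewrite inE => -[/=].
  rewrite !in_itv /= => xs ys.
  have xyD : disc (x +i* y)%C by apply: box_disc; rewrite ler_norml.
  have /cdiff_cont H := Hol_cdiff Hf xyD.
  apply/cvgrPdist_le => e e0; have [r r0 Hr] := H _ e0.
  have r20 : 0 < r / 2 by rewrite divr_gt0.
  have : \forall q \near (x, y), `|x - q.1| < r / 2 /\ `|y - q.2| < r / 2.
    exists (ball x (r / 2), ball y (r / 2)); last by move=> q [].
    by split; exact: nbhsx_ballx.
  apply: filterS => q [q1 q2]; rewrite distrC (le_trans (cmod_lip _ _))// Hr//.
  apply: le_lt_trans (cmod_le _) _; rewrite -[complex.Re _]/(q.1 - x) -[complex.Im _]/(q.2 - y).
  by move: q1 q2; rewrite distrC (distrC y); lra.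
exists (cmod (f (toC c))) => x y xs ys; apply: (Hc (x, y)); rewrite inE; split; rewrite /= in_itv /=.
  by move: xs; rewrite ler_norml.
by move: ys; rewrite ler_norml.
Qed.

Lemma Hol_box_deriv_bounded f : Hol f -> exists M, forall x y,
  `|x| <= 6 / 10 -> `|y| <= 6 / 10 -> cmod (cderiv f (x +i* y)%C) <= M.
Proof.
(* 40 = 4 / (1/10), from [cauchy_deriv_bound] on a square of half side 1/10. *)
move=> Hf; have [M HM] := Hol_box_bounded Hf; exists (40 * M) => x y xs ys.
have xyD : disc (x +i* y)%C by apply: box_disc; lra.
have sh u v : ((x +i* y) + (u +i* v))%C = ((x + u) +i* (y + v))%C by [].
have := @cauchy_deriv_bound R (fun w => f ((x +i* y)%C + w)) (1 / 10) M (cderiv f (x +i* y)%C).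
rewrite divr_gt0// => /(_ isT) H.
have : 1 / 10 * cmod (cderiv f (x +i* y)%C) <= 4 * M.
  have cd z : cdiff (fun w => (x +i* y)%C + w) z 1.
    by rewrite -[X in cdiff _ _ X]add0r; apply: cdiffD; [exact: cdiff_cst|exact: cdiff_id].
  apply: H.
  - move=> u v us vs; eexists; apply: cdiff_comp; first exact: cd.
    apply: Hol_cdiff => //; rewrite sh; apply: box_disc; apply: le_trans (ler_normD _ _) _; lra.
  - move=> u v us vs; rewrite sh; apply: HM; apply: le_trans (ler_normD _ _) _; lra.
  - rewrite -[X in cdiff _ _ X]mulr1; apply: cdiff_comp; first exact: cd.
    by rewrite addr0; exact: Hol_cdiff.
by lra.
Qed.

End BoxBounds.

Section AreaMean.
Context {R : realType}.
Local Notation mu := (@lebesgue_measure R).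
Implicit Types (F : R[i] -> R[i]).

Definition half_box : set (plane R) := [set p | `|p.1| < 2^-1 /\ `|p.2| < 2^-1].

Lemma half_box_open : box_open half_box.
Proof.
move=> p [p1 p2]; exists (Num.min (2^-1 - `|p.1|) (2^-1 - `|p.2|)).
  by rewrite lt_min !subr_gt0 p1 p2.
move=> q; rewrite !lt_min => /andP[q1 _] /andP[_ q2]; split.
  have := ler_normD (q.1 - p.1) p.1; rewrite subrK; lra.
have := ler_normD (q.2 - p.2) p.2; rewrite subrK; lra.
Qed.

Lemma measurable_half_box : measurable half_box.
Proof. exact: box_open_measurable half_box_open. Qed.

Lemma sintD (a b : R) f g : cont_on a b f -> cont_on a b g ->
  sint a b (fun x => f x + g x) = sint a b f + sint a b g.
Proof. by move=> cf cg; rewrite /sint RintegralD//; exact: cont_on_int. Qed.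

Lemma sint_EFin (a b : R) f : cont_on a b f ->
  (sint a b f)%:E = (\int[mu]_(x in `[a, b]) (f x)%:E)%E.
Proof.
move=> /cont_on_int If; rewrite /sint /Rintegral fineK//.
exact: integrable_fin_num If.
Qed.

Lemma sint_le_integral (a b : R) f (V : measurableTypeR R -> \bar R) :
  measurable_fun setT V -> (forall x, 0 <= V x)%E -> cont_on a b f ->
  (forall x, a <= x <= b -> V x = (f x)%:E) -> ((sint a b f)%:E <= \int[mu]_x V x)%E.
Proof.
move=> mV V0 cf Vf; rewrite sint_EFin//.
rewrite (eq_integral V) => [|x]; last by rewrite inE /= in_itv /= => /Vf.
exact: ge0_subset_integral.
Qed.

(* [cauchy_side_bound] averaged over the squares of half side [s] in
   [[1/4, 3/8]]. *)
Lemma area_mean_bound F :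
  (forall p : plane R, half_box p -> exists d, cdiff F (toC p) d) ->
  ((cmod (F 0))%:E <= 32%:E * \int[mu \x mu]_(p in half_box) (cmod (F (toC p)))%:E)%E.
Proof.
move=> HF; set A := cmod (F 0).
have mQ := measurable_half_box.
pose U := (fun p : plane R => (cmod (F (toC p)))%:E) \_ half_box.
have mU : measurable_fun setT U.
  apply: (measurable_restrictT _ mQ).1; apply/measurable_EFinP.
  apply: (@cmeas_cmod _ half_box F); apply: cmeas_cdiff => //; exact: half_box_open.
have U0 p : (0 <= U p)%E.
  by rewrite erestrict_ge0// => q _; rewrite lee_fin cmod_ge0.
have -> : (\int[mu \x mu]_(p in half_box) (cmod (F (toC p)))%:E = \int[mu \x mu]_p U p)%E.
  by rewrite integral_mkcond.
pose G (y : measurableTypeR R) := (\int[mu]_x U (x, y))%E.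
pose H (x : measurableTypeR R) := (\int[mu]_y U (x, y))%E.
have mG : measurable_fun setT G by exact: (@measurable_fun_fubini_tonelli_G _ _ _ _ R mu U mU U0).
have mH : measurable_fun setT H by exact: (@measurable_fun_fubini_tonelli_F _ _ _ _ R mu U mU U0).
have G0 y : (0 <= G y)%E by apply: integral_ge0.
have H0 y : (0 <= H y)%E by apply: integral_ge0.
have cF1 s b : 0 < s -> s < 2^-1 -> `|b| = s ->
    cont_on (- s) s (fun x => cmod (F (x +i* b)%C)).
  move=> s0 s1 bs x xs; have [|d] := HF (x, b).
    split; rewrite /= ?bs//; apply: le_lt_trans s1; by rewrite ler_norml.
  exact: cdiff_cont_cmod1.
have cF2 s b : 0 < s -> s < 2^-1 -> `|b| = s ->
    cont_on (- s) s (fun x => cmod (F (b +i* x)%C)).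
  move=> s0 s1 bs x xs; have [|d] := HF (b, x).
    split; rewrite /= ?bs//; apply: le_lt_trans s1; by rewrite ler_norml.
  exact: cdiff_cont_cmod2.
have side1 s b : 0 < s -> s < 2^-1 -> `|b| = s ->
    ((sint (- s) s (fun x => cmod (F (x +i* b)%C)))%:E <= G b)%E.
  move=> s0 s1 bs; apply: (@sint_le_integral _ _ _ (fun x => U (x, b))) => //.
  - by apply: (measurableT_comp mU); exact: measurable_fun_pair.
  - exact: cF1.
  - move=> x xs; rewrite /U /patch mem_set//; split; rewrite /= ?bs//.
    by apply: le_lt_trans s1; rewrite ler_norml.
have side2 s b : 0 < s -> s < 2^-1 -> `|b| = s ->
    ((sint (- s) s (fun x => cmod (F (b +i* x)%C)))%:E <= H b)%E.
  move=> s0 s1 bs; apply: (@sint_le_integral _ _ _ (fun x => U (b, x))) => //.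
  - by apply: (measurableT_comp mU); exact: measurable_fun_pair.
  - exact: cF2.
  - move=> x xs; rewrite /U /patch mem_set//; split; rewrite /= ?bs//.
    by apply: le_lt_trans s1; rewrite ler_norml.
(* The sides are enlarged to full slices of the box, and 4 s >= 1 removes the factor in
   [cauchy_side_bound]. *)
have key s : 4^-1 <= s <= 3 / 8 -> (A%:E <= (G (- s)%R + G s) + (H s + H (- s)%R))%E.
  move=> /andP[s1 s2]; have s0 : 0 < s by lra.
  have s3 : s < 2^-1 by lra.
  have sN : `|- s| = s by rewrite normrN gtr0_norm.
  have sP : `|s| = s by rewrite gtr0_norm.
  have HFs : hol_square F s.
    by move=> x y xs ys; apply: (HF (x, y)); split; apply: le_lt_trans s3.
  have := cauchy_side_bound s0 HFs.
  rewrite !sintD; try by [exact: cF1|exact: cF2].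
  move=> B; apply: (@le_trans _ _ (4 * s * A)%:E).
    by rewrite lee_fin ler_peMl ?cmod_ge0//; lra.
  apply: (le_trans (y := (_ + _ + (_ + _))%:E)); first by rewrite lee_fin; exact: B.
  by rewrite !EFinD; apply: leeD; apply: leeD; [exact: side1|exact: side1|exact: side2|exact: side2].
have mN : measurable_fun setT (fun x : measurableTypeR R => - x : measurableTypeR R) by exact: oppr_measurable.
have mGN : measurable_fun setT (fun s : measurableTypeR R => G (- s)) by exact: (measurableT_comp mG mN).
have mHN : measurable_fun setT (fun s : measurableTypeR R => H (- s)) by exact: (measurableT_comp mH mN).
have IG : (\int[mu]_s G s = \int[mu \x mu]_p U p)%E by exact/esym/(fubini_tonelli2 U mU U0).
have IH : (\int[mu]_s H s = \int[mu \x mu]_p U p)%E by exact/esym/(fubini_tonelli1 U mU U0).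
have refl (V : measurableTypeR R -> \bar R) : measurable_fun setT V -> (forall x, 0 <= V x)%E ->
   (\int[mu]_s V (- s)%R = \int[mu]_s V s)%E.
  move=> mV V0; have := @integral_aff R (-1) 0 V.
  rewrite normrN1 invr1 mul1e oppr_eq0 oner_eq0 => /(_ isT mV V0) <-.
  by apply: eq_integral => x _; rewrite mulN1r addr0.
have I4 : (4%:E * \int[mu \x mu]_p U p =
    \int[mu]_s ((G (- s)%R + G s) + (H s + H (- s)%R)))%E.
  rewrite ge0_integralD//; last 4 first.
  - by move=> x _; rewrite adde_ge0.
  - exact: emeasurable_funD.
  - by move=> x _; rewrite adde_ge0.
  - exact: emeasurable_funD.
  have -> : (\int[mu]_s (G (- s)%R + G s) = \int[mu]_s G (- s)%R + \int[mu]_s G s)%E.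
    exact: ge0_integralD.
  have -> : (\int[mu]_s (H s + H (- s)%R) = \int[mu]_s H s + \int[mu]_s H (- s)%R)%E.
    exact: ge0_integralD.
  rewrite (refl G mG G0) (refl H mH H0) IG IH.
  have -> : (4%:E = 1 + 1 + (1 + 1) :> \bar R)%E by rewrite -!EFinD; congr EFin; ring.
  by rewrite !ge0_muleDl ?adde_ge0// !mul1e.
(* The interval [1/4, 3/8] has length 1/8, and each of the four slice terms integrates to the area
   integral: 32 = 8 * 4. *)
have I8 : (A%:E * (1 / 8)%:E <= 4%:E * \int[mu \x mu]_p U p)%E.
  rewrite I4; apply: (@le_trans _ _ (\int[mu]_(s in `[4^-1%R, (3 / 8)%R]) ((G (- s)%R + G s) + (H s + H (- s)%R)))%E).
    apply: (@le_trans _ _ (\int[mu]_(s in `[4^-1%R, (3 / 8)%R]) cst A%:E s)%E).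
      rewrite integral_cst//= lebesgue_measure_itv /= lte_fin.
      have -> : 4^-1 < 3 / 8 :> R by lra.
      by rewrite -EFinD -!EFinM lee_fin; rewrite ler_wpM2l ?cmod_ge0//; lra.
    apply: ge0_le_integral => //.
    - by move=> x _; rewrite lee_fin cmod_ge0.
    - by apply: measurable_funTS; apply: emeasurable_funD; apply: emeasurable_funD.
  apply: ge0_subset_integral => //.
  - by apply: emeasurable_funD; apply: emeasurable_funD.
  - by move=> x _; apply: adde_ge0; apply: adde_ge0.
have -> : (A%:E = 8%:E * (A%:E * (1 / 8)%:E))%E by rewrite -!EFinM; congr EFin; field.
have -> : (32%:E = 8%:E * 4%:E :> \bar R)%E by rewrite -EFinM; congr EFin; ring.
by rewrite -muleA lee_wpmul2l.
Qed.

End AreaMean.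

Section DerivativeAreaBound.
Context {R : realType}.
Local Notation mu := (@lebesgue_measure R).
Implicit Types (f : R[i] -> R[i]).

Lemma half_box_disc (p : plane R) : half_box p -> disc (toC p).
Proof. by case: p => x y [/= x1 y1]; apply: box_disc; lra. Qed.

(** At most 1/10, so that shifts of the box of half side 1/2 stay in the box of half side 6/10,
    where f' is bounded. *)
Definition step (n : nat) : R := (10 * n.+1%:R)^-1.

Lemma step_gt0 n : 0 < step n.
Proof. by rewrite invr_gt0 mulr_gt0. Qed.

Lemma step_le n : step n <= 1 / 10.
Proof.
rewrite /step invfM mul1r ler_piMr// invf_le1//.
by rewrite ler1n.
Qed.

Lemma step_cvg (r : R) : 0 < r -> \forall n \near \oo, step n < r.
Proof.
move=> r0; have /cvgrPdist_lt/(_ r r0) := @cvg_harmonic R.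
apply: filterS => n; rewrite /= sub0r normrN ger0_norm// => H.
apply: le_lt_trans H; rewrite /step invfM ler_piMl// invf_le1//; lra.
Qed.

Definition quot f n (z : R[i]) : R[i] := (f (z + (step n)%:C%C) - f z) / (step n)%:C%C.

Lemma cmod_step n : cmod (step n)%:C%C = step n.
Proof. by rewrite cmod_real gtr0_norm// step_gt0. Qed.

Lemma step_neq0 n : (step n)%:C%C != 0 :> R[i].
Proof. by rewrite -cmod_gt0 cmod_step step_gt0. Qed.

Lemma quot_cvg f z d (e : R) : cdiff f z d -> 0 < e ->
  \forall n \near \oo, cmod (quot f n z - d) <= e.
Proof.
move=> dz e0; have [r r0 Hr] := dz _ e0; near=> n.
have E : z + (step n)%:C%C - z = (step n)%:C%C by rewrite addrC addKr.
have := Hr (z + (step n)%:C%C); rewrite E cmod_step.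
have sr : step n < r by near: n; exact: step_cvg.
move=> /(_ sr) H.
have s0 := step_neq0 n.
have -> : quot f n z - d = (f (z + (step n)%:C%C) - f z - d * (step n)%:C%C) / (step n)%:C%C.
  by rewrite /quot; field.
by rewrite cmodM cmodV cmod_step ler_pdivrMr// step_gt0.
Unshelve. all: by end_near. Qed.

Lemma quot_shift_box (p : plane R) (t : R) : half_box p -> 0 <= t <= 1 / 10 ->
  `|p.1 + t| <= 6 / 10 /\ `|p.2| <= 6 / 10.
Proof.
case=> p1 p2 /andP[t0 t1]; split; last by lra.
apply: le_trans (ler_normD _ _) _; rewrite (ger0_norm t0); lra.
Qed.

Lemma toC_shift (p : plane R) (t : R) : toC p + t%:C%C = ((p.1 + t) +i* p.2)%C.
Proof. by apply/eqP; rewrite eq_complex /= addr0 !eqxx. Qed.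

Lemma quot_bound f M n p : Hol f ->
  (forall x y, `|x| <= 6 / 10 -> `|y| <= 6 / 10 -> cmod (cderiv f (x +i* y)%C) <= M) ->
  half_box p -> cmod (quot f n (toC p)) <= 2 * M.
Proof.
move=> Hf HM pQ; have s0 := step_gt0 n.
rewrite /quot cmodM cmodV cmod_step ler_pdivrMr// -mulrA -[X in M * X]cmod_step.
apply: path_lip => t /andP[t0 t1].
have ts : 0 <= t * step n <= 1 / 10.
  rewrite mulr_ge0 ?(ltW s0)//=; apply: le_trans (step_le n).
  by rewrite ler_piMl// ltW.
have [x6 y6] := quot_shift_box pQ ts.
rewrite -rmorphM /= toC_shift.
exists (cderiv f ((p.1 + t * step n) +i* p.2)%C); last exact: HM.
apply: Hol_cdiff => //; apply: box_disc; lra.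
Qed.

Lemma quot_cdiff f n p : Hol f -> half_box p ->
  exists d, cdiff (quot f n) (toC p) d.
Proof.
move=> Hf pQ; eexists; apply: cdiffM; last exact: cdiff_cst.
apply: cdiffB; last exact: Hol_cdiff (half_box_disc pQ).
apply: cdiff_comp.
  by apply: cdiffD; [exact: cdiff_id|exact: cdiff_cst].
apply: Hol_cdiff => //; rewrite toC_shift.
have ts : 0 <= step n <= 1 / 10 by rewrite ltW ?step_gt0//= step_le.
have [x6 y6] := quot_shift_box pQ ts; apply: box_disc; lra.
Qed.

Lemma unit_square_finite (A : set (plane R)) : measurable A ->
  (forall p, A p -> `|p.1| <= 1 /\ `|p.2| <= 1) -> ((mu \x mu)%E A < +oo)%E.
Proof.
move=> mA HA; pose S := (`[(-1)%R, 1%R]%classic `*` `[(-1)%R, 1%R]%classic : set (plane R)).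
have mS : measurable S by apply: measurableX; exact: measurable_itv.
apply: (@le_lt_trans _ _ ((mu \x mu)%E S)).
  apply: le_measure; rewrite ?inE// => p /HA[p1 p2]; split; rewrite /= in_itv /=.
    by move: p1; rewrite ler_norml.
  by move: p2; rewrite ler_norml.
rewrite product_measure1E//= !lebesgue_measure_itv /= !lte_fin.
by case: ifP => _; rewrite -?EFinD -?EFinM ?mule0 ?ltry.
Qed.

(** [area_mean_bound] asks for a differentiable function with modulus |f'|^2, and f' is not known to
    be differentiable. It is applied to the square of the difference quotient, bounded by (2 M)^2 on
    the box, and the limit is taken by dominated convergence. *)
Lemma deriv_area_bound f : Hol f ->
  ((cmod (cderiv f 0) ^+ 2)%:E <=
   32%:E * \int[mu \x mu]_(p in half_box) (cmod (cderiv f (toC p)) ^+ 2)%:E)%E.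
Proof.
move=> Hf; have [M HM] := Hol_box_deriv_bounded Hf.
have mQ := @measurable_half_box R.
have M0 : 0 <= M by apply: le_trans (HM 0 0 _ _); rewrite ?cmod_ge0 ?normr0.
pose u n (p : plane R) := (cmod (quot f n (toC p)) ^+ 2)%:E.
have ineq n : ((cmod (quot f n 0) ^+ 2)%:E <= 32%:E * \int[mu \x mu]_(p in half_box) u n p)%E.
  have := @area_mean_bound R (fun z => quot f n z * quot f n z).
  rewrite cmodM -expr2 => H.
  apply: le_trans (H _) _.
    by move=> p /(quot_cdiff n Hf)[d dz]; eexists; apply: cdiffM; exact: dz.
  apply: le_of_eq; congr (_ * _)%E.
  by apply: eq_integral => p _; rewrite /u cmodM -expr2.
have sq_cvg z d : cdiff f z d ->
    (cmod (quot f n z) ^+ 2)%:E @[n --> \oo] --> (cmod d ^+ 2)%:E.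
  move=> dz; apply: cvg_EFin; first by near=> n.
  apply: (@cvgM _ _ _ _ (fun n => cmod (quot f n z)) (fun n => cmod (quot f n z)));
    apply/cvgrPdist_le => e e0; have := quot_cvg dz e0; apply: filterS => n;
    by apply: le_trans; rewrite distrC; exact: cmod_lip.
have cstE : (cst ((2 * M) ^+ 2)%:E : plane R -> \bar R) = EFin \o cst ((2 * M) ^+ 2) by [].
have ID : (mu \x mu)%E.-integrable half_box (cst ((2 * M) ^+ 2)%:E).
  rewrite cstE; apply: measurable_bounded_integrable => //.
    apply: unit_square_finite => // p [p1 p2]; split; lra.
  exact: bounded_cst.
have mu' n : measurable_fun half_box (u n).
  apply/measurable_EFinP; apply: cmeas_cmod2; apply: cmeas_cdiff; first exact: half_box_open.
  by move=> p /(quot_cdiff n Hf).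
have mlim : measurable_fun half_box (fun p : plane R => (cmod (cderiv f (toC p)) ^+ 2)%:E).
  apply/measurable_EFinP; apply: measurable_funS (cmeas_cmod2 (cmeas_cderiv Hf)) => //.
    exact: measurable_disc2.
  exact: half_box_disc.
have [] := @dominated_convergence _ _ _ (mu \x mu)%E half_box mQ u
  (fun p => (cmod (cderiv f (toC p)) ^+ 2)%:E) (cst ((2 * M) ^+ 2)%:E) mu' mlim.
- by apply: aeW => p pQ; apply: sq_cvg; apply: Hol_cdiff => //; exact: half_box_disc.
- exact: ID.
- apply: aeW => p n pQ; rewrite /u /= lee_fin ger0_norm ?sqr_ge0//.
  by rewrite ler_pXn2r// ?nnegrE ?cmod_ge0 ?mulr_ge0//; exact: quot_bound.
move=> _ _ cv.
have cv1 := sq_cvg _ _ (Hol_cdiff Hf disc0).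
have cv2 : (32%:E * \int[mu \x mu]_(p in half_box) u n p)%E @[n --> \oo] -->
   (32%:E * \int[mu \x mu]_(p in half_box) (cmod (cderiv f (toC p)) ^+ 2)%:E)%E.
  by apply: cvgeZl.
have c1 : cvgn (fun n => (cmod (quot f n 0) ^+ 2)%:E).
  by apply/cvg_ex; eexists; exact: cv1.
have c2 : cvgn (fun n => (32%:E * \int[mu \x mu]_(p in half_box) u n p)%E).
  by apply/cvg_ex; eexists; exact: cv2.
have := @lee_lim _ _ _ _ _ _ c1 c2 (nearW _ ineq).
rewrite (cvg_lim (@ereal_hausdorff R) cv1) (cvg_lim (@ereal_hausdorff R) cv2).
by apply.
Unshelve. all: by end_near. Qed.

Lemma measurable_density p f : Hol f ->
  measurable_fun disc2 (dirichlet_density p f).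
Proof.
move=> Hf; apply: measurable_funM; first exact: (cmeas_cmod2 (cmeas_cderiv Hf)).
apply: (measurableT_comp (@measurable_powR R p)).
by apply: measurable_funTS; apply: measurable_funB => //; exact: mtoC_sqr.
Qed.

Lemma density_ge0 p f w : 0 <= dirichlet_density p f w.
Proof. by rewrite mulr_ge0 ?sqr_ge0 ?powR_ge0. Qed.

(** 64 = 32 * 2, since the weight is at least 1/2 on the box: there 1 - |w|^2 >= 1/2, and p <= 1
    makes the power no smaller than its base. The factor pi undoes the normalization of [area]. *)
Lemma deriv0_le_dirichlet p f : 0 <= p <= 1 -> Hol f ->
  ((cmod (cderiv f 0) ^+ 2)%:E <=
   (64 * pi)%:E * \int[area]_(w in disc2) (dirichlet_density p f w)%:E)%E.
Proof.
move=> /andP[p0 p1] Hf; apply: le_trans (deriv_area_bound Hf) _.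
have mQ := @measurable_half_box R.
have mD := @measurable_disc2 R.
have md := measurable_density p Hf.
have QD : half_box `<=` @disc2 R by exact: half_box_disc.
rewrite integral_area//; last 2 first.
- exact/measurable_EFinP.
- by move=> w _; rewrite lee_fin density_ge0.
rewrite muleA -EFinM mulfK ?gt_eqF ?pi_gt0//.
have -> : (64%:E = 32%:E * 2%:E :> \bar R)%E by rewrite -EFinM; congr EFin; ring.
rewrite -muleA lee_wpmul2l//.
apply: (@le_trans _ _ (2%:E * \int[mu \x mu]_(w in half_box) (dirichlet_density p f w)%:E)%E).
  rewrite -ge0_integralZl//; last 2 first.
  - by apply/measurable_EFinP; apply: measurable_funS md.
  - by move=> w _; rewrite lee_fin density_ge0.
  apply: ge0_le_integral => //.
  - by move=> w _; rewrite lee_fin sqr_ge0.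
  - apply/measurable_EFinP; apply: measurable_funS (cmeas_cmod2 (cmeas_cderiv Hf)) => //.
  - by apply/measurable_EFinP; apply: measurable_funM => //; apply: measurable_funS md.
  move=> w [w1 w2]; rewrite -EFinM lee_fin /dirichlet_density mulrCA ler_peMr ?sqr_ge0//.
  have w3 : 2^-1 <= 1 - cmod (toC w) ^+ 2.
    rewrite sqr_cmod_toC -[w.1 ^+ 2]real_normK ?num_real// -[w.2 ^+ 2]real_normK ?num_real//.
    have := normr_ge0 w.1; have := normr_ge0 w.2; nra.
  have w4 : 1 - cmod (toC w) ^+ 2 <= 1 by rewrite gerBl sqr_ge0.
  rewrite -ler_pdivrMl// mulr1; apply: (le_trans w3).
  by apply: ger1_powR => //; rewrite w4 andbT (lt_le_trans _ w3).
rewrite lee_wpmul2l//; apply: ge0_subset_integral => //.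
- exact/measurable_EFinP.
- by move=> w _; rewrite lee_fin density_ge0.
Qed.

End DerivativeAreaBound.

(** * Dirichlet energies and the Morrey norm *)

Section DirichletMorreyBounds.
Context {R : realType}.
Implicit Types (f g : R[i] -> R[i]) (a z : R[i]) (p q N : R).

Lemma Hol_mul f g : Hol f -> Hol g -> Hol (fun z => f z * g z).
Proof.
move=> Hf Hg; apply: HolP => z zD; eexists.
by apply: cdiffM; exact: Hol_cdiff.
Qed.

Lemma cderiv_mul f g z : Hol f -> Hol g -> disc z ->
  cderiv (fun z => f z * g z) z = cderiv f z * g z + f z * cderiv g z.
Proof. by move=> Hf Hg zD; apply: cdiff_cderiv; apply: cdiffM; exact: Hol_cdiff. Qed.

Lemma cdiff_shift f a z : Hol f -> disc a -> disc z ->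
  cdiff (moebius_shift f a) z
    (cderiv f (phi a z) * (- (1 - cmod a ^+ 2)%:C%C / (1 - conjc a * z) ^+ 2)).
Proof.
move=> Hf aD zD; rewrite -[X in cdiff _ _ X]subr0; apply: cdiffB; last exact: cdiff_cst.
apply: cdiff_comp; first exact: cdiff_phi.
by apply: Hol_cdiff => //; exact: phi_disc.
Qed.

Lemma Hol_shift f a : Hol f -> disc a -> Hol (moebius_shift f a).
Proof. by move=> Hf aD; apply: HolP => z zD; eexists; exact: cdiff_shift. Qed.

Definition wdens p f a (w : plane R) : R :=
  cmod (cderiv f (toC w)) ^+ 2 * (1 - cmod (phi a (toC w)) ^+ 2) `^ p.

Definition energy p f a : \bar R := (\int[area]_(w in disc2) (wdens p f a w)%:E)%E.

Lemma wdens_ge0 p f a w : 0 <= wdens p f a w.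
Proof. by rewrite mulr_ge0 ?sqr_ge0 ?powR_ge0. Qed.

Lemma measurable_weight p a : disc a ->
  measurable_fun disc2 (fun w : plane R => (1 - cmod (phi a (toC w)) ^+ 2) `^ p).
Proof.
move=> aD; apply: (measurableT_comp (@measurable_powR R p)).
apply: measurable_funB => //; apply: cmeas_cmod2; apply: cmeas_Hol.
by apply: HolP => z zD; eexists; exact: cdiff_phi.
Qed.

Lemma measurable_wdens p f a : Hol f -> disc a ->
  measurable_fun disc2 (wdens p f a).
Proof.
move=> Hf aD; apply: measurable_funM; first exact: (cmeas_cmod2 (cmeas_cderiv Hf)).
exact: measurable_weight.
Qed.

Lemma density_shift p f a (w : plane R) : Hol f -> disc a -> disc2 w ->
  dirichlet_density p (moebius_shift f a) w =
  wdens p f a (ofC (phi a (toC w))) *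
    ((1 - cmod a ^+ 2) ^+ 2 / cmod (1 - conjc a * toC w) ^+ 4).
Proof.
move=> Hf aD wD; rewrite /dirichlet_density /wdens ofCK phiK//.
rewrite (cdiff_cderiv (cdiff_shift Hf aD wD)) !cmodM cmodN cmodV cmodX cmod_real.
rewrite gtr0_norm ?one_sub_sqr_gt0//.
have : cmod (1 - conjc a * toC w) != 0 by rewrite gt_eqF// cmod_denom_gt0.
by move: (cmod (1 - _)) (cmod (cderiv f _)) (_ `^ p) => D A P D0; field.
Qed.

Lemma energyE p f a : Hol f -> disc a ->
  energy p f a = (\int[area]_(w in disc2) (dirichlet_density p (moebius_shift f a) w)%:E)%E.
Proof.
move=> Hf aD; rewrite /energy -(@area_phi R a (fun w => (wdens p f a w)%:E))//.
- apply: eq_integral => w; rewrite inE => wD.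
  by rewrite -EFinM -density_shift.
- by apply/measurable_EFinP; exact: measurable_wdens.
- by move=> w _; rewrite lee_fin wdens_ge0.
Qed.

Lemma energy_ge0 p f a : (0 <= energy p f a)%E.
Proof. by apply: integral_ge0 => w _; rewrite lee_fin wdens_ge0. Qed.

Lemma normD2_shift p f a : Hol f -> disc a -> normD2 p (moebius_shift f a) = energy p f a.
Proof.
move=> Hf aD; rewrite /normD2 energyE// /moebius_shift phi0 subrr cmod0 expr0n /=.
by rewrite add0e.
Qed.

Lemma poweR_half_le (x : \bar R) (c n : R) : (0 <= x)%E -> 0 < c -> 0 <= n ->
  (c%:E * poweR x 2^-1 <= n%:E)%E <-> (x <= (n ^+ 2 / c ^+ 2)%:E)%E.
Proof.
move=> x0 c0 n0; case: x x0 => [x|_|//]; last first.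
  by rewrite poweRyr ?invr_eq0// gt0_muley ?lte_fin// !leye_eq.
rewrite lee_fin => x0.
rewrite poweR_EFin -EFinM !lee_fin powR12_sqrt//.
rewrite -exprVn -exprMn.
split=> H.
  rewrite -(sqr_sqrtr x0) ler_pXn2r// ?nnegrE ?sqrtr_ge0 ?mulr_ge0 ?invr_ge0 ?(ltW c0)//.
  by rewrite ler_pdivlMr// mulrC.
rewrite mulrC -ler_pdivlMr// -(@ler_pXn2r _ 2)// ?nnegrE ?sqrtr_ge0 ?mulr_ge0 ?invr_ge0 ?(ltW c0)//.
by rewrite sqr_sqrtr.
Qed.

(* With [q = p * (1 - lambda)] this is [normDM p lambda f <= N], up to a factor
   [2]; [lambda = 1] gives [normQ]. *)
Definition DMbound p q f N := [/\ 0 <= N, cmod (f 0) <= N &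
  forall a, disc a -> (energy p f a <= (N ^+ 2 * (1 - cmod a ^+ 2) `^ (- q))%:E)%E].

Lemma weight_sqr p lambda a : disc a -> let c := (1 - cmod a ^+ 2) `^ (p / 2 * (1 - lambda)) in
  0 < c /\ (c ^+ 2)^-1 = (1 - cmod a ^+ 2) `^ (- (p * (1 - lambda))).
Proof.
move=> aD c; have a0 := one_sub_sqr_gt0 aD; split; first exact: powR_gt0.
rewrite powRN /c; congr (_^-1); rewrite -powR_mulrn ?powR_ge0// -powRrM.
by congr (_ `^ _); field.
Qed.

Lemma normDM_le_bound p lambda f N : Hol f -> (normDM p lambda f <= N%:E)%E ->
  DMbound p (p * (1 - lambda)) f N.
Proof.
move=> Hf; rewrite /normDM; set s := ereal_sup _ => H.
have hs a : disc a -> (((1 - cmod a ^+ 2) `^ (p / 2 * (1 - lambda)))%:E *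
     poweR (energy p f a) 2^-1 <= s)%E.
  move=> aD; apply: ereal_sup_ubound; exists a => //.
  by rewrite /normD normD2_shift.
have s0 : (0 <= s)%E.
  apply: le_trans (hs 0 disc0); apply: mule_ge0; first by rewrite lee_fin powR_ge0.
  exact: poweR_ge0.
have f0N : cmod (f 0) <= N.
  by rewrite -lee_fin; apply: le_trans H; rewrite leeDl.
have N0 : 0 <= N by exact: le_trans (cmod_ge0 _) f0N.
have sN : (s <= N%:E)%E by apply: le_trans H; rewrite leeDr// lee_fin cmod_ge0.
split=> // a aD; have [c0 cE] := weight_sqr p lambda aD.
rewrite -cE; apply/poweR_half_le => //; first exact: energy_ge0.
exact: le_trans (hs a aD) sN.
Qed.

Lemma bound_normDM_le p lambda f N : Hol f -> DMbound p (p * (1 - lambda)) f N ->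
  (normDM p lambda f <= (2 * N)%:E)%E.
Proof.
move=> Hf [N0 f0N HE]; rewrite /normDM mulr2n mulrDl !mul1r EFinD; apply: leeD.
  by rewrite lee_fin.
apply: ge_ereal_sup => _ [a aD <-]; rewrite /normD normD2_shift//.
have [c0 cE] := weight_sqr p lambda aD.
apply/poweR_half_le => //; first exact: energy_ge0.
by rewrite cE; exact: HE.
Qed.

(** At lambda = 1 the Morrey weight is the constant 1, so the statements on [normDM] also serve the
    Q spaces. *)
Lemma normQE p f : normQ p f = normDM p 1 f.
Proof.
rewrite /normQ /normDM; congr (_ + ereal_sup _)%E; apply/seteqP; split=> _ [a aD <-];
  by exists a; rewrite // subrr mulr0 powRr0 mul1e.
Qed.

Lemma normDM_ge0 p lambda f : Hol f -> (0 <= normDM p lambda f)%E.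
Proof.
move=> Hf; apply: adde_ge0; first by rewrite lee_fin cmod_ge0.
set S := (X in ereal_sup X).
have S0 : S (((1 - cmod (0 : R[i]) ^+ 2) `^ (p / 2 * (1 - lambda)))%:E *
     normD p (moebius_shift f 0%R))%E by exists 0 => //; exact: disc0.
apply: le_trans (ereal_sup_ubound S0).
by apply: mule_ge0; [rewrite lee_fin powR_ge0|exact: poweR_ge0].
Qed.

Lemma normDM_fin p lambda f : Hol f -> (normDM p lambda f < +oo)%E ->
  exists2 N, 0 <= N & normDM p lambda f = N%:E.
Proof.
move=> /(normDM_ge0 p lambda); case: normDM => [N| |] //.
by rewrite lee_fin => N0 _; exists N.
Qed.

Lemma powRDp (x s t : R) : 0 < x -> x `^ (s + t) = x `^ s * x `^ t.
Proof. by move=> x0; rewrite powRD// (gt_eqF x0) implybT. Qed.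

Lemma powR_pred_mul (x s : R) : 0 < x -> x `^ (s - 1) * x = x `^ s.
Proof.
by move=> x0; have := powRDp (s - 1) 1 x0; rewrite subrK powRr1 ?ltW.
Qed.

(** The derivative of f o phi_a at 0 has modulus |f'(a)| (1 - |a|^2); the constant is the square
    root of the one in [deriv0_le_dirichlet]. *)
Lemma deriv_bound p q f N a : 0 <= p <= 1 -> Hol f -> DMbound p q f N -> disc a ->
  cmod (cderiv f a) <=
    Num.sqrt (64 * pi) * N * (1 - cmod a ^+ 2) `^ (- (q / 2) - 1).
Proof.
move=> p01 Hf [N0 _ HE] aD; have a0 := one_sub_sqr_gt0 aD.
have := deriv0_le_dirichlet p01 (Hol_shift Hf aD).
rewrite -energyE// (cdiff_cderiv (cdiff_shift Hf aD disc0)).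
rewrite phi0 mulr0 subr0 expr1n invr1 mulr1 cmodM cmodN cmod_real gtr0_norm// => H.
have pi0 : 0 <= 64 * pi :> R by rewrite mulr_ge0// pi_ge0.
have {}H : (cmod (cderiv f a) * (1 - cmod a ^+ 2)) ^+ 2 <=
    64 * pi * (N ^+ 2 * (1 - cmod a ^+ 2) `^ (- q)).
  rewrite -lee_fin; apply: le_trans H _; rewrite [X in (_ <= X)%E]EFinM.
  by apply: lee_wpmul2l; rewrite ?lee_fin//; exact: HE.
rewrite -(ler_pM2r a0).
have -> : Num.sqrt (64 * pi) * N * (1 - cmod a ^+ 2) `^ (- (q / 2) - 1) * (1 - cmod a ^+ 2) =
   Num.sqrt (64 * pi) * N * (1 - cmod a ^+ 2) `^ (- (q / 2)).
  by rewrite -!mulrA powR_pred_mul.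
rewrite -(@ler_pXn2r _ 2)// ?nnegrE; last 2 first.
- by rewrite mulr_ge0 ?cmod_ge0// ltW.
- by rewrite !mulr_ge0 ?sqrtr_ge0 ?powR_ge0.
apply: le_trans H _; rewrite !exprMn sqr_sqrtr//.
have -> : (1 - cmod a ^+ 2) `^ (- (q / 2)) ^+ 2 = (1 - cmod a ^+ 2) `^ (- q).
  by rewrite -powR_mulrn ?powR_ge0// -powRrM; congr (_ `^ _); field.
by rewrite !mulrA.
Qed.

End DirichletMorreyBounds.

Section Growth.
Context {R : realType}.
Implicit Types (f g : R[i] -> R[i]) (a z : R[i]) (p q N : R).

Lemma powRN_le (x y t : R) : 0 <= t -> 0 < x -> x <= y -> y `^ (- t) <= x `^ (- t).
Proof.
move=> t0 x0 xy; have y0 : 0 < y by exact: lt_le_trans x0 xy.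
rewrite !powRN lef_pV2 ?posrE ?powR_gt0//.
by apply: ge0_ler_powR => //; rewrite nnegrE ltW.
Qed.

Lemma powRN_ge1 (x t : R) : 0 <= t -> 0 < x <= 1 -> 1 <= x `^ (- t).
Proof.
move=> t0 /andP[x0 x1]; have {1}<- : 1 `^ (- t) = 1 :> R by rewrite powR1.
exact: powRN_le.
Qed.

Lemma is_derive_powR_aff (r s t : R) : 0 < 1 - t * r ->
  is_derive t 1 (fun u : R => (1 - u * r) `^ (- s)) (s * r * (1 - t * r) `^ (- s - 1)).
Proof.
move=> H.
have d1 : is_derive t 1 (fun u : R => 1 - u * r) (- r).
  have := @is_deriveB R R R (cst 1) (fun u : R => r * u) t 1 0 r (is_derive_cst _ _ _).
  have -> : (cst 1 - (fun u : R => r * u)) = (fun u : R => 1 - u * r).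
    by apply/funext => u /=; rewrite fctE mulrC.
  rewrite sub0r; apply.
  by have := @is_deriveZ R R R id r t 1 1 (is_derive_id _ _); rewrite [_ *: 1]mulr1.
have d2 : is_derive (1 - t * r) 1 (@powR R ^~ (- s)) (- s * (1 - t * r) `^ (- s - 1)).
  have H' : 1 - t * r \in `]0, +oo[ by rewrite in_itv /= H.
  apply: DeriveDef; first exact: derivable_powR.
  by rewrite -derive1E powR_derive1.
have := @is_derive1_comp R (@powR R ^~ (- s)) (fun u => 1 - u * r) t _ _ d2 d1.
rewrite /comp /=; suff -> : - s * (1 - t * r) `^ (- s - 1) * - r =
  s * r * (1 - t * r) `^ (- s - 1) by [].
by ring.
Qed.

Lemma growth p q : 0 <= p <= 1 -> 0 < q -> exists2 K : R, 0 <= K &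
  forall f N, Hol f -> DMbound p q f N -> forall w, disc w ->
  cmod (f w) ^+ 2 <= K * N ^+ 2 * (1 - cmod w ^+ 2) `^ (- q).
Proof.
move=> p01 q0; pose s := q / 2; have s0 : 0 < s by rewrite divr_gt0.
pose c0 : R := Num.sqrt (64 * pi).
have c00 : 0 <= c0 by exact: sqrtr_ge0.
pose C := 1 + 2 * (c0 / s) * 2 `^ s.
have C0 : 0 <= C by rewrite addr_ge0// !mulr_ge0// ?invr_ge0 ?powR_ge0// ltW.
exists (C ^+ 2); first exact: sqr_ge0.
move=> f N Hf HN w wD; have [N0 f0N _] := HN.
have w0 := one_sub_sqr_gt0 wD.
set r := cmod w in w0 *.
have r0 : 0 <= r by exact: cmod_ge0.
have r1 : r < 1 by [].
have g1 : forall t : R, 0 <= t <= 1 -> 0 < 1 - t * r.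
  move=> t /andP[t0 t1]; rewrite subr_gt0; apply: le_lt_trans r1.
  by rewrite ler_piMl.
(* An antiderivative of the bound for |f'| along the radius, after 1 - |t w|^2 >= 1 - t r. As s > 0
   it is a negative power of 1 - t r rather than a logarithm. *)
pose g (t : R) := c0 * N / s * (1 - t * r) `^ (- s).
have := @path_bound R f 0 w g (fun t => c0 * N / s * (s * r * (1 - t * r) `^ (- s - 1))).
rewrite add0r => /(_ _ _) H.
have {}H : cmod (f w - f 0) <= 2 * (g 1 - g 0).
  apply: H => t t01; have b0 := g1 t t01; last first.
    have := @is_deriveZ R R R (fun t => (1 - t * r) `^ (- s)) (c0 * N / s) t 1 _ (is_derive_powR_aff s b0).
    by [].
  have tw : cmod (t%:C%C * w) = t * r.
    by rewrite cmodM cmod_real ger0_norm//; case/andP: t01.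
  have twD : disc (t%:C%C * w) by rewrite /disc/mkset tw -subr_gt0.
  exists (cderiv f (t%:C%C * w)); first by rewrite add0r; exact: Hol_cdiff.
  have := deriv_bound p01 Hf HN twD; rewrite tw -/s => H1.
  rewrite cmodM -/r.
  have -> : c0 * N / s * (s * r * (1 - t * r) `^ (- s - 1)) =
     c0 * N * (1 - t * r) `^ (- s - 1) * r by field; rewrite gt_eqF.
  rewrite ler_wpM2r//; apply: le_trans H1 _.
  rewrite ler_wpM2l ?mulr_ge0//.
  have -> : - s - 1 = - (s + 1) by ring.
  apply: powRN_le => //; first by rewrite addr_ge0// ltW.
  rewrite lerD2l lerN2 expr2 ler_piMr//; last by rewrite -subr_ge0 ltW.
  by rewrite mulr_ge0//; case/andP: t01.
have X1 : 1 <= (1 - r ^+ 2) `^ (- s).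
  by apply: powRN_ge1; [exact: ltW|rewrite w0 gerBl sqr_ge0].
(* 1 - r >= (1 - r^2) / 2 leads back to the weight. *)
have X2 : (1 - r) `^ (- s) <= 2 `^ s * (1 - r ^+ 2) `^ (- s).
  have -> : 2 `^ s = (2^-1) `^ (- s) :> R by rewrite -powR_inv1// -powRrM mulN1r opprK.
  rewrite -powRM ?(ltW w0)//; apply: powRN_le; [exact: ltW|by rewrite mulr_gt0|].
  have : r ^+ 2 >= 0 by rewrite sqr_ge0.
  by rewrite expr2; nra.
have fw : cmod (f w) <= C * N * (1 - r ^+ 2) `^ (- s).
  have := cmodD (f w - f 0) (f 0); rewrite subrK => H2.
  apply: le_trans H2 _.
  apply: (@le_trans _ _ (2 * (c0 * N / s * (2 `^ s * (1 - r ^+ 2) `^ (- s))) + N * (1 - r ^+ 2) `^ (- s))).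
    apply: lerD; last by rewrite (le_trans f0N)// ler_peMr.
    apply: le_trans H _; rewrite ler_pM2l// /g mul0r subr0 powR1 mul1r.
    have cN : 0 <= c0 * N / s by rewrite !mulr_ge0 ?invr_ge0// ltW.
    rewrite -mulrBr ler_wpM2l//; apply: le_trans X2; rewrite lerBlDr lerDl//.
  apply: le_of_eq; rewrite /C; field; exact: lt0r_neq0.
have -> : C ^+ 2 * N ^+ 2 * (1 - r ^+ 2) `^ (- q) = (C * N * (1 - r ^+ 2) `^ (- s)) ^+ 2.
  rewrite !exprMn; congr (_ * _).
  by rewrite -(powR_mulrn 2 (powR_ge0 _ (- s))) -powRrM /s; congr (_ `^ _); field.
by rewrite ler_pXn2r// nnegrE ?cmod_ge0// !mulr_ge0// powR_ge0.
Qed.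

End Growth.

(** * Kernel estimates *)

Section Dyadic.
Context {R : realType}.
Implicit Types (a : R[i]) (s t e : R).

Let h (n : nat) : R := 2^-1 ^+ n.

Let h_gt0 n : 0 < h n. Proof. by rewrite exprn_gt0. Qed.

Let h_le1 n : h n <= 1.
Proof. by rewrite /h exprn_ile1// invf_le1// ler1n. Qed.

Let h_powRN n (k : R) : h n `^ (- k) = (2 `^ k) ^+ n.
Proof.
have -> : h n = 2 `^ (- n%:R) by rewrite powRN powR_mulrn// /h exprVn.
rewrite -powRrM -powR_mulrn ?powR_ge0// -powRrM.
by congr (_ `^ _); ring.
Qed.

Lemma conjc_realM (k : R) (z : R[i]) : conjc (k%:C%C * z) = k%:C%C * conjc z.
Proof. by case: z => x y; apply/eqP; rewrite eq_complex /=; apply/andP; split; apply/eqP; ring. Qed.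

(** [h n] is 2^-n; the points approach [a] along its radius and keep a distance of at least 2^-n
    from the unit circle. *)
Definition dpt a n : R[i] := (1 - h n)%:C%C * a.

Lemma cmod_dpt a n : cmod (dpt a n) = (1 - h n) * cmod a.
Proof. by rewrite cmodM cmod_real ger0_norm// subr_ge0. Qed.

Lemma dpt_disc a n : disc a -> disc (dpt a n).
Proof.
move=> aD; rewrite /disc/mkset cmod_dpt; apply: le_lt_trans aD.
by rewrite ler_piMl ?cmod_ge0// gerBl ltW.
Qed.

Lemma one_sub_dpt a n : disc a -> h n <= 1 - cmod (dpt a n) ^+ 2.
Proof.
move=> aD; rewrite cmod_dpt.
have [a0 a1] : 0 <= cmod a /\ cmod a <= 1 by split; [exact: cmod_ge0|exact: ltW].
have [h0 h1] := (h_gt0 n, h_le1 n).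
have X : (1 - h n) * cmod a <= 1 - h n by rewrite ler_piMr// subr_ge0.
have X0 : 0 <= (1 - h n) * cmod a by rewrite mulr_ge0// subr_ge0.
by rewrite expr2; nra.
Qed.

Lemma dyadic_depth (d : R) : 0 < d -> exists n, h n <= d /\ (d <= 1 -> d <= 2 * h n).
Proof.
move=> d0; have ex : exists n, h n <= d.
  have /cvgrPdist_lt/(_ d d0)[n _ /(_ n (leqnn n))] := @cvg_geometric R 1 2^-1 ltac:(rewrite ger0_norm// invf_lt1// ltr1n//).
  rewrite /= sub0r normrN mul1r ger0_norm ?exprn_ge0// => H; exists n; exact: ltW.
exists (ex_minn ex); case: ex_minnP => -[|n] Hn Hmin; split => // d1.
  by rewrite /h expr0 mulr1 (le_trans d1)// ler1n.
have : ~~ (h n <= d) by apply/negP => /Hmin; rewrite ltnn.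
rewrite -ltNge => /ltW H; apply: le_trans H _.
by rewrite /h exprS mulrA mulfV ?mul1r// pnatr_eq0.
Qed.

(** [j] is the first scale with 2^-j <= |1 - conj(a) w|. Replacing a by [dpt a j] changes the
    denominator by at most 2^-j, hence at most doubles it. The last clause bounds the scale
    independently of w, because |1 - conj(a) w| >= 1 - |a|. *)
Lemma dyadic_point a (w : R[i]) : disc a -> disc w -> exists j,
  [/\ h j <= cmod (1 - conjc a * w),
      cmod (1 - conjc (dpt a j) * w) <= 2 * cmod (1 - conjc a * w) &
      cmod (1 - conjc a * w) <= 4 * h j /\
      forall n, h n <= 1 - cmod a -> (j <= n)%N].
Proof.
move=> aD wD; set m := cmod (1 - conjc a * w).
have m0 : 0 < m by exact: cmod_denom_gt0.
have ex : exists n, h n <= m by have [n []] := dyadic_depth m0; exists n.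
exists (ex_minn ex); case: ex_minnP => j Hj Hmin; split=> //.
- have -> : 1 - conjc (dpt a j) * w = (1 - conjc a * w) + (h j)%:C%C * (conjc a * w).
    rewrite /dpt conjc_realM rmorphB /= rmorph1; ring.
  apply: le_trans (cmodD _ _) _; rewrite mulr2n mulrDl !mul1r lerD2l.
  apply: le_trans Hj; rewrite cmodM cmod_real gtr0_norm// ler_piMr//; first exact: ltW.
  by rewrite cmodM cmod_conj mulr_ile1 ?cmod_ge0// ltW.
split; last by move=> n Hn; apply: Hmin; exact: le_trans Hn (cmod_denom_ge aD wD).
(* At j = 0 there is no larger scale to compare with, and |1 - conj(a) w| <= 2 serves instead. *)
case: j Hj Hmin => [|j] Hj Hmin.
  by rewrite /h expr0 mulr1; have := cmod_denom_le2 aD wD; rewrite -/m; lra.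
have : ~~ (h j <= m) by apply/negP => /Hmin; rewrite ltnn.
rewrite -ltNge => /ltW H; apply: le_trans H _.
have -> : h j = 2 * h j.+1 by rewrite /h exprS mulrA mulfV ?mul1r// pnatr_eq0.
by rewrite ler_pM2r// ler_nat.
Qed.

(** The term at the scale of w already dominates; the other terms are nonnegative and make the
    right-hand side independent of that scale. Each of the factors m^(t - s) and m^(-t) costs
    4^t. *)
Lemma dyadic_pointwise a (w : R[i]) s t n : disc a -> disc w -> 0 <= s -> s <= t ->
  h n <= 1 - cmod a ->
  cmod (1 - conjc a * w) `^ (- s) <=
  \sum_(j < n.+1) 4 `^ (2 * t) * h j `^ (t - s) * cmod (1 - conjc (dpt a j) * w) `^ (- t).
Proof.
move=> aD wD s0 st hn.
have [j [j1 j2 [j3 j4]]] := dyadic_point aD wD.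
set m := cmod (1 - conjc a * w) in j1 j2 j3 *.
have m0 : 0 < m by exact: cmod_denom_gt0.
have mj0 : 0 < cmod (1 - conjc (dpt a j) * w) by apply: cmod_denom_gt0 => //; exact: dpt_disc.
have jn : (j < n.+1)%N by rewrite ltnS; exact: j4.
rewrite (bigD1 (Ordinal jn))//= -[leLHS]addr0; apply: lerD; last first.
  by apply: sumr_ge0 => i _; rewrite !mulr_ge0 ?powR_ge0.
have t0 : 0 <= t by exact: le_trans st.
have ts : 0 <= t - s by rewrite subr_ge0.
have -> : m `^ (- s) = m `^ (t - s) * m `^ (- t).
  by rewrite -powRDp//; congr (_ `^ _); ring.
have A1 : m `^ (t - s) <= 4 `^ t * h j `^ (t - s).
  apply: (@le_trans _ _ ((4 * h j) `^ (t - s))).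
    by apply: ge0_ler_powR => //; rewrite nnegrE ?mulr_ge0// ltW.
  rewrite powRM ?(ltW (h_gt0 _))// ler_wpM2r ?powR_ge0//.
  apply: ler_powR; first by rewrite ler1n.
  by rewrite gerBl.
have A2 : m `^ (- t) <= 4 `^ t * cmod (1 - conjc (dpt a j) * w) `^ (- t).
  apply: (@le_trans _ _ ((4^-1 * cmod (1 - conjc (dpt a j) * w)) `^ (- t))).
    apply: powRN_le => //; first by rewrite mulr_gt0.
    by rewrite ler_pdivrMl//; apply: le_trans j2 _; rewrite ler_pM2r// ler_nat.
  rewrite powRM ?(ltW mj0)// -powR_inv1// -powRrM mulN1r opprK lexx//.
apply: le_trans (ler_pM _ _ A1 A2) _; rewrite ?powR_ge0//.
have -> : 4 `^ (2 * t) = 4 `^ t * 4 `^ t :> R.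
  by rewrite -powRDp//; congr (_ `^ _); ring.
by apply: le_of_eq; ring.
Qed.

Lemma geometric_sum_le (x : R) n : 1 < x -> \sum_(j < n.+1) x ^+ j <= x / (x - 1) * x ^+ n.
Proof.
move=> x1; have x0 : 0 < x - 1 by rewrite subr_gt0.
rewrite -(ler_pM2l x0) -subrX1.
have -> : (x - 1) * (x / (x - 1) * x ^+ n) = x ^+ n.+1.
  by rewrite exprS; field; exact: lt0r_neq0.
by rewrite gerBl.
Qed.

Local Open Scope ereal_scope.

Lemma measurable_kernel (b : R[i]) t : measurable_fun disc2
  (fun w : plane R => cmod (1 - conjc b * toC w)%R `^ (- t))%R.
Proof.
apply: (measurableT_comp (@measurable_powR R (- t))).
exact: (cmeas_cmod (cmeas_Hol (@Hol_denom R b))).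
Qed.

(** This lowers the kernel exponent from t to s. By 1 - |b|^2 >= 2^-j the j-th term of the dyadic
    sum is at most of order 2^(jk), with k = e - t + s. As k > 0, the geometric sum is governed by
    its last term, where 2^-n is comparable with 1 - |a|. *)
Lemma dyadic_integral s t e : (0 <= s)%R -> (s <= t)%R -> (0 <= e)%R -> (0 < e - t + s)%R ->
  exists2 C : R, (0 <= C)%R & forall (u : plane R -> R) (L : R),
    measurable_fun disc2 u -> (forall w, 0 <= u w)%R -> (0 <= L)%R ->
    (forall b, disc b -> \int[area]_(w in disc2)
       (u w * cmod (1 - conjc b * toC w) `^ (- t))%:E <= (L * (1 - cmod b ^+ 2) `^ (- e))%:E) ->
    forall a, disc a -> \int[area]_(w in disc2)
       (u w * cmod (1 - conjc a * toC w) `^ (- s))%:E <=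
       (C * L * (1 - cmod a ^+ 2) `^ (- (e - t + s)))%:E.
Proof.
move=> s0 st e0; set k := (e - t + s)%R => k0.
pose x : R := (2 `^ k)%R.
have x1 : (1 < x)%R.
  have := @gt0_ltr_powR R k k0 1%R 2%R; rewrite powR1 => -> //; rewrite ?nnegrE//.
  by rewrite ltr1n.
have x0 : (0 < x - 1)%R by rewrite subr_gt0.
pose C : R := (4 `^ (2 * t) * (x / (x - 1)) * 4 `^ k)%R.
exists C.
  by rewrite /C !mulr_ge0 ?powR_ge0// ?invr_ge0 ltW// (lt_trans _ x1).
move=> u L mu' u0 L0 Hu a aD.
have d0 : (0 < 1 - cmod a)%R by rewrite subr_gt0.
have [n [hn1 /(_ _) hn2]] := dyadic_depth d0.
have {}hn2 : (1 - cmod a <= 2 * h n)%R by apply: hn2; rewrite gerBl cmod_ge0.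
pose F (j : nat) (w : plane R) : \bar R := (4 `^ (2 * t) * h j `^ (t - s))%:E *
   (u w * cmod (1 - conjc (dpt a j) * toC w)%R `^ (- t))%:E.
have mF j : measurable_fun disc2 (F j).
  apply: emeasurable_funM; first exact: measurable_cst.
  by apply/measurable_EFinP; apply: measurable_funM => //; exact: measurable_kernel.
have F0 j w : 0 <= F j w.
  by apply: mule_ge0; rewrite lee_fin mulr_ge0// powR_ge0.
apply: (@le_trans _ _ (\int[area]_(w in disc2) (\sum_(j < n.+1) F j w))).
  apply: ge0_le_integral => //.
  - exact: measurable_disc2.
  - by move=> w _; rewrite lee_fin mulr_ge0// powR_ge0.
  - by apply/measurable_EFinP; apply: measurable_funM => //; exact: measurable_kernel.
  - by apply: emeasurable_sum => j; exact: mF.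
  move=> w wD; rewrite /F; under eq_bigr do rewrite -EFinM.
  rewrite sumEFin lee_fin.
  apply: (@le_trans _ _ (u w * \sum_(j < n.+1) 4 `^ (2 * t) * h j `^ (t - s) *
      cmod (1 - conjc (dpt a j) * toC w)%R `^ (- t))%R).
    by rewrite ler_wpM2l//; exact: dyadic_pointwise.
  rewrite mulr_sumr; apply: ler_sum => j _.
  by apply: le_of_eq; rewrite mulrCA.
rewrite (@ge0_integral_sum _ _ _ area _ (@measurable_disc2 R) _ (fun (j : 'I_n.+1) w => F j w))//.
have step1 j : \int[area]_(w in disc2) F j w <=
    (4 `^ (2 * t) * L * x ^+ j)%:E.
  rewrite /F ge0_integralZl//; last 4 first.
  - exact: measurable_disc2.
  - by apply/measurable_EFinP; apply: measurable_funM => //; exact: measurable_kernel.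
  - by move=> w _; rewrite lee_fin mulr_ge0// powR_ge0.
  - by rewrite lee_fin mulr_ge0// powR_ge0.
  apply: (@le_trans _ _ ((4 `^ (2 * t) * h j `^ (t - s))%:E *
     (L * (1 - cmod (dpt a j) ^+ 2) `^ (- e))%:E)).
    apply: lee_wpmul2l; first by rewrite lee_fin mulr_ge0// powR_ge0.
    by apply: Hu; exact: dpt_disc.
  rewrite -EFinM lee_fin.
  have A : ((1 - cmod (dpt a j) ^+ 2) `^ (- e) <= h j `^ (- e))%R.
    by apply: powRN_le => //; exact: one_sub_dpt.
  have B : (h j `^ (t - s) * h j `^ (- e) = x ^+ j)%R.
    rewrite -powRDp// /x -h_powRN; congr (_ `^ _)%R; rewrite /k; ring.
  apply: (@le_trans _ _ (4 `^ (2 * t) * h j `^ (t - s) * (L * h j `^ (- e)))%R).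
    by rewrite ler_wpM2l ?mulr_ge0 ?powR_ge0// ler_wpM2l.
  by rewrite -B; apply: le_of_eq; ring.
apply: (@le_trans _ _ (\sum_(j < n.+1) ((4 `^ (2 * t) * L * x ^+ j)%R)%:E)).
  by apply: lee_sum => j _; exact: step1.
rewrite sumEFin lee_fin -mulr_sumr.
apply: (@le_trans _ _ (4 `^ (2 * t) * L * (x / (x - 1) * x ^+ n))%R).
  by rewrite ler_wpM2l ?mulr_ge0 ?powR_ge0//; exact: geometric_sum_le.
(* 1 - |a|^2 <= 2 (1 - |a|) <= 4 h n. *)
have xn : (x ^+ n <= 4 `^ k * (1 - cmod a ^+ 2) `^ (- k))%R.
  rewrite /x -h_powRN.
  have -> : (4 `^ k * (1 - cmod a ^+ 2) `^ (- k) = (4^-1 * (1 - cmod a ^+ 2)) `^ (- k))%R.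
    by rewrite powRM ?invr_ge0 ?(ltW (one_sub_sqr_gt0 aD))// -powR_inv1// -powRrM mulN1r opprK.
  apply: powRN_le; first exact: ltW.
    by rewrite mulr_gt0 ?invr_gt0// one_sub_sqr_gt0.
  rewrite ler_pdivrMl//; have := cmod_ge0 a; have : (cmod a < 1)%R by [].
  by rewrite expr2; nra.
rewrite /C; apply: (@le_trans _ _ (4 `^ (2 * t) * L * (x / (x - 1) * (4 `^ k * (1 - cmod a ^+ 2) `^ (- k))))%R).
  rewrite ler_wpM2l ?mulr_ge0 ?powR_ge0// ler_wpM2l// mulr_ge0 ?invr_ge0 ?ltW//.
  exact: lt_trans x1.
by apply: le_of_eq; ring.
Qed.

End Dyadic.

(** * Area integrals of Cauchy kernels *)

Section MorreyMultipliers.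
Context {R : realType}.
Implicit Types (f g : R[i] -> R[i]) (a b : R[i]) (p q t N M : R).
Local Notation mu := (@lebesgue_measure R).
Local Open Scope ereal_scope.

Lemma measurable_denom_indic b (r : R) : measurable_fun disc2 (fun w : plane R =>
  ((cmod (1 - conjc b * toC w)%R <= r)%R%:R : R)%:E).
Proof.
apply/measurable_EFinP.
apply: (@measurableT_comp _ _ _ _ _ _ (fun c : bool => (c%:R : R))) => //.
apply: measurable_fun_ler => //.
exact: (cmeas_cmod (cmeas_Hol (@Hol_denom R b))).
Qed.

(** The affine map w -> 1 - conj(b) w sends the set into a square of side 2 r and multiplies areas
    by |b|^2. *)
Lemma area_denom_le b (r : R) : (0 < r)%R -> b != 0%R ->
  \int[area]_(w in disc2) ((cmod (1 - conjc b * toC w)%R <= r)%R%:R)%:E <=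
  (pi^-1 * (cmod b ^- 2 * (2 * r) ^+ 2))%:E.
Proof.
move=> r0 b0.
pose S := (`[(- r)%R, r]%classic `*` `[(- r)%R, r]%classic : set (plane R)).
have mS : measurable S by apply: measurableX; exact: measurable_itv.
pose f (p : plane R) : \bar R := (\1_S p)%:E.
have mf : measurable_fun setT f by apply/measurable_EFinP; exact: measurable_indic.
have f0 (p : plane R) : 0 <= f p by rewrite lee_fin.
have c0 : (- conjc b != 0)%R by rewrite oppr_eq0 -cmod_eq0 cmod_conj cmod_eq0.
have mD := @measurable_disc2 R.
have mg : measurable_fun setT (fun p : plane R => f (ofC (- conjc b * toC p + 1)%R)).
  apply: (measurableT_comp mf); exact: measurable_affC.
have m1 := measurable_denom_indic b r.
rewrite integral_area// EFinM; apply: lee_wpmul2l.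
  by rewrite lee_fin invr_ge0 pi_ge0.
apply: (@le_trans _ _ (\int[mu \x mu]_(w in disc2) f (ofC (- conjc b * toC w + 1)%R))).
  apply: ge0_le_integral => //.
  - exact: measurable_funTS.
  - move=> w wD; rewrite lee_fin; case: (boolP (_ <= r)%R) => //= H.
    suff -> : \1_S (ofC (- conjc b * toC w + 1)%R) = 1%R :> R by [].
    rewrite indicE mem_set// /S addrC mulNr.
    move: H; set z := (1 - _)%R => H; split; rewrite /= in_itv /= -ler_norml.
      exact: le_trans (cmod_Re _) H.
    exact: le_trans (cmod_Im _) H.
apply: (@le_trans _ _ (\int[mu \x mu]_w f (ofC (- conjc b * toC w + 1)%R))).
  by apply: ge0_subset_integral.
rewrite integral_affC// cmodN cmod_conj EFinM.
apply: lee_wpmul2l; first by rewrite lee_fin invr_ge0 sqr_ge0.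
have -> : \int[mu \x mu]_p f p = (mu \x mu)%E S by rewrite /f integral_indic// setIT.
rewrite product_measure1E//=.
rewrite !lebesgue_measure_itv /= !lte_fin.
have -> : (- r < r)%R by lra.
by rewrite -EFinD -EFinM lee_fin; apply: le_of_eq; ring.
Qed.

Lemma geometric_half_sum n : (\sum_(j < n.+1) (2^-1 : R) ^+ j <= 2)%R.
Proof.
suff -> : (\sum_(j < n.+1) (2^-1 : R) ^+ j = 2 - 2^-1 ^+ n)%R by rewrite gerBl exprn_ge0.
elim: n => [|n IH]; first by rewrite big_ord_recl big_ord0 addr0 !expr0; ring.
by rewrite big_ord_recr /= IH exprS; field.
Qed.

Lemma area_disc_fin : area (@disc2 R) < +oo.
Proof.
rewrite /area /= /mscale /=; apply: lte_mul_pinfty => //.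
  by rewrite lee_fin invr_ge0 pi_ge0.
apply: unit_square_finite; first exact: measurable_disc2.
by move=> w wD; split; apply/ltW; [exact: le_lt_trans (cmod_Re (toC w)) wD|exact: le_lt_trans (cmod_Im (toC w)) wD].
Qed.

(** Where |1 - conj(b) w| is of order 2^-j the integrand is at most 2^j because t <= 1, while the
    area is of order 4^-j; the products are summable uniformly in b. *)
Lemma denom_integral t : (0 <= t <= 1)%R -> exists2 K : R, (0 <= K)%R & forall b, disc b ->
  \int[area]_(w in disc2) (cmod (1 - conjc b * toC w)%R `^ (- t))%:E <= K%:E.
Proof.
move=> /andP[t0 t1].
pose A : R := fine (area (@disc2 R)).
have AE : area (@disc2 R) = A%:E.
  by rewrite /A fineK// ge0_fin_numE ?area_disc_fin.
have A0 : (0 <= A)%R by apply: fine_ge0.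
have pi0 : (0 <= (pi : R)^-1)%R by rewrite invr_ge0 pi_ge0.
have mD := @measurable_disc2 R.
(* 64 comes from the squared side 2 r at r = 4 h_j in [area_denom_le], and 4 bounds |b|^-2 when |b|
   > 1/2. For |b| <= 1/2 the integrand is at most 2, whence the term 2 A below. *)
have [P P0 PE] : exists2 P : R, (0 <= P)%R & P = (64 * pi^-1 * 4)%R.
  by eexists; last reflexivity; apply: mulr_ge0; [apply: mulr_ge0|]; rewrite ?ler0n.
exists (2 * A + P * 2)%R; first by apply: addr_ge0; apply: mulr_ge0.
move=> b bD; have [b2|b2] := leP (cmod b) (2^-1)%R.
  apply: (@le_trans _ _ (\int[area]_(w in disc2) (cst (2%:R)%:E w))).
    apply: ge0_le_integral => //.
    - by move=> w _; rewrite lee_fin powR_ge0.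
    - by apply/measurable_EFinP; exact: measurable_kernel.
    - move=> w wD; rewrite lee_fin.
      have H : (2^-1 <= cmod (1 - conjc b * toC w))%R.
        by apply: le_trans (cmod_denom_ge bD wD); lra.
      apply: (@le_trans _ _ ((2^-1) `^ (- t))%R).
        by apply: powRN_le => //; rewrite invr_gt0.
      rewrite -powR_inv1// -powRrM mulN1r opprK.
      by apply: (@le_trans _ _ (2 `^ 1)%R); [apply: ler_powR => //; rewrite ler1n|rewrite powRr1].
  by rewrite integral_cst// AE -EFinM lee_fin lerDl; apply: mulr_ge0.
have b0 : b != 0%R by rewrite -cmod_eq0 gt_eqF//; apply: lt_trans b2; rewrite invr_gt0.
have d0 : (0 < 1 - cmod b)%R by rewrite subr_gt0.
have [n [hn1 _]] := dyadic_depth d0.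
pose h (j : nat) : R := (2^-1 ^+ j)%R.
have h0 j : (0 < h j)%R by rewrite exprn_gt0.
pose F (j : nat) (w : plane R) : \bar R :=
  (h j)^-1%:E * ((cmod (1 - conjc b * toC w)%R <= 4 * h j)%R%:R)%:E.
have mF j : measurable_fun disc2 (F j).
  by apply: emeasurable_funM; [exact: measurable_cst|exact: measurable_denom_indic].
have F0 j w : 0 <= F j w by apply: mule_ge0; rewrite lee_fin// invr_ge0 ltW.
apply: (@le_trans _ _ (\int[area]_(w in disc2) (\sum_(j < n.+1) F j w))).
  apply: ge0_le_integral => //.
  - by move=> w _; rewrite lee_fin powR_ge0.
  - by apply/measurable_EFinP; exact: measurable_kernel.
  - by apply: emeasurable_sum => j; exact: mF.
  move=> w wD; have [j [j1 _ [j2 j3]]] := dyadic_point bD wD.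
  have jn : (j < n.+1)%N by rewrite ltnS; exact: j3.
  rewrite (bigD1 (Ordinal jn))//= -[leLHS]adde0; apply: leeD; last first.
    by apply: sume_ge0 => i _.
  rewrite /F /h j2 mule1 lee_fin.
  apply: (@le_trans _ _ (h j `^ (- t))%R); first exact: powRN_le.
  rewrite powRN lef_pV2 ?posrE ?powR_gt0// -[leLHS]powRr1 ?(ltW (h0 j))//.
  by apply: ger_powR => //; rewrite h0 /h exprn_ile1// invf_le1// ler1n.
rewrite (@ge0_integral_sum _ _ _ area _ mD _ (fun (j : 'I_n.+1) w => F j w))//.
have step1 j : \int[area]_(w in disc2) F j w <= (P * h j)%:E.
  rewrite /F ge0_integralZl//; last 2 first.
  - exact: measurable_denom_indic.
  - by rewrite lee_fin invr_ge0 ltW.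
  have h40 : (0 < 4 * h j)%R by rewrite mulr_gt0.
  apply: (@le_trans _ _ ((h j)^-1%:E * (pi^-1 * (cmod b ^- 2 * (2 * (4 * h j)) ^+ 2))%:E)).
    apply: lee_wpmul2l; first by rewrite lee_fin invr_ge0 ltW.
    exact: area_denom_le.
  rewrite -EFinM lee_fin.
  have B : (cmod b ^- 2 <= 4)%R.
    rewrite invf_ple ?posrE ?exprn_gt0//; last by apply: lt_trans b2; rewrite invr_gt0.
    by have : (2^-1 ^+ 2 <= cmod b ^+ 2)%R; [rewrite ler_pXn2r// ?nnegrE ?cmod_ge0 ?ltW//|rewrite !expr2; lra].
  have -> : ((h j)^-1 * (pi^-1 * (cmod b ^- 2 * (2 * (4 * h j)) ^+ 2)) =
     pi^-1 * (64 * h j) * cmod b ^- 2)%R.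
    by move: (cmod b ^- 2)%R (pi^-1)%R => X Y; field; rewrite gt_eqF.
  have -> : (P * h j = pi^-1 * (64 * h j) * 4)%R by rewrite PE; ring.
  apply: ler_wpM2l B; apply: mulr_ge0 => //; apply: mulr_ge0; first exact: ler0n.
  exact: ltW.
apply: (@le_trans _ _ (\sum_(j < n.+1) ((P * h j)%R)%:E)).
  by apply: lee_sum => j _; exact: step1.
rewrite sumEFin lee_fin -mulr_sumr.
apply: (@le_trans _ _ (P * 2)%R).
  by rewrite ler_wpM2l//; exact: geometric_half_sum.
by rewrite lerDr; apply: mulr_ge0.
Qed.

Lemma measurable_forelli_rudin b t : measurable_fun disc2 (fun w : plane R =>
  (1 - cmod (toC w) ^+ 2) `^ t / cmod (1 - conjc b * toC w) ^+ 4)%R.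
Proof.
apply: measurable_funM; last by apply: measurable_funTS; exact: measurable_denom_pow.
apply: (measurableT_comp (@measurable_powR R t)).
by apply: measurable_funB => //; apply: measurable_funTS; exact: mtoC_sqr.
Qed.

Lemma forelli_rudin_ge0 b t (w : plane R) :
  (0 <= (1 - cmod (toC w) ^+ 2) `^ t / cmod (1 - conjc b * toC w) ^+ 4)%R.
Proof. by rewrite mulr_ge0 ?powR_ge0// invr_ge0 exprn_ge0// cmod_ge0. Qed.

(** Up to (1 - |b|^2)^2 the power 4 makes the kernel the Jacobian of phi_b. The substitution leaves
    the integral of (1 - |phi_b|^2)^t, and 1 - |phi_b|^2 <= 2 (1 - |b|^2) / |1 - conj(b) w| reduces
    it to [denom_integral]. *)
Lemma forelli_rudin t : (0 <= t <= 1)%R -> exists2 K : R, (0 <= K)%R & forall b, disc b ->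
  \int[area]_(w in disc2)
    ((1 - cmod (toC w) ^+ 2) `^ t / cmod (1 - conjc b * toC w)%R ^+ 4)%:E <=
  (K * (1 - cmod b ^+ 2) `^ (t - 2))%:E.
Proof.
move=> t01; have /andP[t0 _] := t01; have [K K0 HK] := denom_integral t01.
have mD := @measurable_disc2 R.
exists (2 `^ t * K)%R; first by rewrite mulr_ge0 ?powR_ge0.
move=> b bD; have b0 := one_sub_sqr_gt0 bD; set B := (1 - cmod b ^+ 2)%R in b0 *.
pose u (w : plane R) : \bar R := ((1 - cmod (phi b (toC w)) ^+ 2) `^ t)%:E.
have mu' : measurable_fun disc2 u.
  by apply/measurable_EFinP; exact: measurable_weight.
have u0 w : disc2 w -> 0 <= u w by move=> _; rewrite lee_fin powR_ge0.
have E : \int[area]_(w in disc2)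
    ((1 - cmod (toC w) ^+ 2) `^ t / cmod (1 - conjc b * toC w)%R ^+ 4)%:E =
    (B ^- 2)%:E * \int[area]_(w in disc2) u w.
  rewrite -(area_phi bD mu' u0) -ge0_integralZl//; last first.
  - by rewrite lee_fin invr_ge0 sqr_ge0.
  - move=> w wD; apply: mule_ge0; first by apply: u0; rewrite /disc2/preimage/mkset ofCK; exact: phi_disc.
    by rewrite lee_fin mulr_ge0 ?sqr_ge0// invr_ge0 exprn_ge0// cmod_ge0.
  - apply: emeasurable_funM.
      apply/measurable_EFinP.
      apply: (eq_measurable_fun (fun w : plane R => (1 - cmod (toC w) ^+ 2) `^ t)%R).
        by move=> w; rewrite inE => wD; rewrite ofCK phiK.
      apply: (measurableT_comp (@measurable_powR R t)).
      by apply: measurable_funB => //; apply: measurable_funTS; exact: mtoC_sqr.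
    by apply/measurable_EFinP; apply: measurable_funTS; exact: measurable_phi_jac.
  apply: eq_integral => w; rewrite inE => wD.
  rewrite /u ofCK phiK// -!EFinM; congr (_%:E).
  have c0 := cmod_denom_gt0 bD wD.
  rewrite -/B; move: (cmod (1 - _)%R) c0 (_ `^ t)%R => X X0 Y.
  by field; rewrite !gt_eqF.
rewrite E; have -> : (2 `^ t * K * B `^ (t - 2) = B ^- 2 * (B `^ t * 2 `^ t * K))%R.
  rewrite powRDp// powRN powR_mulrn ?(ltW b0)//; ring.
rewrite EFinM; apply: lee_wpmul2l; first by rewrite lee_fin invr_ge0 sqr_ge0.
apply: (@le_trans _ _ (\int[area]_(w in disc2)
    ((B `^ t * 2 `^ t)%:E * (cmod (1 - conjc b * toC w)%R `^ (- t))%:E))).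
  apply: ge0_le_integral => //.
  - apply: emeasurable_funM; first exact: measurable_cst.
    by apply/measurable_EFinP; exact: measurable_kernel.
  move=> w wD; rewrite /u -EFinM lee_fin one_sub_sqr_phi// -/B.
  have c0 := cmod_denom_gt0 bD wD.
  have H : (1 - cmod (toC w) ^+ 2 <= 2 * cmod (1 - conjc b * toC w))%R.
    have := cmod_denom_ge' bD wD; have : (cmod (toC w) < 1)%R by [].
    have := cmod_ge0 (toC w); move: (cmod (1 - _)%R) (cmod _) => X Y.
    by rewrite expr2; nra.
  have w0 := one_sub_sqr_gt0 wD.
  move: (cmod (1 - _)%R) c0 (1 - cmod (toC w) ^+ 2)%R w0 H => X X0 Y Y0 H.
  have -> : (B `^ t * 2 `^ t * X `^ (- t) = (B * 2 * X^-1) `^ t)%R.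
    rewrite !powRM ?mulr_ge0 ?invr_ge0 ?(ltW b0) ?(ltW X0)//.
    by rewrite -[X^-1%R]powR_inv1 ?(ltW X0)// -powRrM mulN1r.
  apply: ge0_ler_powR => //; rewrite ?nnegrE ?mulr_ge0 ?invr_ge0 ?sqr_ge0 ?(ltW b0) ?(ltW X0) ?(ltW Y0)//.
  rewrite ler_pdivrMr ?exprn_gt0//.
  have -> : (B * 2 * X^-1 * X ^+ 2 = B * (2 * X))%R by field; rewrite gt_eqF.
  by rewrite ler_pM2l.
rewrite ge0_integralZl//; last 3 first.
- by apply/measurable_EFinP; exact: measurable_kernel.
- by move=> w _; rewrite lee_fin powR_ge0.
- by rewrite lee_fin mulr_ge0 ?powR_ge0.
rewrite [leRHS]EFinM; apply: lee_wpmul2l; first by rewrite lee_fin mulr_ge0 ?powR_ge0.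
exact: HK.
Qed.

(** * Multiplication operators *)

Lemma integral_scale (X : plane R -> R) (c : R) : (0 <= c)%R ->
  measurable_fun disc2 X -> (forall w, 0 <= X w)%R ->
  \int[area]_(w in disc2) (c * X w)%:E = c%:E * \int[area]_(w in disc2) (X w)%:E.
Proof.
move=> c0 mX X0; have mD := @measurable_disc2 R.
have <- : \int[area]_(w in disc2) (c%:E * (X w)%:E) = c%:E * \int[area]_(w in disc2) (X w)%:E.
  by apply: ge0_integralZl => //; [exact/measurable_EFinP|move=> w _; rewrite lee_fin].
by apply: (@eq_integral _ _ _ area) => w _; rewrite EFinM.
Qed.

Lemma integral_le_lin (X Y Z : plane R -> R) (c d : R) : (0 <= c)%R -> (0 <= d)%R ->
  measurable_fun disc2 X -> measurable_fun disc2 Y -> measurable_fun disc2 Z ->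
  (forall w, 0 <= X w)%R -> (forall w, 0 <= Y w)%R -> (forall w, 0 <= Z w)%R ->
  (forall w, disc2 w -> X w <= c * Y w + d * Z w)%R ->
  \int[area]_(w in disc2) (X w)%:E <=
  c%:E * \int[area]_(w in disc2) (Y w)%:E + d%:E * \int[area]_(w in disc2) (Z w)%:E.
Proof.
move=> c0 d0 mX mY mZ X0 Y0 Z0 H; have mD := @measurable_disc2 R.
have mY' : measurable_fun disc2 (fun w => (Y w)%:E) by exact/measurable_EFinP.
have mZ' : measurable_fun disc2 (fun w => (Z w)%:E) by exact/measurable_EFinP.
have mcY : measurable_fun disc2 (fun w => c%:E * (Y w)%:E).
  by apply: emeasurable_funM => //; exact: measurable_cst.
have mdZ : measurable_fun disc2 (fun w => d%:E * (Z w)%:E).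
  by apply: emeasurable_funM => //; exact: measurable_cst.
have cY0 w : disc2 w -> 0 <= c%:E * (Y w)%:E by move=> _; rewrite mule_ge0// lee_fin.
have dZ0 w : disc2 w -> 0 <= d%:E * (Z w)%:E by move=> _; rewrite mule_ge0// lee_fin.
have EY : \int[area]_(w in disc2) (c%:E * (Y w)%:E) = c%:E * \int[area]_(w in disc2) (Y w)%:E.
  by apply: ge0_integralZl => // w _; rewrite lee_fin.
have EZ : \int[area]_(w in disc2) (d%:E * (Z w)%:E) = d%:E * \int[area]_(w in disc2) (Z w)%:E.
  by apply: ge0_integralZl => // w _; rewrite lee_fin.
rewrite -EY -EZ.
have <- : \int[area]_(w in disc2) (c%:E * (Y w)%:E + d%:E * (Z w)%:E) =
  \int[area]_(w in disc2) (c%:E * (Y w)%:E) + \int[area]_(w in disc2) (d%:E * (Z w)%:E).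
  exact: ge0_integralD.
apply: ge0_le_integral => //.
- by move=> w _; rewrite lee_fin.
- exact/measurable_EFinP.
- exact: emeasurable_funD.
Qed.

Lemma integral_le_scale (X Y : plane R -> R) (c : R) : (0 <= c)%R ->
  measurable_fun disc2 X -> measurable_fun disc2 Y ->
  (forall w, 0 <= X w)%R -> (forall w, 0 <= Y w)%R ->
  (forall w, disc2 w -> X w <= c * Y w)%R ->
  \int[area]_(w in disc2) (X w)%:E <= c%:E * \int[area]_(w in disc2) (Y w)%:E.
Proof.
move=> c0 mX mY X0 Y0 H; rewrite -[leRHS]adde0 -[X in _ + X](mul0e (\int[area]_(w in disc2) (Y w)%:E)).
by apply: integral_le_lin => // w wD; rewrite mul0r addr0; exact: H.
Qed.

Lemma sqr_cmodD_le (x y : R[i]) : (cmod (x + y)%R ^+ 2 <= 2 * cmod x ^+ 2 + 2 * cmod y ^+ 2)%R.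
Proof.
have := cmodD x y; have := cmod_ge0 (x + y)%R; have := cmod_ge0 x; have := cmod_ge0 y.
move: (cmod _) (cmod _) (cmod _) => X Y Z Z0 Y0 X0 H.
have : (X ^+ 2 <= (Y + Z) ^+ 2)%R.
  by rewrite ler_pXn2r// ?nnegrE ?addr_ge0.
by have := sqr_ge0 (Y - Z)%R; rewrite !expr2; lra.
Qed.

Definition cross p f g a : \bar R :=
  \int[area]_(w in disc2) (cmod (f (toC w)) ^+ 2 * wdens p g a w)%:E.

Lemma measurable_cross p f g a : Hol f -> Hol g -> disc a ->
  measurable_fun disc2 (fun w : plane R => cmod (f (toC w)) ^+ 2 * wdens p g a w)%R.
Proof.
move=> Hf Hg aD; apply: measurable_funM; last exact: measurable_wdens.
exact: cmeas_cmod2 (cmeas_Hol Hf).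
Qed.

Lemma cross_ge0 f p g a (w : plane R) : (0 <= cmod (f (toC w)) ^+ 2 * wdens p g a w)%R.
Proof. by rewrite mulr_ge0 ?wdens_ge0 ?sqr_ge0. Qed.

Section BoundedMultiplier.
Variables (g : R[i] -> R[i]) (M : R).
Hypotheses (Hg : Hol g) (M0 : (0 <= M)%R) (gM : forall z, disc z -> (cmod (g z) <= M)%R).

Let gM2 z : disc z -> (cmod (g z) ^+ 2 <= M ^+ 2)%R.
Proof. by move=> zD; rewrite ler_pXn2r// ?nnegrE ?cmod_ge0// gM. Qed.

Lemma energy_mulop_le p f a : Hol f -> disc a ->
  energy p (mulop g f) a <= 2%:E * cross p f g a + (2 * M ^+ 2)%:E * energy p f a.
Proof.
move=> Hf aD; apply: integral_le_lin.
- by [].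
- by rewrite mulr_ge0 ?sqr_ge0.
- exact: (measurable_wdens p (Hol_mul Hg Hf) aD).
- exact: measurable_cross.
- exact: measurable_wdens.
- exact: wdens_ge0.
- exact: cross_ge0.
- exact: wdens_ge0.
move=> w wD; rewrite /wdens cderiv_mul//.
set W := (_ `^ p)%R; have W0 : (0 <= W)%R by exact: powR_ge0.
set x := cderiv g _; set y := cderiv f _; clearbody x y.
have -> : (2 * (cmod (f (toC w)) ^+ 2 * (cmod x ^+ 2 * W)) + 2 * M ^+ 2 * (cmod y ^+ 2 * W) =
  (2 * cmod (x * f (toC w)) ^+ 2 + 2 * (M ^+ 2 * cmod y ^+ 2)) * W)%R.
  by rewrite cmodM; move: (cmod (f _)) (cmod x) (cmod y) => X Y Z; clearbody W; ring.
apply: ler_wpM2r => //; apply: le_trans (sqr_cmodD_le _ _) _.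
rewrite lerD2l ler_pM2l// cmodM exprMn.
by apply: ler_wpM2r; [exact: sqr_ge0|exact: gM2].
Qed.

(** The product rule read backwards, f g' = (gf)' - g f'; it extracts information on g' from the
    boundedness of M_g. *)
Lemma cross_le_energy p f a : Hol f -> disc a ->
  cross p f g a <= 2%:E * energy p (mulop g f) a + (2 * M ^+ 2)%:E * energy p f a.
Proof.
move=> Hf aD; apply: integral_le_lin.
- by [].
- by rewrite mulr_ge0 ?sqr_ge0.
- exact: measurable_cross.
- exact: (measurable_wdens p (Hol_mul Hg Hf) aD).
- exact: measurable_wdens.
- exact: cross_ge0.
- exact: wdens_ge0.
- exact: wdens_ge0.
move=> w wD; rewrite /wdens cderiv_mul//.
set W := (_ `^ p)%R; have W0 : (0 <= W)%R by exact: powR_ge0.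
set x' := cderiv g _; set y := cderiv f _; clearbody x' y.
set x := (x' * f (toC w))%R; set z := (g (toC w) * y)%R.
have -> : (cmod (f (toC w)) ^+ 2 * (cmod x' ^+ 2 * W) =
  cmod ((x + z) + - z)%R ^+ 2 * W)%R.
  by rewrite addrK /x cmodM; move: (cmod (f _)) (cmod x') => X Y; clearbody W; ring.
have -> : (2 * (cmod (x + z) ^+ 2 * W) + 2 * M ^+ 2 * (cmod y ^+ 2 * W) =
  (2 * cmod (x + z) ^+ 2 + 2 * (M ^+ 2 * cmod y ^+ 2)) * W)%R.
  by move: (cmod _) (cmod _) => X Y; clearbody W; ring.
apply: ler_wpM2r => //; apply: le_trans (sqr_cmodD_le _ _) _.
rewrite lerD2l ler_pM2l// cmodN cmodM exprMn.
by apply: ler_wpM2r; [exact: sqr_ge0|exact: gM2].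
Qed.

Lemma bounded_mulop p lambda (C : R) : (0 <= C)%R ->
  (forall f N, Hol f -> DMbound p (p * (1 - lambda)) f N -> forall a, disc a ->
     cross p f g a <= (C * N ^+ 2 * (1 - cmod a ^+ 2) `^ (- (p * (1 - lambda))))%:E) ->
  bounded_operator (DMspace p lambda) (normDM p lambda) (mulop g).
Proof.
move=> C0 HC; set q := (p * (1 - lambda))%R in HC.
(* The square root controls the energies of gf, the summand M its value at 0. *)
pose k : R := (Num.sqrt (2 * C + 2 * M ^+ 2) + M)%R.
have S0 : (0 <= 2 * C + 2 * M ^+ 2)%R by rewrite addr_ge0 ?mulr_ge0 ?sqr_ge0.
have k0 : (0 <= k)%R by rewrite addr_ge0 ?sqrtr_ge0.
have Mk : (M <= k)%R by rewrite lerDr sqrtr_ge0.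
have k2 : (2 * C + 2 * M ^+ 2 <= k ^+ 2)%R.
  by rewrite -[leLHS]sqr_sqrtr// ler_pXn2r ?nnegrE ?sqrtr_ge0// lerDl.
have step f N : Hol f -> DMbound p q f N -> DMbound p q (mulop g f) (k * N).
  move=> Hf HN; have [N0 f0 HE] := HN; split; first exact: mulr_ge0.
    rewrite /mulop cmodM; apply: ler_pM; rewrite ?cmod_ge0//.
    by apply: le_trans (gM disc0) Mk.
  move=> a aD; apply: le_trans (energy_mulop_le p Hf aD) _.
  apply: (@le_trans _ _ (2%:E * (C * N ^+ 2 * (1 - cmod a ^+ 2) `^ (- q))%:E +
     (2 * M ^+ 2)%:E * (N ^+ 2 * (1 - cmod a ^+ 2) `^ (- q))%:E)).
    apply: leeD; apply: lee_wpmul2l; rewrite ?lee_fin ?mulr_ge0 ?sqr_ge0//.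
    - exact: HC.
    - exact: HE.
  rewrite -!EFinM -EFinD lee_fin.
  set B := (_ `^ _)%R; have B0 : (0 <= B)%R by exact: powR_ge0.
  have -> : (2 * (C * N ^+ 2 * B) + 2 * M ^+ 2 * (N ^+ 2 * B) =
     (2 * C + 2 * M ^+ 2) * (N ^+ 2 * B))%R by ring.
  have -> : ((k * N) ^+ 2 * B = k ^+ 2 * (N ^+ 2 * B))%R by ring.
  by apply: ler_wpM2r k2; rewrite mulr_ge0 ?sqr_ge0.
have fin f : DMspace p lambda f -> exists N, [/\ Hol f, (0 <= N)%R,
    normDM p lambda f = N%:E & normDM p lambda (mulop g f) <= (2 * (k * N))%:E].
  move=> [Hf ffin]; have [N N0 NE] := normDM_fin Hf ffin; exists N; split=> //.
  apply: bound_normDM_le; first exact: Hol_mul.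
  by apply: step => //; apply: normDM_le_bound => //; rewrite NE.
split.
- move=> f /fin[N [Hf _ _ H]]; split; first exact: Hol_mul.
  by apply: le_lt_trans H _; rewrite ltry.
- by move=> c f h _ _ z _; rewrite /mulop; ring.
exists (2 * k)%R => f /fin[N [_ _ -> H]].
by rewrite -EFinM -mulrA.
Qed.

End BoundedMultiplier.

(** From |1 - conj(a) w| >= (1 - |a|^2) / 2 in the formula [one_sub_sqr_phi]. *)
Lemma one_sub_phi_powR_le t a (w : R[i]) : (0 <= t)%R -> disc a -> disc w ->
  ((1 - cmod (phi a w) ^+ 2) `^ t <=
   4 `^ t * (1 - cmod a ^+ 2) `^ (- t) * (1 - cmod w ^+ 2) `^ t)%R.
Proof.
move=> t0 aD wD; rewrite one_sub_sqr_phi//.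
have a0 := one_sub_sqr_gt0 aD; have w0 := one_sub_sqr_gt0 wD.
have H := cmod_denom_ge aD wD; have D0 := cmod_denom_gt0 aD wD.
have H1 : (1 - cmod a ^+ 2 <= 2 * cmod (1 - conjc a * w))%R.
  move: H (cmod_ge0 a) (aD : (cmod a < 1)%R); move: (cmod (1 - _)%R) (cmod _) => X Y.
  by rewrite expr2; nra.
move: (1 - cmod a ^+ 2)%R (1 - cmod w ^+ 2)%R (cmod (1 - _)%R) a0 w0 D0 H1 => A W D A0 W0 D0 H1.
have -> : (4 `^ t * A `^ (- t) * W `^ t = (4 * A^-1 * W) `^ t)%R.
  rewrite !powRM ?mulr_ge0 ?invr_ge0 ?(ltW A0) ?(ltW W0)//.
  by rewrite -[A^-1%R]powR_inv1 ?(ltW A0)// -powRrM mulN1r.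
apply: ge0_ler_powR => //; rewrite ?nnegrE ?mulr_ge0 ?invr_ge0 ?sqr_ge0 ?(ltW A0) ?(ltW W0)//.
rewrite ler_pdivrMr ?exprn_gt0//.
have -> : (4 * A^-1 * W * D ^+ 2 = A^-1 * W * (2 * D) ^+ 2)%R by ring.
have -> : (A * W = A^-1 * W * A ^+ 2)%R by field; rewrite gt_eqF.
rewrite ler_wpM2l ?mulr_ge0 ?invr_ge0 ?(ltW A0) ?(ltW W0)//.
by rewrite ler_pXn2r// ?nnegrE ?mulr_ge0 ?(ltW A0) ?(ltW D0).
Qed.

Lemma Q_cross_bound p q g N : (0 < p <= 1)%R -> (0 < q)%R -> Hol g ->
  DMbound (p - q) 0 g N ->
  exists2 C : R, (0 <= C)%R & forall f n, Hol f -> DMbound p q f n -> forall a, disc a ->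
    cross p f g a <= (C * n ^+ 2 * (1 - cmod a ^+ 2) `^ (- q))%:E.
Proof.
move=> /andP[p0 p1] q0 Hg [N0 _ HN].
have p01 : (0 <= p <= 1)%R by rewrite (ltW p0).
have [K K0 HK] := growth p01 q0.
exists (K * 4 `^ q * N ^+ 2)%R; first by rewrite !mulr_ge0 ?powR_ge0 ?sqr_ge0.
move=> f n Hf Hn a aD; have [n0 _ _] := Hn; set A := (1 - cmod a ^+ 2)%R.
have c0 : (0 <= K * n ^+ 2 * 4 `^ q * A `^ (- q))%R.
  by rewrite !mulr_ge0 ?powR_ge0 ?sqr_ge0.
apply: (@le_trans _ _ ((K * n ^+ 2 * 4 `^ q * A `^ (- q))%:E * energy (p - q) g a)).
  apply: integral_le_scale => //.
  - exact: measurable_cross.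
  - exact: measurable_wdens.
  - exact: cross_ge0.
  - exact: wdens_ge0.
  move=> w wD; have w0 := one_sub_sqr_gt0 wD.
  have F0 : (0 < 1 - cmod (phi a (toC w)) ^+ 2)%R.
    by apply: one_sub_sqr_gt0; exact: phi_disc.
  have H1 := HK f n Hf Hn _ wD.
  have H2 := one_sub_phi_powR_le (ltW q0) aD wD; rewrite -/A in H2.
  rewrite /wdens; set F := (1 - _ ^+ 2)%R in F0 H2 *; set W := (1 - _ ^+ 2)%R in w0 H1 H2.
  (* The power p - q is left to the energy of g; F^q yields (1 - |w|^2)^q, which absorbs the growth
     of |f|^2. *)
  have -> : (F `^ p = F `^ (p - q) * F `^ q)%R by rewrite -powRDp// subrK.
  set G := (cmod (cderiv _ _) ^+ 2)%R; set E := (F `^ (p - q))%R.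
  have G0 : (0 <= G)%R by exact: sqr_ge0.
  have E0 : (0 <= E)%R by exact: powR_ge0.
  have -> : (cmod (f (toC w)) ^+ 2 * (G * (E * F `^ q)) =
     (G * E) * (cmod (f (toC w)) ^+ 2 * F `^ q))%R by ring.
  rewrite [leRHS]mulrC; apply: ler_wpM2l; first exact: mulr_ge0.
  apply: le_trans (ler_pM _ _ H1 H2) _; rewrite ?sqr_ge0 ?powR_ge0//.
  have WW : (W `^ (- q) * W `^ q = 1)%R by rewrite -powRDp// addNr powRr0.
  apply: le_of_eq.
  by rewrite -[RHS]mulr1 -WW; ring.
apply: (@le_trans _ _ ((K * n ^+ 2 * 4 `^ q * A `^ (- q))%:E * (N ^+ 2)%:E)).
  apply: lee_wpmul2l; first by rewrite lee_fin.
  by apply: le_trans (HN a aD) _; rewrite oppr0 powRr0 mulr1.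
by rewrite -EFinM lee_fin; apply: le_of_eq; ring.
Qed.

(** * Carleson measures tested on Cauchy kernels *)

Definition cauchy_test b f (z : R[i]) : R[i] := (f z / (1 - conjc b * z))%R.

Lemma cdiff_cauchy_test b f z : Hol f -> disc b -> disc z ->
  cdiff (cauchy_test b f) z
    (cderiv f z / (1 - conjc b * z) + f z * (conjc b / (1 - conjc b * z) ^+ 2))%R.
Proof.
move=> Hf bD zD; have d0 := denom_neq0 bD zD.
apply: cdiffM; first exact: Hol_cdiff.
by have := @cdiffV _ (fun z => 1 - conjc b * z)%R z _ d0 (cdiff_denom b z); rewrite opprK.
Qed.

Lemma Hol_cauchy_test b f : Hol f -> disc b -> Hol (cauchy_test b f).
Proof. by move=> Hf bD; apply: HolP => z zD; eexists; exact: cdiff_cauchy_test. Qed.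

(** [integral_density] applies once the density is cut off outside the disc; the maximum with 0
    makes the constant nonnegative. *)
Lemma carleson_area p g : Wspace p g -> exists2 C : R, (0 <= C)%R &
  forall F, Hol F -> normD2 p F < +oo ->
    \int[area]_(w in disc2) (cmod (F (toC w)) ^+ 2 * dirichlet_density p g w)%:E <=
    C%:E * normD2 p F.
Proof.
move=> [Hg [mu muE [C HC]]]; exists (Num.max C 0%R); first by rewrite le_max lexx orbT.
move=> F HF Ffin; have mD := @measurable_disc2 R.
pose h := (dirichlet_density p g) \_ disc2.
have mh : measurable_fun setT h.
  by apply: (measurable_restrictT _ mD).1; exact: measurable_density.
have h0 w : (0 <= h w)%R by rewrite /h patchE; case: ifP => // _; exact: density_ge0.
pose u (w : plane R) : \bar R := (cmod (F (toC w)) ^+ 2)%:E.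
have mu' : measurable_fun disc2 u.
  by apply/measurable_EFinP; exact: (cmeas_cmod2 (cmeas_Hol HF)).
have u0 w : 0 <= u w by rewrite lee_fin sqr_ge0.
have E : forall A, measurable A -> mu A = \int[area]_(x in A) (h x)%:E.
  move=> A mA; rewrite muE// [LHS]integral_mkcondr; apply: (@eq_integral _ _ _ area A) => w _.
  by rewrite /h !patchE; case: ifP.
have muf : measurable_fun setT (u \_ disc2).
  by apply: (measurable_restrictT _ mD).1.
have uf0 w : 0 <= (u \_ disc2) w by rewrite erestrict_ge0.
have := @integral_density _ _ R area h mh h0 mu _ E muf uf0.
rewrite -integral_mkcond => H.
have -> : \int[area]_(w in disc2) (cmod (F (toC w)) ^+ 2 * dirichlet_density p g w)%:E =
    \int[mu]_(w in disc2) u w.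
  rewrite H [LHS]integral_mkcond; apply: (@eq_integral _ _ _ area setT) => w _.
  by rewrite /h !patchE; case: ifP => _; rewrite ?mul0e// EFinM.
apply: (le_trans (HC F (conj HF Ffin))).
apply: lee_wpmul2r; last by rewrite lee_fin le_max lexx.
apply: adde_ge0; first by rewrite lee_fin sqr_ge0.
by apply: integral_ge0 => w _; rewrite lee_fin density_ge0.
Qed.

Lemma weight_denom p b (w : R[i]) : disc b -> disc w ->
  ((1 - cmod (phi b w) ^+ 2) `^ p =
   (1 - cmod b ^+ 2) `^ p * ((1 - cmod w ^+ 2) `^ p * cmod (1 - conjc b * w) `^ (- (2 * p))))%R.
Proof.
move=> bD wD; rewrite one_sub_sqr_phi//.
have b0 := one_sub_sqr_gt0 bD; have w0 := one_sub_sqr_gt0 wD; have D0 := cmod_denom_gt0 bD wD.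
rewrite !powRM ?mulr_ge0 ?invr_ge0 ?sqr_ge0 ?(ltW b0) ?(ltW w0)// -mulrA; congr (_ * (_ * _))%R.
by rewrite -powR_inv1 ?sqr_ge0// -powR_mulrn ?(ltW D0)// -!powRrM; congr (_ `^ _)%R; ring.
Qed.

Lemma cross_weight p f g b : Hol f -> Hol g -> disc b ->
  cross p f g b = ((1 - cmod b ^+ 2) `^ p)%:E *
    \int[area]_(w in disc2) (cmod (f (toC w)) ^+ 2 * dirichlet_density p g w *
       cmod (1 - conjc b * toC w) `^ (- (2 * p)))%:E.
Proof.
move=> Hf Hg bD; have mD := @measurable_disc2 R.
rewrite -integral_scale; last 3 first.
- exact: powR_ge0.
- apply: measurable_funM; last exact: measurable_kernel.
  by apply: measurable_funM; [exact: (cmeas_cmod2 (cmeas_Hol Hf))|exact: measurable_density].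
- by move=> w; rewrite mulr_ge0 ?powR_ge0// mulr_ge0 ?sqr_ge0 ?density_ge0.
apply: (@eq_integral _ _ _ area) => w; rewrite inE => wD; congr (_%:E).
rewrite /wdens /dirichlet_density weight_denom//.
set x := cderiv g _; clearbody x; ring.
Qed.

(** With d = 1 - conj(b) w, the derivative f' / d + f conj(b) / d^2 gives two integrals. The first
    is compared with E(f, b). In the second the growth bound leaves (1 - |w|^2)^(p - q) / |d|^4, a
    Forelli-Rudin integral with exponent p - q between 0 and 1. *)
Lemma test_norm_bound p q : (0 < q)%R -> (q < p)%R -> (p < 1)%R ->
  exists2 C : R, (0 <= C)%R & forall f n, Hol f -> DMbound p q f n -> forall b, disc b ->
    normD2 p (cauchy_test b f) <= (C * n ^+ 2 * (1 - cmod b ^+ 2) `^ (p - q - 2))%:E.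
Proof.
move=> q0 qp p1; have p0 : (0 < p)%R by exact: lt_trans qp.
have p01 : (0 <= p <= 1)%R by rewrite !ltW.
have [K K0 HK] := growth p01 q0.
have [K' K'0 HK'] := @forelli_rudin (p - q)%R ltac:(apply/andP; split; lra).
(* In order: the value at 0, the term with f' and the term with f / d^2. *)
exists (1 + 2 * 4 + 2 * (K * K'))%R; first by rewrite !addr_ge0// mulr_ge0// mulr_ge0.
move=> f n Hf Hn b bD; have [n0 f0 HE] := Hn.
have b0 := one_sub_sqr_gt0 bD.
have HF := Hol_cauchy_test Hf bD.
set B := (1 - cmod b ^+ 2)%R in b0 *.
have B1 : (B <= 1)%R by rewrite gerBl sqr_ge0.
pose Y (w : plane R) : R := wdens p f b w.
pose Z (w : plane R) : R := ((1 - cmod (toC w) ^+ 2) `^ (p - q) / cmod (1 - conjc b * toC w) ^+ 4)%R.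
have mY : measurable_fun disc2 Y by exact: measurable_wdens.
have mZ : measurable_fun disc2 Z by exact: measurable_forelli_rudin.
have c10 : (0 <= 2 * (4 * B `^ (p - 2)))%R by rewrite !mulr_ge0// powR_ge0.
have c20 : (0 <= 2 * (K * n ^+ 2))%R by rewrite !mulr_ge0.
have I : \int[area]_(w in disc2) (dirichlet_density p (cauchy_test b f) w)%:E <=
    (2 * (4 * B `^ (p - 2)))%:E * \int[area]_(w in disc2) (Y w)%:E +
    (2 * (K * n ^+ 2))%:E * \int[area]_(w in disc2) (Z w)%:E.
  apply: integral_le_lin => //.
  - exact: measurable_density.
  - exact: density_ge0.
  - exact: wdens_ge0.
  - exact: forelli_rudin_ge0.
  move=> w wD; rewrite /dirichlet_density (cdiff_cderiv (cdiff_cauchy_test Hf bD wD)).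
  rewrite /Y /Z /wdens weight_denom// -/B.
  have H1 := HK f n Hf Hn _ wD.
  have w0 := one_sub_sqr_gt0 wD; have D0 := cmod_denom_gt0 bD wD.
  have DB : (B <= 2 * cmod (1 - conjc b * toC w))%R.
    move: (cmod_denom_ge bD wD) (cmod_ge0 b) (bD : (cmod b < 1)%R); rewrite /B.
    by move: (cmod (1 - _)%R) (cmod b) => X y; rewrite expr2; nra.
  have cb1 : (cmod (conjc b) <= 1)%R by rewrite cmod_conj ltW.
  have cb0 := cmod_ge0 (conjc b).
  set x := cderiv f _; set y := f _ in H1 *; set d := (1 - conjc b * toC w)%R in D0 DB *.
  set W := (1 - _ ^+ 2)%R in w0 H1 *; set c := conjc b in cb0 cb1 *.
  clearbody x y d W c; move: B b0 B1 DB {c10 c20 HF} => {}B b0 B1 DB.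
  apply: le_trans (_ : (2 * cmod (x / d) ^+ 2 + 2 * cmod (y * (c / d ^+ 2)) ^+ 2) * W `^ p <= _)%R.
    by apply: ler_wpM2r; [exact: powR_ge0|exact: sqr_cmodD_le].
  rewrite !cmodM !cmodV !cmodX; move: (cmod x) (cmod_ge0 x) => X X0.
  move: (cmod d) D0 DB => D D0 DB.
  rewrite mulrDl; apply: lerD.
    (* B <= 2 D is raised to the power 2 - 2p >= 0, and 2^(2 - 2p) <= 4. *)
    have DD : (D ^- 2 <= 4 * B `^ (p - 2) * (B `^ p * D `^ (- (2 * p))))%R.
      have -> : (4 * B `^ (p - 2) * (B `^ p * D `^ (- (2 * p))) =
        4 * B `^ (- (2 - 2 * p)) * D `^ (- (2 * p)))%R.
        have -> : (- (2 - 2 * p) = (p - 2) + p)%R by ring.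
        by rewrite (powRDp (p - 2) p)//; ring.
      have -> : (D ^- 2 = D `^ (- (2 - 2 * p)) * D `^ (- (2 * p)))%R.
        rewrite -powRDp//.
        have -> : (- (2 - 2 * p) + - (2 * p) = - 2)%R by ring.
        by rewrite powRN powR_mulrn// ltW.
      apply: ler_wpM2r; first exact: powR_ge0.
      have e0 : (0 <= 2 - 2 * p)%R by lra.
      apply: (@le_trans _ _ ((2^-1 * B) `^ (- (2 - 2 * p)))%R).
        by apply: powRN_le => //; [exact: mulr_gt0|rewrite ler_pdivrMl].
      rewrite powRM ?invr_ge0 ?(ltW b0)//; apply: ler_wpM2r; first exact: powR_ge0.
      rewrite -powR_inv1// -powRrM mulN1r opprK.
      have -> : (4 = 2 `^ 2 :> R)%R by rewrite powR_mulrn// -natrX.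
      by apply: ler_powR; [rewrite ler1n|lra].
    have W0 : (0 <= W `^ p)%R by exact: powR_ge0.
    move: (W `^ p)%R W0 DD => Wp Wp0 DD.
    have -> : (2 * (X * D^-1) ^+ 2 * Wp = (2 * X ^+ 2 * Wp) * D ^- 2)%R.
      by rewrite exprMn exprVn; ring.
    have -> : (2 * (4 * B `^ (p - 2)) * (X ^+ 2 * (B `^ p * (Wp * D `^ (- (2 * p))))) =
       (2 * X ^+ 2 * Wp) * (4 * B `^ (p - 2) * (B `^ p * D `^ (- (2 * p)))))%R by ring.
    by apply: ler_wpM2l DD; rewrite mulr_ge0// mulr_ge0// sqr_ge0.
  have -> : (W `^ (p - q) = W `^ (- q) * W `^ p)%R.
    by rewrite -powRDp// addrC.
  have -> : (2 * (cmod y * (cmod c * (D ^+ 2)^-1)) ^+ 2 * W `^ p =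
    (2 * cmod y ^+ 2 * cmod c ^+ 2) * (W `^ p / D ^+ 4))%R.
    by move: (cmod y) (cmod c) (W `^ p)%R => u v z; field; rewrite gt_eqF.
  have -> : (2 * (K * n ^+ 2) * (W `^ (- q) * W `^ p / D ^+ 4) =
    (2 * (K * n ^+ 2 * W `^ (- q)) * 1) * (W `^ p / D ^+ 4))%R by ring.
  apply: ler_wpM2r; first by rewrite mulr_ge0 ?powR_ge0// invr_ge0 exprn_ge0// ltW.
  apply: ler_pM.
  - by rewrite mulr_ge0 ?sqr_ge0.
  - exact: sqr_ge0.
  - by apply: ler_wpM2l.
  - by rewrite exprn_ile1.
have F0 : (cmod (cauchy_test b f 0) ^+ 2 <= n ^+ 2 * B `^ (p - q - 2))%R.
  rewrite /cauchy_test mulr0 subr0 divr1.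
  have e1 : (1 <= B `^ (p - q - 2))%R.
    have -> : (p - q - 2 = - (2 - (p - q)))%R by ring.
    by apply: powRN_ge1; [lra|rewrite b0].
  rewrite -[leLHS]mulr1; apply: ler_pM; rewrite ?sqr_ge0//.
  by rewrite ler_pXn2r// ?nnegrE ?cmod_ge0.
rewrite -lee_fin in F0; rewrite /normD2; apply: (le_trans (leeD F0 I)).
apply: (@le_trans _ _ ((n ^+ 2 * B `^ (p - q - 2))%:E +
   ((2 * (4 * B `^ (p - 2)))%:E * (n ^+ 2 * B `^ (- q))%:E +
    (2 * (K * n ^+ 2))%:E * (K' * B `^ (p - q - 2))%:E))).
  apply: leeD => //; apply: leeD; apply: lee_wpmul2l; rewrite ?lee_fin//.
  - exact: HE.
  - exact: HK'.
rewrite -!EFinM -!EFinD lee_fin.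
have -> : (B `^ (p - q - 2) = B `^ (p - 2) * B `^ (- q))%R.
  by rewrite -powRDp//; congr (_ `^ _)%R; ring.
by apply: le_of_eq; ring.
Qed.

Lemma W_cross_bound p q g : (0 < q)%R -> (q < p)%R -> (p < 1)%R -> Wspace p g ->
  exists2 C : R, (0 <= C)%R & forall f n, Hol f -> DMbound p q f n -> forall a, disc a ->
    cross p f g a <= (C * n ^+ 2 * (1 - cmod a ^+ 2) `^ (- q))%:E.
Proof.
move=> q0 qp p1 gW; have Hg : Hol g by case: gW.
have [Cd Cd0 HCd] := carleson_area gW.
have [Ct Ct0 HCt] := test_norm_bound q0 qp p1.
(* The exponent goes from 2, that of the test functions, to 2p, that of the weight. The resulting
   power is (2 - p + q) - 2 + 2p = p + q, and the factor (1 - |a|^2)^p of the weight reduces it to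
   q. *)
have [Cy Cy0 HCy] := @dyadic_integral R (2 * p)%R 2%R (2 - (p - q))%R
  ltac:(lra) ltac:(lra) ltac:(lra) ltac:(lra).
exists (Cy * (Cd * Ct))%R; first by rewrite !mulr_ge0.
move=> f n Hf Hn a aD; have [n0 _ _] := Hn.
have a0 := one_sub_sqr_gt0 aD.
pose u (w : plane R) : R := (cmod (f (toC w)) ^+ 2 * dirichlet_density p g w)%R.
have mu' : measurable_fun disc2 u.
  by apply: measurable_funM; [exact: (cmeas_cmod2 (cmeas_Hol Hf))|exact: measurable_density].
have u0 w : (0 <= u w)%R by rewrite mulr_ge0 ?sqr_ge0 ?density_ge0.
have L0 : (0 <= Cd * Ct * n ^+ 2)%R by rewrite !mulr_ge0.
have H b : disc b -> \int[area]_(w in disc2)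
    (u w * cmod (1 - conjc b * toC w) `^ (- 2))%:E <=
    (Cd * Ct * n ^+ 2 * (1 - cmod b ^+ 2) `^ (- (2 - (p - q))))%:E.
  move=> bD; have HF := Hol_cauchy_test Hf bD.
  have E : \int[area]_(w in disc2) (u w * cmod (1 - conjc b * toC w) `^ (- 2))%:E =
     \int[area]_(w in disc2)
       (cmod (cauchy_test b f (toC w)) ^+ 2 * dirichlet_density p g w)%:E.
    apply: (@eq_integral _ _ _ area) => w _; congr (_%:E).
    rewrite /u /cauchy_test powRN powR_mulrn ?cmod_ge0// cmodM cmodV exprMn exprVn.
    by rewrite mulrAC.
  have NF := HCt f n Hf Hn b bD.
  rewrite E; apply: (le_trans (HCd _ HF (le_lt_trans NF (ltry _)))).
  apply: (le_trans (lee_wpmul2l _ NF)); first by rewrite lee_fin.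
  rewrite -EFinM lee_fin.
  have -> : (p - q - 2 = - (2 - (p - q)))%R by ring.
  by rewrite !mulrA.
rewrite cross_weight//.
have {H} := HCy u _ mu' u0 L0 H a aD.
have -> : (2 - (p - q) - 2 + 2 * p = p + q)%R by ring.
move=> H; apply: (le_trans (lee_wpmul2l _ H)); first by rewrite lee_fin powR_ge0.
rewrite -EFinM lee_fin.
move: (1 - cmod a ^+ 2)%R a0 => A a0.
have -> : (A `^ (- q) = A `^ p * A `^ (- (p + q)))%R.
  by rewrite -powRDp//; congr (_ `^ _)%R; ring.
by apply: le_of_eq; ring.
Qed.

(** * Necessary conditions on a multiplier *)

Lemma cderiv_cst (c z : R[i]) : cderiv (fun=> c) z = 0%R.
Proof. exact: (cdiff_cderiv (cdiff_cst c z)). Qed.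

Lemma Hol_cst (c : R[i]) : Hol (fun=> c).
Proof. by apply: HolP => z _; exists 0%R; exact: cdiff_cst. Qed.

Lemma DMbound_cst p q : DMbound p q (fun=> 1%R : R[i]) 1.
Proof.
split; rewrite ?cmod1// => a aD.
rewrite /energy (eq_integral (cst 0)) ?integral0.
  by rewrite lee_fin mulr_ge0 ?powR_ge0.
move=> w _; rewrite /wdens cderiv_cst cmod0 expr0n /= mul0r//.
Qed.

Lemma unbounded_expr (x y : R) : (1 < x)%R -> exists n, (y < x ^+ n)%R.
Proof.
move=> x1; have x0 : (0 < x)%R by exact: lt_trans x1.
have [y0|y0] := leP y 0%R; first by exists 0%N; rewrite expr0 (le_lt_trans y0).
have y0' : (0 < y^-1)%R by rewrite invr_gt0.
have /cvgrPdist_lt/(_ _ y0')[n _ /(_ n (leqnn n))] :=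
  @cvg_geometric R 1 x^-1 ltac:(rewrite ger0_norm ?invr_ge0 ?ltW// invf_lt1//).
rewrite /= sub0r normrN mul1r ger0_norm ?exprn_ge0 ?invr_ge0 ?ltW// exprVn.
by rewrite ltf_pV2 ?posrE ?exprn_gt0// => H; exists n.
Qed.

Lemma bounded_operator_Hinfty p lambda g : (0 < p <= 1)%R -> (0 <= lambda < 1)%R -> Hol g ->
  bounded_operator (DMspace p lambda) (normDM p lambda) (mulop g) -> Hinfty g.
Proof.
move=> /andP[p0 p1] /andP[l0 l1] Hg [gX _ [C0 HC0]]; split=> //.
set q := (p * (1 - lambda))%R.
have q0 : (0 < q)%R by rewrite mulr_gt0// subr_gt0.
have [K K0 HK] := @growth R p q ltac:(rewrite (ltW p0)//) q0.
(* At least 1, so that the powers of C can be divided by. *)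
pose C : R := Num.max C0 1%R.
have C1 : (1 <= C)%R by rewrite /C le_max lexx orbT.
have Cg0 : (0 < C)%R by exact: lt_le_trans C1.
have HC f : DMspace p lambda f -> normDM p lambda (mulop g f) <= C%:E * normDM p lambda f.
  move=> Xf; apply: (le_trans (HC0 f Xf)); apply: lee_wpmul2r.
    by apply: normDM_ge0; case: Xf.
  by rewrite lee_fin le_max lexx.
pose pw n : R[i] -> R[i] := fun z => (g z ^+ n)%R.
have pwN n : DMspace p lambda (pw n) /\ normDM p lambda (pw n) <= (C ^+ n * 2)%:E.
  elim: n => [|n [IX IN]].
    have -> : pw 0%N = (fun=> 1%R) by apply/funext => z; rewrite /pw expr0.
    have H : normDM p lambda (fun=> 1%R) <= (C ^+ 0 * 2)%:E.
      apply: (le_trans (bound_normDM_le (@Hol_cst 1%R) (DMbound_cst p _))).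
      by rewrite lee_fin expr0 mulr1 mul1r.
    split; last exact: H.
    split; first exact: Hol_cst.
    exact: le_lt_trans H (ltry _).
  have -> : pw n.+1 = mulop g (pw n) by apply/funext => z; rewrite /pw exprS.
  split; first exact: gX.
  apply: (le_trans (HC _ IX)); apply: (le_trans (lee_wpmul2l _ IN)).
    by rewrite lee_fin ltW.
  by rewrite -EFinM lee_fin exprS mulrA.
exists C => z zD; rewrite leNgt; apply/negP => Hlt.
(* The growth bound is quadratic in the norm of g^n, which is at most 2 C^n; after division by
   C^(2n) the bound no longer depends on n. *)
have B n : ((cmod (g z) / C) ^+ (2 * n) <= K * 4 * (1 - cmod z ^+ 2) `^ (- q))%R.
  have [[Hpw _] /(normDM_le_bound Hpw) HN] := pwN n.
  have := HK _ _ Hpw HN _ zD; rewrite /pw cmodX => H.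
  have Cn0 : (0 < C ^+ n)%R by exact: exprn_gt0.
  have Cn2 : (0 < C ^+ (2 * n))%R by exact: exprn_gt0.
  rewrite expr_div_n ler_pdivrMr// mulnC exprM.
  apply: (le_trans H); rewrite exprM; apply: le_of_eq; ring.
have x1 : (1 < (cmod (g z) / C) ^+ 2)%R.
  by rewrite exprn_egt1// ltr_pdivlMr// mul1r.
have [n] := unbounded_expr (K * 4 * (1 - cmod z ^+ 2) `^ (- q))%R x1.
by rewrite -exprM ltNge B.
Qed.

(** The coefficient normalizes the kernels to bounded norm: its square (1 - |b|^2)^(2 - q) cancels
    the Forelli-Rudin power (1 - |b|^2)^(q - 2). *)
Definition kernel_test q b : R[i] -> R[i] :=
  cauchy_test b (fun=> ((1 - cmod b ^+ 2) `^ (1 - q / 2))%:C%C).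

Lemma kernel_coef q b : disc b ->
  (cmod (((1 - cmod b ^+ 2) `^ (1 - q / 2))%:C%C : R[i]) ^+ 2 = (1 - cmod b ^+ 2) `^ (2 - q))%R.
Proof.
move=> bD; rewrite cmod_real ger0_norm ?powR_ge0// -powR_mulrn ?powR_ge0// -powRrM.
by congr (_ `^ _)%R; field.
Qed.

Lemma kernel_test_bound p q : (0 < q)%R -> (q <= p)%R -> (p <= 1)%R -> exists2 N, (0 <= N)%R &
  forall b, disc b -> DMbound p q (kernel_test q b) N.
Proof.
move=> q0 qp p1.
have [K K0 HK] := @forelli_rudin q ltac:(apply/andP; split; lra).
pose S : R := (4 `^ q * K)%R.
have S0 : (0 <= S)%R by rewrite mulr_ge0 ?powR_ge0.
(* [S] bounds the energies; adding 1 covers the value at 0 and gives S <= (1 + S)^2. *)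
exists (1 + S)%R; first by rewrite addr_ge0.
move=> b bD; have b0 := one_sub_sqr_gt0 bD.
pose c : R[i] := ((1 - cmod b ^+ 2) `^ (1 - q / 2))%:C%C.
have cE : (cmod c ^+ 2 = (1 - cmod b ^+ 2) `^ (2 - q))%R by exact: kernel_coef.
have HF : Hol (kernel_test q b) by exact: (Hol_cauchy_test (@Hol_cst c) bD).
set B := (1 - cmod b ^+ 2)%R in b0 cE.
have B1 : (B <= 1)%R by rewrite gerBl sqr_ge0.
split; first by rewrite addr_ge0.
  rewrite /kernel_test /cauchy_test mulr0 subr0 divr1 cmod_real ger0_norm ?powR_ge0//.
  apply: (@le_trans _ _ (B `^ 0)%R); last by rewrite powRr0 lerDl.
  rewrite -/B.
  by apply: ger_powR; [rewrite b0|lra].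
move=> a aD; have a0 := one_sub_sqr_gt0 aD; set A := (1 - cmod a ^+ 2)%R in a0 *.
pose Z (w : plane R) : R := ((1 - cmod (toC w) ^+ 2) `^ q / cmod (1 - conjc b * toC w) ^+ 4)%R.
have mZ : measurable_fun disc2 Z by exact: measurable_forelli_rudin.
have k0 : (0 <= B `^ (2 - q) * (4 `^ q * A `^ (- q)))%R by rewrite !mulr_ge0 ?powR_ge0.
have I : energy p (kernel_test q b) a <=
    (B `^ (2 - q) * (4 `^ q * A `^ (- q)))%:E * \int[area]_(w in disc2) (Z w)%:E.
  apply: integral_le_scale => //.
  - exact: measurable_wdens.
  - exact: wdens_ge0.
  - exact: forelli_rudin_ge0.
  move=> w wD; rewrite /wdens (cdiff_cderiv (cdiff_cauchy_test (@Hol_cst c) bD wD)).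
  rewrite cderiv_cst mul0r add0r.
  have H2 := one_sub_phi_powR_le (ltW q0) aD wD; rewrite -/A in H2.
  have F0 : (0 < 1 - cmod (phi a (toC w)) ^+ 2)%R.
    by apply: one_sub_sqr_gt0; exact: phi_disc.
  have F1 : (1 - cmod (phi a (toC w)) ^+ 2 <= 1)%R by rewrite gerBl sqr_ge0.
  have D0 := cmod_denom_gt0 bD wD; rewrite /Z.
  have cb1 : (cmod (conjc b) <= 1)%R by rewrite cmod_conj ltW.
  have cb0 := cmod_ge0 (conjc b).
  set d := (1 - conjc b * toC w)%R in D0 *; set F := (1 - cmod (phi _ _) ^+ 2)%R in F0 F1 H2 *.
  set W := (1 - _ ^+ 2)%R in H2 *.
  (* Since F <= 1 and q <= p, the power p may be lowered to q, the one in the target weight (1 -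
     |a|^2)^(-q). *)
  have {}H2 : (F `^ p <= 4 `^ q * A `^ (- q) * W `^ q)%R.
    by apply: le_trans H2; apply: ger_powR => //; rewrite F0.
  rewrite !cmodM cmodV cmodX -[X in (X * _ <= _)%R]/((cmod c * (cmod (conjc b) / cmod d ^+ 2)) ^+ 2)%R.
  rewrite exprMn cE; move: (cmod (conjc b)) cb0 cb1 (cmod d) D0 => x x0 x1 D D0.
  have -> : (B `^ (2 - q) * (x / D ^+ 2) ^+ 2 * F `^ p =
     B `^ (2 - q) / D ^+ 4 * (x ^+ 2 * F `^ p))%R.
    by move: (B `^ _)%R (F `^ _)%R => X Y; field; rewrite gt_eqF.
  have -> : (B `^ (2 - q) * (4 `^ q * A `^ (- q)) * (W `^ q / D ^+ 4) =
     B `^ (2 - q) / D ^+ 4 * (1 * (4 `^ q * A `^ (- q) * W `^ q)))%R by ring.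
  apply: ler_wpM2l; first by rewrite mulr_ge0 ?powR_ge0// invr_ge0 exprn_ge0// ltW.
  by apply: ler_pM; rewrite ?powR_ge0 ?exprn_ge0 ?exprn_ile1.
apply: (le_trans I); apply: (le_trans (lee_wpmul2l _ (HK b bD))); first by rewrite lee_fin.
rewrite -EFinM lee_fin.
have BB : (B `^ (2 - q) * B `^ (q - 2) = 1)%R.
  by rewrite -powRDp// addrC subrKA subrr powRr0.
have -> : (B `^ (2 - q) * (4 `^ q * A `^ (- q)) * (K * B `^ (q - 2)) =
   S * A `^ (- q) * (B `^ (2 - q) * B `^ (q - 2)))%R by rewrite /S; ring.
rewrite BB mulr1; apply: ler_wpM2r; first exact: powR_ge0.
by rewrite expr2; nra.
Qed.

Lemma bounded_operator_Q p lambda g M : (0 < p <= 1)%R -> (0 <= lambda < 1)%R ->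
  Hol g -> (forall z, disc z -> (cmod (g z) <= M)%R) ->
  bounded_operator (DMspace p lambda) (normDM p lambda) (mulop g) -> Qspace p g.
Proof.
move=> /andP[p0 p1] /andP[l0 l1] Hg gM [gX _ [C0 HC0]]; split=> //.
pose q := (p * (1 - lambda))%R.
have q0 : (0 < q)%R by rewrite mulr_gt0// subr_gt0.
have qp : (q <= p)%R by rewrite /q ler_piMr ?(ltW p0)// gerBl.
have M0 : (0 <= M)%R by exact: le_trans (cmod_ge0 _) (gM 0%R disc0).
have [N N0 HN] := kernel_test_bound q0 qp p1.
pose C : R := Num.max C0 0%R.
have C0' : (0 <= C)%R by rewrite /C le_max lexx orbT.
(* The two terms of [cross_le_energy]: the energy of the image under M_g, whose norm is at most C (2
   N), and M^2 times the energy of the kernel itself. *)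
pose S : R := (2 * (C * (2 * N)) ^+ 2 + 2 * M ^+ 2 * N ^+ 2)%R.
have S0 : (0 <= S)%R by rewrite addr_ge0// !mulr_ge0.
have HF b : disc b -> Hol (kernel_test q b).
  by move=> bD; exact: (Hol_cauchy_test (@Hol_cst _) bD).
(* Only the diagonal a = b is tested: there the test function and the weight combine into the single
   kernel |1 - conj(b) w|^-(2p + 2). *)
have cr b : disc b -> cross p (kernel_test q b) g b <= (S * (1 - cmod b ^+ 2) `^ (- q))%:E.
  move=> bD; have H1 := bound_normDM_le (HF b bD) (HN b bD).
  have X1 : DMspace p lambda (kernel_test q b).
    by split; [exact: HF|exact: le_lt_trans H1 (ltry _)].
  have H2 : normDM p lambda (mulop g (kernel_test q b)) <= (C * (2 * N))%:E.
    rewrite EFinM; apply: (le_trans (HC0 _ X1)).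
    apply: (@le_trans _ _ (C%:E * normDM p lambda (kernel_test q b))).
      apply: lee_wpmul2r; first by apply: normDM_ge0; exact: HF.
      by rewrite lee_fin le_max lexx.
    by apply: lee_wpmul2l; rewrite ?lee_fin.
  have Hgf : Hol (mulop g (kernel_test q b)) by case: (gX _ X1).
  have [_ _ /(_ b bD) E2] := normDM_le_bound Hgf H2.
  have [_ _ /(_ b bD) E1] := HN b bD.
  apply: (le_trans (cross_le_energy Hg M0 gM p (HF b bD) bD)).
  have c1 : 0 <= 2%:E :> \bar R by rewrite lee_fin.
  have c2 : 0 <= (2 * M ^+ 2)%:E by rewrite lee_fin !mulr_ge0.
  apply: (le_trans (leeD (lee_wpmul2l c1 E2) (lee_wpmul2l c2 E1))).
  by rewrite -!EFinM -EFinD lee_fin /S -/q; apply: le_of_eq; ring.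
(* The resulting power is (p + 2) - (2p + 2) + 2p = p, which the factor (1 - |a|^2)^p of the weight
   in E(g, a) cancels. *)
have [Cy Cy0 HCy] := @dyadic_integral R (2 * p)%R (2 * p + 2)%R (p + 2)%R
  ltac:(lra) ltac:(lra) ltac:(lra) ltac:(lra).
have H b : disc b -> \int[area]_(w in disc2)
    (dirichlet_density p g w * cmod (1 - conjc b * toC w) `^ (- (2 * p + 2)))%:E <=
    (S * (1 - cmod b ^+ 2) `^ (- (p + 2)))%:E.
  move=> bD; have := cr b bD; rewrite (cross_weight p (HF b bD) Hg bD).
  have b0 := one_sub_sqr_gt0 bD.
  have mJ : measurable_fun disc2 (fun w : plane R =>
      dirichlet_density p g w * cmod (1 - conjc b * toC w) `^ (- (2 * p + 2)))%R.
    by apply: measurable_funM; [exact: measurable_density|exact: measurable_kernel].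
  have J0 (w : plane R) : (0 <= dirichlet_density p g w *
      cmod (1 - conjc b * toC w) `^ (- (2 * p + 2)))%R.
    by rewrite mulr_ge0 ?density_ge0 ?powR_ge0.
  have -> : \int[area]_(w in disc2) (cmod (kernel_test q b (toC w)) ^+ 2 *
      dirichlet_density p g w * cmod (1 - conjc b * toC w) `^ (- (2 * p)))%:E =
      ((1 - cmod b ^+ 2) `^ (2 - q))%:E * \int[area]_(w in disc2)
    (dirichlet_density p g w * cmod (1 - conjc b * toC w) `^ (- (2 * p + 2)))%:E.
    rewrite -(integral_scale (powR_ge0 _ _) mJ J0).
    apply: (@eq_integral _ _ _ area) => w; rewrite inE => wD; congr (_%:E).
    have D0 := cmod_denom_gt0 bD wD.
    rewrite /kernel_test /cauchy_test cmodM cmodV exprMn kernel_coef// exprVn.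
    move: (cmod (1 - _)%R) D0 => D D0.
    have -> : (D `^ (- (2 * p + 2)) = D `^ (- (2 * p)) * D ^- 2)%R.
      rewrite opprD powRDp//; congr (_ * _)%R.
      by rewrite powRN powR_mulrn// ltW.
    by ring.
  move: (1 - cmod b ^+ 2)%R b0 => B b0; rewrite muleA -EFinM.
  have k0 : (0 < B `^ p * B `^ (2 - q))%R by rewrite mulr_gt0 ?powR_gt0.
  have -> : (S * B `^ (- q) = (B `^ p * B `^ (2 - q)) * (S * B `^ (- (p + 2))))%R.
    have -> : (B `^ (- q) = B `^ p * B `^ (2 - q) * B `^ (- (p + 2)))%R.
      by rewrite -!powRDp//; congr (_ `^ _)%R; ring.
    by ring.
  by rewrite [X in _ <= X -> _]EFinM lee_pmul2l// ?lte_fin.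
(* The summand 1 ensures that the energy bound Cy S is at most N'^2. *)
pose N' : R := (cmod (g 0) + (1 + Cy * S))%R.
have CS0 : (0 <= Cy * S)%R by rewrite mulr_ge0.
have g00 := cmod_ge0 (g 0%R).
suff : DMbound p (p * (1 - 1)) g N'.
  move=> /(bound_normDM_le Hg); rewrite -normQE => HQ.
  exact: le_lt_trans HQ (ltry _).
split.
- by rewrite !addr_ge0.
- by rewrite lerDl addr_ge0.
move=> a aD; rewrite subrr mulr0 oppr0 powRr0 mulr1.
have := HCy (dirichlet_density p g) S (measurable_density p Hg) (density_ge0 p g) S0 H a aD.
have -> : (p + 2 - (2 * p + 2) + 2 * p = p)%R by ring.
move=> HE; have a0 := one_sub_sqr_gt0 aD.
(* E(g, a) is the cross term for the constant function 1, which makes [cross_weight] applicable. *)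
have -> : energy p g a = cross p (fun=> 1%R) g a.
  by apply: (@eq_integral _ _ _ area) => w _; rewrite cmod1 expr1n mul1r.
rewrite (cross_weight p (@Hol_cst 1%R) Hg aD).
under eq_integral do rewrite cmod1 expr1n mul1r.
apply: (le_trans (lee_wpmul2l _ HE)); first by rewrite lee_fin powR_ge0.
rewrite -EFinM lee_fin.
move: (1 - cmod a ^+ 2)%R a0 => A a0.
have AA : (A `^ p * A `^ (- p) = 1)%R by rewrite -powRDp// subrr powRr0.
have -> : (A `^ p * (Cy * S * A `^ (- p)) = Cy * S * (A `^ p * A `^ (- p)))%R by ring.
rewrite AA mulr1 /N' expr2; move: (Cy * S)%R (cmod (g 0%R)) CS0 g00 => x y x0 y0; nra.
Qed.

End MorreyMultipliers.

Theorem corollary1 (R : realType) (p lambda : R) (g : R[i] -> R[i]) :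
  0 < p < 1 -> 0 < lambda < 1 -> Hol g ->
  [/\ (Wspace p `&` Hinfty) g ->
        bounded_operator (DMspace p lambda) (normDM p lambda) (mulop g),
      (Qspace (p * lambda) `&` Hinfty) g ->
        bounded_operator (DMspace p lambda) (normDM p lambda) (mulop g)
    & bounded_operator (DMspace p lambda) (normDM p lambda) (mulop g) ->
        (Qspace p `&` Hinfty) g].
Proof.
move=> /andP[p0 p1] /andP[l0 l1] Hg; pose q := p * (1 - lambda).
have q0 : 0 < q by rewrite mulr_gt0// subr_gt0.
(* Here lambda > 0 enters. The difference p - q = p lambda is the Forelli-Rudin exponent in (1) and
   the order of the Q space in (2). *)
have qp : q < p by rewrite /q gtr_pMr// gtrBl.
have p01 : 0 < p <= 1 by rewrite p0 ltW.
split.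
- move=> [gW [_ [M gM]]]; have M0 : 0 <= M by exact: le_trans (cmod_ge0 _) (gM 0 disc0).
  have [C C0 HC] := W_cross_bound q0 qp p1 gW.
  exact: (bounded_mulop Hg M0 gM C0 HC).
- move=> [[_ gQ] [_ [M gM]]]; have M0 : 0 <= M by exact: le_trans (cmod_ge0 _) (gM 0 disc0).
  rewrite normQE in gQ; have [N N0 NE] := normDM_fin Hg gQ.
  have NE1 : (normDM (p * lambda) 1 g <= N%:E)%E by rewrite NE.
  have := normDM_le_bound Hg NE1.
  rewrite subrr mulr0 => HN.
  have E : p - q = p * lambda by rewrite /q; ring.
  rewrite -E in HN.
  have [C C0 HC] := Q_cross_bound p01 q0 Hg HN.
  exact: (bounded_mulop Hg M0 gM C0 HC).
- move=> gB; have l01 : 0 <= lambda < 1 by rewrite ltW.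
  have gI := bounded_operator_Hinfty p01 l01 Hg gB; split=> //.
  by have [_ [M gM]] := gI; exact: (bounded_operator_Q p01 l01 Hg gM gB).
Qed.
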